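(* Let $n\ge 1$, let $m_1,\dots,m_n$ be nonnegative integers, and let $a,b,c,d,z_1,\dots,z_n$ be nonzero complex numbers with $a^2q=bcd$. Then $$\sum_{y_1=0}^{m_1}\cdots\sum_{y_n=0}^{m_n} \Bigg(\frac{\Delta(zq^y)}{\Delta(z)}\prod_{k=1}^n\frac{\theta(az_kq^{y_k+|y|})} {\theta(az_k)}\prod_{1\leq j<k\leq n}\frac{1}{(z_jz_k)_{y_j+y_k}} \prod_{j,k=1}^n\frac{(q^{-m_j}z_k/z_j,q^{m_j}z_jz_k)_{y_k}}{(qz_k/z_j)_{y_k}}$$ $$\times\prod_{j=1}^n\frac{(az_j)_{|y|}(aq/z_j)_{|y|-y_j}} {(aq^{1+m_j}z_j,aq^{1-m_j}/z_j)_{|y|}}\cdot\frac{(b,c,d)_{|y|}} {\prod_{k=1}^n(aqz_k/b,aqz_k/c,aqz_k/d)_{y_k}}\,q^{|y|}\Bigg)$$ $$=\prod_{k=1}^n\frac{(aqz_k,bz_k/a,cz_k/a,dz_k/a)_{m_k}} {(z_k/a,aqz_k/b,aqz_k/c,aqz_k/d)_{m_k}}.$$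
   Context: Fix $p\in\mathbb C$ with $|p|<1$ and $q\in\mathbb C\setminus\{0\}$. For $x\neq 0$ put $\theta(x)=\prod_{j=0}^\infty(1-p^jx)(1-p^{j+1}/x)$ (so $\theta(x)=1-x$ when $p=0$). The elliptic Pochhammer symbol is $(a)_k=\theta(a)\theta(aq)\cdots\theta(aq^{k-1})$ for integers $k\ge 0$, with $(a)_0=1$, and $(a_1,\dots,a_r)_k=(a_1)_k\cdots(a_r)_k$. For $z=(z_1,\dots,z_n)$, the elliptic Vandermonde determinant is $\Delta(z)=\prod_{1\le j<k\le n}z_j\,\theta(z_k/z_j)$, and $zq^y=(z_1q^{y_1},\dots,z_nq^{y_n})$, $|y|=y_1+\dots+y_n$. Standing assumption: all expressions are well-defined, i.e. the parameters are such that no denominator occurring on either side vanishes. *)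

(* Defs.v *)
From mathcomp Require Import all_boot all_order all_algebra.
From mathcomp Require Import all_classical all_reals all_analysis.
From mathcomp Require Export complex.
Import Order.TTheory GRing.Theory Num.Theory numFieldNormedType.Exports.

Set Implicit Arguments.
Unset Strict Implicit.
Unset Printing Implicit Defensive.

Local Open Scope classical_set_scope.
Local Open Scope ring_scope.

(* The definitions are made over an arbitrary numFieldType K because the
   topology (hence limn) is inferred from that structure; they are meant to be
   used at K := R[i] with R : realType. *)

(* Limit of the partial products; at p = 0 the convention 0 ^+ 0 = 1 makes
   every partial product (N > 0) equal to 1 - x. *)
Definition theta (K : numFieldType) (p x : K) : K :=
  limn (fun N : nat =>
    \prod_(0 <= j < N) ((1 - p ^+ j * x) * (1 - p ^+ j.+1 / x))).

Definition epoch (K : numFieldType) (p q a : K) (k : nat) : K :=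
  \prod_(0 <= i < k) theta p (a * q ^+ i).

(* (a_1, ..., a_r)_k *)
Definition epochs (K : numFieldType) (p q : K) (s : seq K) (k : nat) : K :=
  \prod_(a <- s) epoch p q a k.

Definition evandermonde (K : numFieldType) (n : nat) (p : K)
    (z : 'I_n -> K) : K :=
  \prod_(j < n) \prod_(k < n | (j < k)%N) (z j * theta p (z k / z j)).

(* The multi-indices y with 0 <= y_k <= m_k for all k; y k : 'I_(m k).+1
   coerces to nat. *)
Notation multirange m := {dffun forall k, 'I_(m k).+1}.

(* |y| *)
Definition mweight (n : nat) (m : 'I_n -> nat) (y : multirange m) : nat :=
  (\sum_(k < n) y k)%N.

(* Main.v *)
Require Import Defs.
From Stdlib Require Import FunctionalExtensionality.
From mathcomp Require Import all_boot all_order all_algebra ring lra zify.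
Import Order.TTheory GRing.Theory Num.Theory.
Set Implicit Arguments.
Unset Strict Implicit.
Unset Printing Implicit Defensive.
Local Open Scope ring_scope.

(** The identity is first proved in cleared form, i.e. multiplied by the products of
    (aqz_k/b, aqz_k/c, aqz_k/d)_{m_k}, by induction on m_1 + ... + m_n = M.  With a, b and
    cd = a^2q/b fixed, both sides are, as functions of c, combinations of products of M
    functions theta(xc) theta(x cd/c), hence determined by M + 1 generic values.  At
    c = 1 the sum has one term; at c = a q^s z_k with 1 <= s <= m_k, the terms with
    y_k < s vanish and the others form the sum for m_k - s, z_k q^s, (a, b, d) q^s.
    Interpolation rests on Weierstrass' three-term relation, i.e. on the fact that
    theta(xy) theta(x/y) is a kernel of rank two: the finite Jacobi triple product
    exhibits it as a limit of rank-two kernels.  The nodes are distinct only for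
    generic parameters; the general case follows by letting u -> 1 in (au, bu^2, c, d). *)

(** * Interpolation by products of theta functions *)

(** Clearing denominators makes the special values of c usable: at c = a q^s z_k the symbol
    (aqz_k/c)_{y_k} vanishes for y_k >= s, and in the original sum it is a denominator. After
    clearing, the complementary factors stand in the numerator and remove the terms with y_k < s
    instead. Together with c = 1 there are 1 + m_1 + ... + m_n = M + 1 such values, exactly the
    number that interpolation asks for. The interpolation variable is t = c/e with e^2 = cd. Then c
    = et and d = e/t, and the factors in c and d pair up as theta(xt) theta(x/t). The three-term
    relation is obtained without complex analysis. The expansion of theta(xy) theta(x/y) separates x
    from y up to a common parity of two exponents, hence rank two, and a limit of vanishing 3 x 3
    minors vanishes. All limits are explicit estimates with a geometric error, over a field with a
    real absolute value; the same estimates give the continuity needed to leave generic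
    parameters. *)

Section Interpolation.
Variables (K : fieldType) (th : K -> K).

Definition thpair (x t : K) : K := th (x * t) * th (x / t).

(** Divided by [thpair v u * thpair u v], this is Lagrange interpolation of the function [thpair x]
    of t at the two nodes u and v. *)
Hypothesis thW : forall x t u v : K, x != 0 -> t != 0 -> u != 0 -> v != 0 ->
  thpair x t * thpair v u * thpair u v =
  thpair x u * thpair v t * thpair u v + thpair x v * thpair u t * thpair v u.

Definition thprod (xs : seq K) (t : K) : K := \prod_(x <- xs) thpair x t.

Variables (J : finType) (tau : J -> K).
Hypothesis tau_neq0 : forall j, tau j != 0.
Hypothesis tau_sep : forall i j, i != j -> thpair (tau i) (tau j) != 0.

(* Elliptic partial fractions: by induction on [xs], the three-term relation splits the
   new factor at the two nodes [tau i] and [tau v]. *)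
Lemma thprod_lagrange (xs : seq K) (A : {set J}) (t : K) :
  all (fun x : K => x != 0) xs -> #|A| = (size xs).+1 -> t != 0 ->
  thprod xs t = \sum_(i in A) thprod xs (tau i) *
    \prod_(j in A :\ i) (thpair (tau j) t / thpair (tau j) (tau i)).
Proof.
elim: xs A t => [|x xs IH] A t /=.
  move=> _ /eqP /cards1P [i ->] t0.
  by rewrite big_set1 setDv big_set0 /thprod !big_nil mulr1.
move=> /andP[x0 xs0] cA t0.
have /card_gt0P [v vA] : (0 < #|A|)%N by rewrite cA.
have cA' : #|A :\ v| = (size xs).+1.
  by move: cA; rewrite (cardsD1 v) vA add1n => -[].
have E y : thprod (x :: xs) y = thpair x y * thprod xs y.
  by rewrite /thprod big_cons.
have split_h i : i \in A :\ v -> thpair x t =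
    thpair x (tau i) * (thpair (tau v) t / thpair (tau v) (tau i))
  + thpair x (tau v) * (thpair (tau i) t / thpair (tau i) (tau v)).
  rewrite !inE => /andP[iv _].
  have h1 := tau_sep iv; rewrite eq_sym in iv; have h2 := tau_sep iv.
  have W := thW x0 t0 (tau_neq0 i) (tau_neq0 v).
  apply: (mulIf h2); apply: (mulIf h1).
  rewrite W; move: h1 h2.
  move: (thpair x _) (thpair x _) (thpair _ t) (thpair _ t) (thpair _ _) (thpair _ _).
  move=> p1 p2 p3 p4 p5 p6 h5 h6.
  by field; rewrite h5 h6.
rewrite [LHS]E [X in _ * X](IH _ t xs0 cA' t0) mulr_sumr.
under [LHS]eq_bigr => i iA.
  rewrite (split_h i iA) mulrDl.
  over.
rewrite big_split /= (big_setD1 v vA) /= addrC; congr (_ + _).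
  rewrite E (IH _ (tau v) xs0 cA' (tau_neq0 v)) mulr_sumr big_distrl /=.
  apply: eq_bigr => i iA.
  have -> : \prod_(j in (A :\ v) :\ i) (thpair (tau j) t / thpair (tau j) (tau i)) =
      \prod_(j in (A :\ v) :\ i) (thpair (tau j) (tau v) / thpair (tau j) (tau i)) *
      \prod_(j in (A :\ v) :\ i) (thpair (tau j) t / thpair (tau j) (tau v)).
    rewrite -big_split /=; apply: eq_bigr => j; rewrite !inE => /and3P[_ jv _].
    by rewrite [RHS]mulrC [RHS]mulrA divfK //; apply: tau_sep.
  by rewrite [X in _ = _ * X](big_setD1 i iA) /=; ring.
apply: eq_bigr => i iA; rewrite E.
have vAi : v \in A :\ i.
  by move: iA; rewrite !inE vA andbT eq_sym => /andP[].
rewrite [in RHS](big_setD1 v vAi) /=.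
have -> : (A :\ i) :\ v = (A :\ v) :\ i by rewrite !setDDl setUC.
by rewrite [LHS]mulrACA !mulrA; congr (_ * _); rewrite mulrAC.
Qed.

(** The coefficients do not depend on t, so [thprod_lagrange] recovers both sides from their values
    at the nodes by the same linear formula. The products have equal lengths so that one set of
    nodes serves them all. *)
Lemma thprod_interpolation (I : finType) (P : pred I) (k : I -> K)
    (xs : I -> seq K) (k' : K) (ys : seq K) :
  (forall i, P i -> all (fun x : K => x != 0) (xs i)) ->
  (forall i, P i -> size (xs i) = size ys) ->
  all (fun x : K => x != 0) ys -> #|J| = (size ys).+1 ->
  (forall j, \sum_(i | P i) k i * thprod (xs i) (tau j) = k' * thprod ys (tau j)) ->
  forall t, t != 0 -> \sum_(i | P i) k i * thprod (xs i) t = k' * thprod ys t.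
Proof.
move=> xs0 sz ys0 cJ H t t0.
have cT : #|[set: J]| = (size ys).+1 by rewrite cardsT.
rewrite (thprod_lagrange ys0 cT t0) mulr_sumr.
transitivity (\sum_(i | P i) \sum_(j in [set: J]) k i * (thprod (xs i) (tau j) *
    \prod_(l in [set: J] :\ j) (thpair (tau l) t / thpair (tau l) (tau j)))).
  apply: eq_bigr => i Pi; rewrite -mulr_sumr -thprod_lagrange //.
  - exact: xs0.
  - by rewrite cT sz.
rewrite exchange_big /=; apply: eq_bigr => j _.
rewrite mulrA -H mulr_suml; apply: eq_bigr => i _.
by rewrite mulrA.
Qed.

End Interpolation.

(** * The cleared identity *)

Section Pochhammer.
Variables (K : fieldType) (th : K -> K) (q : K).

Definition poch (a : K) (k : nat) : K := \prod_(0 <= i < k) th (a * q ^+ i).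

Lemma poch0 a : poch a 0 = 1.
Proof. by rewrite /poch big_geq. Qed.

Lemma pochS a k : poch a k.+1 = poch a k * th (a * q ^+ k).
Proof. by rewrite /poch big_nat_recr. Qed.

Lemma pochD a k l : poch a (k + l) = poch a k * poch (a * q ^+ k) l.
Proof.
elim: l => [|l IH]; first by rewrite addn0 poch0 mulr1.
by rewrite addnS !pochS IH exprD !mulrA.
Qed.

Lemma pochS_left a k : poch a k.+1 = th a * poch (a * q) k.
Proof. by rewrite -add1n pochD pochS poch0 mul1r expr0 mulr1 expr1. Qed.

Lemma poch_exchange a k l : poch a k * poch (a * q ^+ k) l = poch a l * poch (a * q ^+ l) k.
Proof. by rewrite -!pochD addnC. Qed.

Lemma poch_neq0 a k : (forall i, (i < k)%N -> th (a * q ^+ i) != 0) -> poch a k != 0.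
Proof.
move=> H; rewrite /poch prodf_seq_neq0; apply/allP => i.
by rewrite mem_index_iota => /andP[_ ik]; rewrite H.
Qed.

Lemma poch_factor_neq0 a k i : poch a k != 0 -> (i < k)%N -> th (a * q ^+ i) != 0.
Proof.
rewrite /poch prodf_seq_neq0 => /allP H ik.
by apply: H; rewrite mem_index_iota.
Qed.

Lemma poch_eq0 a k i : (i < k)%N -> th (a * q ^+ i) = 0 -> poch a k = 0.
Proof.
move=> ik E; apply/eqP; apply: contraT => /poch_factor_neq0 /(_ ik).
by rewrite E eqxx.
Qed.

Lemma poch_tail a k l : poch a k != 0 -> (l <= k)%N ->
  poch a k / poch a l = poch (a * q ^+ l) (k - l).
Proof.
move=> H lk.
have E : poch a k = poch a l * poch (a * q ^+ l) (k - l).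
  by rewrite -pochD subnKC.
rewrite E mulrC mulKf //; apply: contra H => /eqP H0.
by rewrite E H0 mul0r.
Qed.

Hypothesis q0 : q != 0.
Hypothesis thV : forall x, x != 0 -> th x^-1 = - th x / x.

(* Constant of the reversal [poch_reverse]; it cancels in every use, so its value
   (-1)^s q^(-s(s+1)/2) is never needed. *)
Definition poch_flip (s : nat) : K := \prod_(0 <= i < s) (- (q ^+ i.+1)^-1).

Lemma poch_flip_neq0 s : poch_flip s != 0.
Proof.
rewrite prodf_seq_neq0; apply/allP => i _ /=.
by rewrite oppr_eq0 invr_eq0 expf_neq0.
Qed.

(** Read backwards, the arguments x / q^(i+1) on the left are the inverses of the arguments of
    [poch (q / x) s], and [thV] turns each factor around. *)
Lemma poch_reverse x s : x != 0 ->
  poch (x / q ^+ s) s = x ^+ s * poch_flip s * poch (q / x) s.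
Proof.
move=> x0.
have -> : x ^+ s = \prod_(0 <= i < s) x by rewrite big_const_nat subn0 iter_mulr_1.
rewrite /poch /poch_flip -!big_split /= big_nat_rev /= big_nat [RHS]big_nat.
apply: eq_bigr => i /andP[_ ilt].
have qi k : q ^+ k != 0 by apply: expf_neq0.
have -> : x / q ^+ s * q ^+ (0 + s - i.+1) = x / q ^+ i.+1.
  rewrite add0n -mulrA; congr (_ * _).
  by apply: (mulfI (qi s)); rewrite mulVKf // -{2}(subnK ilt) exprD mulfK.
have -> : x / q ^+ i.+1 = (q / x * q ^+ i)^-1.
  rewrite exprS; field; by rewrite q0 x0 qi.
rewrite thV ?mulf_neq0 ?invr_eq0 // exprS; field; by rewrite q0 x0 qi.
Qed.

End Pochhammer.

(** * The cleared summand and its behaviour under a shift of the summation index *)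

Section Summand.
Variables (K : fieldType) (th : K -> K) (q : K) (n : nat).
Implicit Types (z : 'I_n -> K) (m y : 'I_n -> nat) (a b c d : K).
Local Notation po := (poch th q).

Definition vdm (x y : K) : K := x * th (y / x).

Definition shiftz z y : 'I_n -> K := fun k => z k * q ^+ y k.

Definition vand_part z y : K := \prod_(j < n) \prod_(k < n | (j < k)%N)
  (vdm (z j * q ^+ y j) (z k * q ^+ y k) / vdm (z j) (z k)
   / po (z j * z k) (y j + y k)).

Definition wp_part a z y (Y : nat) : K :=
  \prod_(k < n) (th (a * z k * q ^+ (y k + Y)) / th (a * z k)).

Definition num_part m z y : K := \prod_(j < n) \prod_(k < n)
  (po (z k / (z j * q ^+ m j)) (y k) * po (z j * q ^+ m j * z k) (y k)).

Definition den_part z y : K := \prod_(j < n) \prod_(k < n) po (q * z k / z j) (y k).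

Definition weight_part a z (Y : nat) : K := \prod_(j < n) po (a * z j) Y.

Definition mixed_part a m z y (Y : nat) : K := \prod_(j < n)
  (po (a * q / z j) (Y - y j) /
   (po (a * q * (z j * q ^+ m j)) Y * po (a * q / (z j * q ^+ m j)) Y)).

(* (aqz/e)_m / (aqz/e)_y, written so that it stays defined when (aqz/e)_y vanishes. *)
Definition clear_part a b m z y : K :=
  \prod_(k < n) po (a * q * (z k * q ^+ y k) / b) (m k - y k).

(** The factors are grouped by their behaviour under y = s + y'. The parts [vand_part], [wp_part],
    [num_part], [mixed_part] and the clearing parts for b and d each reproduce themselves;
    [weight_part], [den_part] and the factors in c do so only together, at a node. *)
Definition summand a b c d m z y : K :=
  let Y := (\sum_(k < n) y k)%N in
  vand_part z y * wp_part a z y Y * num_part m z y / den_part z y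
  * weight_part a z Y * mixed_part a m z y Y * (po b Y * po c Y * po d Y)
  * q ^+ Y * (clear_part a b m z y * clear_part a c m z y * clear_part a d m z y).

Definition product_side a b c d m z : K := \prod_(k < n)
  (po (a * q * z k) (m k) * po (b * z k / a) (m k) * po (c * z k / a) (m k)
   * po (d * z k / a) (m k) / po (z k / a) (m k)).

Hypothesis q0 : q != 0.

Let qX i : q ^+ i != 0. Proof. exact: expf_neq0. Qed.

Section Shift.
Variables (z : 'I_n -> K) (m s : 'I_n -> nat) (y : 'I_n -> nat) (a : K).
Hypothesis z0 : forall k, z k != 0.
Hypothesis sm : forall k, (s k <= m k)%N.
Let z' := shiftz z s.
Let m' := fun k => (m k - s k)%N.
Let sy := fun k => (s k + y k)%N.
Variables S Y : nat.
Hypothesis sS : forall k, (s k <= S)%N.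
Hypothesis yY : forall k, (y k <= Y)%N.
Let a' := a * q ^+ S.

Lemma vand_part_shift : (forall j k : 'I_n, (j < k)%N -> vdm (z' j) (z' k) != 0) ->
  vand_part z sy = vand_part z s * vand_part z' y.
Proof.
move=> H; rewrite /vand_part -big_split /=; apply: eq_bigr => j _.
rewrite -big_split /=; apply: eq_bigr => k jk.
have -> : (sy j + sy k = (s j + s k) + (y j + y k))%N by rewrite /sy addnACA.
rewrite pochD (_ : z j * z k * _ = z' j * z' k); last first.
  by rewrite /z' /shiftz exprD; ring.
rewrite (_ : z j * q ^+ sy j = z' j * q ^+ y j); last by rewrite /z' /shiftz exprD mulrA.
rewrite (_ : z k * q ^+ sy k = z' k * q ^+ y k); last by rewrite /z' /shiftz exprD mulrA.
rewrite -[z j * q ^+ s j]/(z' j) -[z k * q ^+ s k]/(z' k) (invfM (po _ _)).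
have := H j k jk; move: (vdm (z' j) (z' k)) => v v0.
move: (vdm (z' j * _) _) (vdm (z j) (z k))^-1 (po _ _)^-1 (po _ _)^-1 => v1 v2 p1 p2.
by field.
Qed.

Lemma wp_part_shift : (forall k, th (a' * z' k) != 0) ->
  wp_part a z sy (S + Y) = wp_part a z s S * wp_part a' z' y Y.
Proof.
move=> H; rewrite /wp_part -big_split /=; apply: eq_bigr => k _.
rewrite (_ : a * z k * q ^+ (s k + S) = a' * z' k); last first.
  by rewrite /a' /z' /shiftz exprD; ring.
rewrite (_ : a * z k * _ = a' * z' k * q ^+ (y k + Y)); last first.
  by rewrite /sy /a' /z' /shiftz !exprD; ring.
by have := H k; move: (th (a' * z' k)) (th (a * z k))^-1 (th _) => u v w *; field.
Qed.

(** The end points z_k q^(m_k) are invariant under the shift, which is why m must drop to m - s. *)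
Lemma shift_top k : z' k * q ^+ m' k = z k * q ^+ m k.
Proof. by rewrite /z' /m' /shiftz -mulrA -exprD subnKC. Qed.

Lemma num_part_shift : num_part m z sy = num_part m z s * num_part m' z' y.
Proof.
rewrite /num_part -big_split /=; apply: eq_bigr => j _.
rewrite -big_split /=; apply: eq_bigr => k _.
rewrite shift_top /sy !pochD.
rewrite (_ : z k / (z j * q ^+ m j) * q ^+ s k = z' k / (z j * q ^+ m j)).
  rewrite (_ : z j * q ^+ m j * z k * q ^+ s k = z j * q ^+ m j * z' k); first by ring.
  by rewrite /z' /shiftz mulrA.
by rewrite /z' /shiftz mulrAC.
Qed.

Lemma mixed_part_shift : mixed_part a m z sy (S + Y) =
  mixed_part a m z s S * mixed_part a' m' z' y Y.
Proof.
rewrite /mixed_part -big_split /=; apply: eq_bigr => j _.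
have := sS j; have := yY j => yYj sSj.
rewrite shift_top !pochD (_ : (S + Y - sy j = (S - s j) + (Y - y j))%N); last first.
  by rewrite /sy; lia.
rewrite pochD (_ : a * q / z j * q ^+ (S - s j) = a' * q / z' j); last first.
  rewrite /a' /z' /shiftz -{2}(subnK sSj) exprD.
  have := qX (S - s j); have := qX (s j); have := z0 j.
  by move: (q ^+ _) (q ^+ _) (z j) => u v w *; field; apply/andP.
rewrite (_ : a * q * (z j * q ^+ m j) * q ^+ S = a' * q * (z j * q ^+ m j)); last first.
  by rewrite /a'; ring.
rewrite (_ : a * q / (z j * q ^+ m j) * q ^+ S = a' * q / (z j * q ^+ m j)); last first.
  by rewrite /a'; ring.
by rewrite !invfM; ring.
Qed.

Lemma clear_part_shift b : clear_part a b m z sy = clear_part a' (b * q ^+ S) m' z' y.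
Proof.
rewrite /clear_part; apply: eq_bigr => k _; rewrite /m' /sy subnDA; congr (po _ _).
rewrite /a' /z' /shiftz exprD (invfM b).
by have := qX S; move: (q ^+ S) b^-1 => u v u0; field.
Qed.

End Shift.

End Summand.

(** * The terms of the sum at a node c = a q^s z_{k0} *)

Section PoleShift.
Variables (K : fieldType) (th : K -> K) (q : K) (n : nat).
Local Notation po := (poch th q).
Hypothesis q0 : q != 0.
Variables (z : 'I_n -> K) (m : 'I_n -> nat) (a b c d : K) (k0 : 'I_n) (s : nat).
Hypothesis z0 : forall k, z k != 0.
Hypothesis a0 : a != 0.
Hypothesis sm : (s <= m k0)%N.
Hypothesis cE : c = a * q ^+ s * z k0.

(* At c = a q^s z_{k0} only the terms with y_{k0} >= s survive; they are reindexed by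
   y = spike + y', which amounts to z_{k0} -> z_{k0} q^s, (a,b,d) -> (a,b,d) q^s. *)
Definition spike (k : 'I_n) : nat := if k == k0 then s else 0.

Let z' := shiftz q z spike.
Let m' := fun k => (m k - spike k)%N.
Let a' := a * q ^+ s.
Let x (k : 'I_n) : K := q * z' k / z' k0.

(** The constant left over by the two exchanges [weight_part_spike] and [den_clear_part_spike]. *)
Definition pole_const : K :=
  weight_part th q a z s * po c s / den_part th q z spike *
  \prod_(k < n) (po (x k) (m' k) / po (x k * q ^+ s) (m' k)).

Hypothesis x1 : forall k, po (x k) (m' k) != 0.
Hypothesis x2 : forall k, po (x k * q ^+ s) (m' k) != 0.

Let qX i : q ^+ i != 0. Proof. exact: expf_neq0. Qed.

Lemma spike_out j : j != k0 -> spike j = 0%N.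
Proof. by rewrite /spike => /negbTE ->. Qed.

Lemma spike_in : spike k0 = s.
Proof. by rewrite /spike eqxx. Qed.

Lemma shift_spike_out j : j != k0 -> shiftz q z spike j = z j.
Proof. by move=> jk; rewrite /shiftz spike_out // expr0 mulr1. Qed.

Lemma shift_spike_in : shiftz q z spike k0 = z k0 * q ^+ s.
Proof. by rewrite /shiftz spike_in. Qed.

Lemma spike_le k : (spike k <= s)%N.
Proof. by rewrite /spike; case: eqP. Qed.

Lemma spike_leq k : (spike k <= m k)%N.
Proof. by rewrite /spike; case: eqP => // ->. Qed.

Lemma sum_spike : (\sum_(k < n) spike k)%N = s.
Proof. by rewrite (bigD1 k0) //= spike_in big1 ?addn0 // => i /spike_out. Qed.

Lemma z'_neq0 k : z' k != 0.
Proof. by rewrite mulf_neq0. Qed.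

(** Two symbols trade places: splitting off s factors from (a z_{k0})_{s+Y} leaves (c)_Y, since a
    q^s z_{k0} = c, and splitting them off from (c)_{s+Y} leaves the new weight (a' z'_{k0})_Y,
    since c q^s = a' z'_{k0}. *)
Lemma weight_part_spike Y :
  weight_part th q a z (s + Y) * po c (s + Y) =
  weight_part th q a z s * po c s * (weight_part th q a' z' Y * po c Y).
Proof.
have -> : weight_part th q a z (s + Y) =
    weight_part th q a z s * \prod_(j < n) po (a' * z j) Y.
  rewrite /weight_part -big_split /=; apply: eq_bigr => j _.
  by rewrite pochD (_ : a * z j * q ^+ s = a' * z j) // /a'; ring.
rewrite pochD (bigD1 k0) //= [weight_part _ _ a' _ _](bigD1 k0) //=.
rewrite (eq_bigr (fun j => po (a' * z' j) Y)) => [|j jk]; last by rewrite /z' shift_spike_out.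
rewrite (_ : a' * z k0 = c) ?cE // (_ : a' * z' k0 = a * q ^+ s * z k0 * q ^+ s); last first.
  by rewrite /a' /z' shift_spike_in; ring.
ring.
Qed.

(** Passing to the shifted data changes x_k q^s into x_k in the row j = k0 of the denominator, and
    x_k into x_k q^s in the clearing product for c. The two changes compensate up to a factor
    independent of y. *)
Lemma den_clear_part_spike (y : 'I_n -> nat) : (forall k, (y k <= m' k)%N) ->
  clear_part th q a c m z (fun k => spike k + y k)%N /
    den_part th q z (fun k => spike k + y k)%N =
  (\prod_(k < n) (po (x k) (m' k) / po (x k * q ^+ s) (m' k))) / den_part th q z spike *
  (clear_part th q a' c m' z' y / den_part th q z' y).
Proof.
move=> ym.
have -> : den_part th q z (fun k => spike k + y k)%N = den_part th q z spike *
    \prod_(j < n) \prod_(k < n) po (q * z' k / z j) (y k).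
  rewrite /den_part -big_split /=; apply: eq_bigr => j _.
  rewrite -big_split /=; apply: eq_bigr => k _.
  by rewrite pochD (_ : q * z k / z j * _ = q * z' k / z j) // /z' /shiftz; ring.
rewrite (bigD1 k0) //= [den_part _ _ z' _](bigD1 k0) //=.
rewrite [\prod_(i < n | i != k0) \prod_(k < n) po (q * z' k / z i) (y k)](eq_bigr
  (fun j => \prod_(k < n) po (q * z' k / z' j) (y k))); last first.
  by move=> j jk; rewrite [z' j]shift_spike_out.
move: (\prod_(i < n | i != k0) _) => R.
rewrite [\prod_(k < n) po (q * z' k / z k0) (y k)](eq_bigr
  (fun k => po (x k * q ^+ s) (y k))); last first.
  move=> k _; congr (po _ _); rewrite /x [z' k0]shift_spike_in.
  by have := qX s; have := z0 k0; move: (q ^+ s) (z k0) => u v *; field; apply/andP.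
have -> : clear_part th q a c m z (fun k => spike k + y k)%N =
    \prod_(k < n) po (x k * q ^+ y k) (m' k - y k).
  apply: eq_bigr => k _; rewrite /m' subnDA; congr (po _ _).
  rewrite /x [z' k0]shift_spike_in /z' /shiftz cE exprD.
  have := qX s; have := z0 k0; move: (q ^+ s) (z k0) => u v v0 u0; field.
  by rewrite u0 v0 a0.
have -> : clear_part th q a' c m' z' y =
    \prod_(k < n) po (x k * q ^+ s * q ^+ y k) (m' k - y k).
  apply: eq_bigr => k _; congr (po _ _).
  rewrite /x [z' k0]shift_spike_in /a' cE.
  have := qX s; have := z0 k0; move: (q ^+ s) (z k0) => u v v0 u0; field.
  by rewrite u0 v0 a0.
suff E : \prod_(k < n) po (x k * q ^+ y k) (m' k - y k) /
       \prod_(k < n) po (x k * q ^+ s) (y k) =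
    \prod_(k < n) (po (x k) (m' k) / po (x k * q ^+ s) (m' k)) *
   (\prod_(k < n) po (x k * q ^+ s * q ^+ y k) (m' k - y k) /
    \prod_(k < n) po (x k) (y k)).
  have -> : \prod_(k < n) po (q * z' k / z' k0) (y k) = \prod_(k < n) po (x k) (y k) by [].
  rewrite (invfM (den_part _ _ _ _)) !(invfM _ R) mulrCA (mulrA (\prod_(k < n) _) _ (R^-1)) E.
  ring.
rewrite -!prodf_div -big_split /=; apply: eq_bigr => k _.
move: (x1 k) (x2 k); rewrite -(subnKC (ym k)) !pochD addKn !mulf_eq0 !negb_or.
case/andP=> p1 p2 /andP[p3 p4]; move: p1 p2 p3 p4.
move: (po _ _) (po _ _) (po _ _) (po _ _) => u1 u2 u3 u4 p1 p2 p3 p4.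
by field; rewrite p1 p3 p4.
Qed.

Definition spike_const : K :=
  vand_part th q z spike * wp_part th q a z spike s * num_part th q m z spike
  * mixed_part th q a m z spike s * (po b s * po d s) * q ^+ s * pole_const.

Hypothesis vz : forall j k : 'I_n, (j < k)%N -> vdm th (z' j) (z' k) != 0.
Hypothesis wz : forall k, th (a' * z' k) != 0.

Lemma summand_spike (y : 'I_n -> nat) : (forall k, (y k <= m' k)%N) ->
  summand th q a b c d m z (fun k => spike k + y k)%N =
  spike_const * summand th q a' (b * q ^+ s) c (d * q ^+ s) m' z' y.
Proof.
move=> ym; rewrite /summand big_split /= sum_spike.
set Y := (\sum_(k < n) y k)%N.
have yY k : (y k <= Y)%N by rewrite /Y (bigD1 k) //= leq_addr.
rewrite (vand_part_shift y vz) (wp_part_shift (S := s) y Y wz).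
rewrite (num_part_shift th q z y spike_leq).
rewrite (mixed_part_shift th q0 a z0 spike_leq spike_le yY).
rewrite (clear_part_shift th q0 z m spike y a s b) (clear_part_shift th q0 z m spike y a s d).
rewrite (pochD _ _ b) (pochD _ _ d) exprD /spike_const /pole_const.
have E1 := weight_part_spike Y; have E2 := den_clear_part_spike ym.
have E := f_equal2 *%R E1 E2; move: E; rewrite -/z' -/m' -/a' => E.
transitivity ((vand_part th q z spike * vand_part th q z' y)
  * (wp_part th q a z spike s * wp_part th q a' z' y Y)
  * (num_part th q m z spike * num_part th q m' z' y)
  * (mixed_part th q a m z spike s * mixed_part th q a' m' z' y Y)
  * (po b s * po (b * q ^+ s) Y * (po d s * po (d * q ^+ s) Y)) * (q ^+ s * q ^+ Y)
  * (clear_part th q a' (b * q ^+ s) m' z' y * clear_part th q a' (d * q ^+ s) m' z' y)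
  * (weight_part th q a z (s + Y) * po c (s + Y) *
     (clear_part th q a c m z (fun k => spike k + y k)%N /
      den_part th q z (fun k => spike k + y k)%N))).
  by ring.
by rewrite E; ring.
Qed.

End PoleShift.

(** * The constant of the reindexing, one index at a time *)

Section PoleConstant.
Variables (K : fieldType) (th : K -> K) (q : K).
Local Notation po := (poch th q).
Hypothesis q0 : q != 0.
Hypothesis thV : forall x, x != 0 -> th x^-1 = - th x / x.

Let qX i : q ^+ i != 0. Proof. exact: expf_neq0. Qed.

(** Both sides come from the two ways of splitting (x / q^s)_{m+s}; the two short symbols are then
    reversed, and the constant [poch_flip] cancels. *)
Lemma poch_reverse_ratio (x y : K) (m s : nat) : x != 0 -> y = x * q ^+ m ->
  po (x / q ^+ s) m * (y ^+ s * po (q / y) s) = x ^+ s * po (q / x) s * po x m.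
Proof.
move=> x0 yE; have y0 : y != 0 by rewrite yE mulf_neq0.
have := poch_exchange th q (x / q ^+ s) m s.
rewrite divfK // (_ : x / q ^+ s * q ^+ m = y / q ^+ s); last by rewrite yE mulrAC.
rewrite !(poch_reverse q0 thV) //.
have := poch_flip_neq0 q0 s; move: (poch_flip _ _) => k k0 E.
by apply: (mulfI k0); transitivity (po (x / q ^+ s) m * (y ^+ s * k * po (q / y) s));
  [ring | rewrite E; ring].
Qed.

(** The contribution of an index j other than k0, with w = z_{k0}, z = z_j, Z = z_j q^(m_j). The
    symbols of b and d agree on both sides; the others are matched by [e1] to [e4], which split one
    symbol in two ways, and by the reversals [e5] and [e6]. *)
Lemma pole_factor_out (a b c d w z Z : K) (m s : nat) :
  a != 0 -> w != 0 -> z != 0 -> Z = z * q ^+ m -> c = a * q ^+ s * w ->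
  th (w / z) != 0 -> po (w / z) s != 0 -> po (q * w / z) s != 0 ->
  th (a * z) != 0 -> po (a * z) s != 0 -> po (a * q * z) s != 0 ->
  po (z * w) s != 0 -> po (a * q * Z) s != 0 -> po (a * q / Z) s != 0 ->
  po (a * q / z) s != 0 -> po (z / a) m != 0 -> po (w / Z) s != 0 ->
  po (q * z / (w * q ^+ s) * q ^+ s) m != 0 ->
  th (w * q ^+ s / z) / th (w / z) / po (z * w) s
  * (th (a * q ^+ s * z) / th (a * z))
  * (po (w / Z) s * po (Z * w) s / po (q * w / z) s)
  * (po (a * z) s * (po (a * q / z) s / (po (a * q * Z) s * po (a * q / Z) s)))
  * (po (q * z / (w * q ^+ s)) m / po (q * z / (w * q ^+ s) * q ^+ s) m)
  * (po (a * q ^+ s * q * z) m * po (b * q ^+ s * z / (a * q ^+ s)) m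
     * po (c * z / (a * q ^+ s)) m * po (d * q ^+ s * z / (a * q ^+ s)) m
     / po (z / (a * q ^+ s)) m)
  = po (a * q * z) m * po (b * z / a) m * po (c * z / a) m * po (d * z / a) m / po (z / a) m.
Proof.
move=> a0 w0 z0 ZE cE h1 h2 h3 h4 h5 h6 h7 h8 h9 h10 h11 h12 h13.
have Z0 : Z != 0 by rewrite ZE mulf_neq0.
have bE e : e * q ^+ s * z / (a * q ^+ s) = e * z / a.
  by have := qX s; move: (q ^+ s) => u u0; field; rewrite u0 a0.
rewrite !bE.
have c1 : c * z / (a * q ^+ s) = z * w.
  by rewrite cE; have := qX s; move: (q ^+ s) => u u0; field; rewrite u0 a0.
have c2 : c * z / a = z * w * q ^+ s by rewrite cE; field.
rewrite c1 c2.
have e1 : po (w / z) s * th (w * q ^+ s / z) = th (w / z) * po (q * w / z) s.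
  rewrite (_ : w * q ^+ s / z = w / z * q ^+ s); last by ring.
  rewrite (_ : q * w / z = w / z * q); last by ring.
  by rewrite -pochS pochS_left.
have e2 : po (a * z) s * th (a * q ^+ s * z) = th (a * z) * po (a * q * z) s.
  rewrite (_ : a * q * z = a * z * q); last by ring.
  by rewrite -pochS_left pochS; congr (_ * th _); ring.
have e3 : po (a * q * z) s * po (a * q ^+ s * q * z) m = po (a * q * z) m * po (a * q * Z) s.
  rewrite (_ : a * q ^+ s * q * z = a * q * z * q ^+ s); last by ring.
  rewrite poch_exchange; congr (_ * po _ _); by rewrite ZE; ring.
have e4 : po (z * w) m * po (Z * w) s = po (z * w) s * po (z * w * q ^+ s) m.
  by rewrite -poch_exchange ZE; congr (_ * po _ _); ring.
have e5 : po (z / (a * q ^+ s)) m * (Z ^+ s * po (a * q / Z) s) =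
    z ^+ s * po (a * q / z) s * po (z / a) m.
  have := @poch_reverse_ratio (z / a) (Z / a) m s.
  rewrite (_ : z / a / q ^+ s = z / (a * q ^+ s)); last by rewrite invfM mulrA.
  move=> H.
  rewrite (_ : a * q / Z = q / (Z / a)); last by field; rewrite a0 Z0.
  rewrite (_ : a * q / z = q / (z / a)); last by field; rewrite a0 z0.
  have {}H : po (z / (a * q ^+ s)) m * ((Z / a) ^+ s * po (q / (Z / a)) s) =
      (z / a) ^+ s * po (q / (z / a)) s * po (z / a) m.
    by apply: H; [rewrite mulf_neq0 ?invr_eq0 | rewrite ZE mulrAC].
  have ai : a^-1 ^+ s != 0 by rewrite expf_neq0 ?invr_eq0.
  apply: (mulfI ai); move: H; rewrite ![(_ / a) ^+ s]exprMn => H.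
  by transitivity (po (z / (a * q ^+ s)) m * (Z ^+ s * a^-1 ^+ s * po (q / (Z / a)) s));
    [ring | rewrite H; ring].
set x := q * z / (w * q ^+ s).
have e6 : po x m * (Z ^+ s * po (w / Z) s) = z ^+ s * po (w / z) s * po (x * q ^+ s) m.
  have := @poch_reverse_ratio (q * z / w) (q * Z / w) m s.
  rewrite (_ : q * z / w / q ^+ s = x); last by rewrite /x invfM mulrA.
  rewrite (_ : q / (q * Z / w) = w / Z); last by field; rewrite w0 q0 Z0.
  rewrite (_ : q / (q * z / w) = w / z); last by field; rewrite w0 q0 z0.
  rewrite (_ : x * q ^+ s = q * z / w); last by rewrite /x invfM mulrA divfK.
  rewrite !mulf_neq0 ?invr_eq0 // => /(_ isT) H.
  have {}H : po x m * ((q * Z / w) ^+ s * po (w / Z) s) =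
    (q * z / w) ^+ s * po (w / z) s * po (q * z / w) m by apply: H; rewrite ZE; ring.
  have ai : (q / w) ^+ s != 0 by rewrite expf_neq0 ?mulf_neq0 ?invr_eq0.
  apply: (mulfI ai); move: H.
  rewrite (_ : q * Z / w = q / w * Z); last by ring.
  rewrite (_ : q * z / w = q / w * z); last by ring.
  rewrite !exprMn => H.
  by transitivity (po x m * ((q ^+ s * (w^-1) ^+ s * Z ^+ s) * po (w / Z) s)); [ring | rewrite H; ring].
have zs : z ^+ s != 0 by rewrite expf_neq0.
have Zs : Z ^+ s != 0 by rewrite expf_neq0.
have n5 : po (z / (a * q ^+ s)) m != 0.
  have : z ^+ s * po (a * q / z) s * po (z / a) m != 0 by rewrite !mulf_neq0.
  by rewrite -e5; apply: contraNneq => ->; rewrite mul0r.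
move: (po (b * z / a) m) (po (d * z / a) m) => pb pd.
move: h13 e6; rewrite -/x.
move: (po x m) (po (x * _) m) => x1 x2 h13 e6.
move: (z ^+ s) (Z ^+ s) zs Zs e5 e6 => zs Zs zs0 Zs0.
move: (po (w / z) s) (po (q * w / z) s) (th (w * q ^+ s / z)) (th (w / z)) h1 h2 h3 e1.
move: (po (a * z) s) (po (a * q * z) s) (th (a * q ^+ s * z)) (th (a * z)) h4 h5 h6 e2 e3.
move: (po (a * q ^+ s * q * z) m) (po (a * q * z) m) (po (a * q * Z) s) h8.
move: (po (z * w) m) (po (Z * w) s) (po (z * w) s) (po (z * w * q ^+ s) m) h7 e4.
move: (po (z / (a * q ^+ s)) m) (po (a * q / Z) s) (po (a * q / z) s) (po (z / a) m) n5 h9 h10 h11.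
move: (po (w / Z) s) h12 => P h12.
move=> g1 g2 g3 g4 n5 h9 h10 h11 f1 f2 f3 f4 h7
  e4 r1 r2 r3 h8 p1 p2 p3 p4 h4 h5 h6 e2 e3 u1 u2 u3 u4 h1 h2 h3 e1 e5 e6.
have -> : u3 = u4 * u2 / u1 by rewrite -e1; field.
have -> : p3 = p4 * p2 / p1 by rewrite -e2; field.
have -> : r1 = r2 * r3 / p2 by rewrite -e3; field.
have -> : f4 = f1 * f2 / f3 by rewrite e4; field.
have -> : x1 = zs * u1 * x2 / (Zs * P) by rewrite -e6; field; rewrite h12.
have -> : g1 = zs * g3 * g4 / (Zs * g2) by rewrite -e5; field; rewrite h9.
by field; rewrite h1 h2 h3 h4 h5 h6 h7 h8 h9 h10 h11 h12 h13 zs0 Zs0.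
Qed.

(** The contribution of k0 itself, where the condition a^2 q = bcd enters: at the node it reads b d
    q^s w = a q, so that the first s factors of (bw/a)_m are those of (d)_s reversed, and likewise
    with b and d interchanged. *)
Lemma pole_factor_in (a b c d w Z : K) (m s : nat) :
  a != 0 -> b != 0 -> d != 0 -> w != 0 -> (s <= m)%N -> Z = w * q ^+ m ->
  c = a * q ^+ s * w -> a ^+ 2 * q = b * c * d ->
  th (a * w) != 0 -> po (a * q * Z) s != 0 -> po (a * q / Z) s != 0 ->
  po (w / a) m != 0 -> po q m != 0 ->
  th (a * q ^+ s * (w * q ^+ s)) / th (a * w)
  * (po (w / Z) s * po (Z * w) s / po (q * w / w) s)
  * (po (a * w) s / (po (a * q * Z) s * po (a * q / Z) s))
  * (po b s * po d s * q ^+ s * po c s)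
  * (po q (m - s) / po (q * q ^+ s) (m - s))
  * (po (a * q ^+ s * q * (w * q ^+ s)) (m - s)
     * po (b * q ^+ s * (w * q ^+ s) / (a * q ^+ s)) (m - s)
     * po (c * (w * q ^+ s) / (a * q ^+ s)) (m - s)
     * po (d * q ^+ s * (w * q ^+ s) / (a * q ^+ s)) (m - s)
     / po (w * q ^+ s / (a * q ^+ s)) (m - s))
  = po (a * q * w) m * po (b * w / a) m * po (c * w / a) m * po (d * w / a) m / po (w / a) m.
Proof.
move=> a0 b0 d0 w0 sm ZE cE bcd h1 h2 h3 h4 h5.
have Z0 : Z != 0 by rewrite ZE mulf_neq0.
set r := (m - s)%N; have mE : m = (s + r)%N by rewrite /r subnKC.
have bd : b * d * q ^+ s * w = a * q.
  by apply: (mulfI a0); rewrite [RHS]mulrA -expr2 bcd cE; ring.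
have qs := qX s.
have bE e : e * q ^+ s * (w * q ^+ s) / (a * q ^+ s) = e * w / a * q ^+ s.
  by move: (q ^+ s) qs => u u0; field; rewrite u0 a0.
rewrite !bE.
have -> : c * (w * q ^+ s) / (a * q ^+ s) = c * w / a.
  by move: (q ^+ s) qs => u u0; field; rewrite u0 a0.
have -> : w * q ^+ s / (a * q ^+ s) = w / a.
  by move: (q ^+ s) qs => u u0; field; rewrite u0 a0.
rewrite mulfK //.
have e1 : th (a * q ^+ s * (w * q ^+ s)) * po (a * w) s * po c s =
    th (a * w) * po (a * q * w) (s + s).
  rewrite cE (_ : a * q ^+ s * w = a * w * q ^+ s); last by ring.
  rewrite -mulrA -pochD mulrC (_ : a * q ^+ s * _ = a * w * q ^+ (s + s)); last first.
    by rewrite exprD; ring.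
  by rewrite -pochS pochS_left; congr (_ * po _ _); ring.
have e2 : po (a * q * w) (s + s) * po (a * q ^+ s * q * (w * q ^+ s)) r =
    po (a * q * w) m * po (a * q * Z) s.
  rewrite (_ : a * q ^+ s * q * (w * q ^+ s) = a * q * w * q ^+ (s + s)); last first.
    by rewrite exprD; ring.
  rewrite (_ : a * q * Z = a * q * w * q ^+ m); last by rewrite ZE; ring.
  by rewrite -!pochD mE (addnAC s s r).
have e4 : po (c * w / a) m = po (c * w / a) r * po (Z * w) s.
  rewrite (_ : Z * w = c * w / a * q ^+ r); last first.
    by rewrite ZE mE exprD cE; move: (q ^+ s) qs (q ^+ r) => u u0 v; field.
  by rewrite -pochD mE addnC.
have e5 : po (w / a) m = po (w / a) r * ((Z / a) ^+ s * poch_flip q s * po (a * q / Z) s).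
  rewrite (_ : a * q / Z = q / (Z / a)); last by field; rewrite a0 Z0.
  rewrite -(poch_reverse q0 thV); last by rewrite mulf_neq0 ?invr_eq0.
  rewrite (_ : Z / a / q ^+ s = w / a * q ^+ r); last first.
    by rewrite ZE mE exprD; move: (q ^+ s) qs (q ^+ r) => u u0 v; field; rewrite u0 a0.
  by rewrite -pochD mE addnC.
have e6 : po (b * w / a) m = (q / d) ^+ s * poch_flip q s * po d s * po (b * w / a * q ^+ s) r.
  rewrite mE pochD; congr (_ * _).
  have qd0 : q / d != 0 by rewrite mulf_neq0 ?invr_eq0.
  have := poch_reverse q0 thV s qd0.
  rewrite (_ : q / (q / d) = d) => [<-|]; last by field; rewrite d0 q0.
  congr (po _ _); apply: (mulIf a0); apply: (mulIf d0); apply: (mulIf qs).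
  transitivity (b * d * q ^+ s * w); last rewrite bd.
    by move: (q ^+ s) => u; field.
  by move: (q ^+ s) qs => u u0; field; rewrite u0 d0.
have e7 : po (d * w / a) m = (q / b) ^+ s * poch_flip q s * po b s * po (d * w / a * q ^+ s) r.
  rewrite mE pochD; congr (_ * _).
  have qd0 : q / b != 0 by rewrite mulf_neq0 ?invr_eq0.
  have := poch_reverse q0 thV s qd0.
  rewrite (_ : q / (q / b) = b) => [<-|]; last by field; rewrite b0 q0.
  congr (po _ _); apply: (mulIf a0); apply: (mulIf b0); apply: (mulIf qs).
  transitivity (b * d * q ^+ s * w); last rewrite bd.
    by move: (q ^+ s) => u; field.
  by move: (q ^+ s) qs => u u0; field; rewrite u0 b0.
have e8 : po (w / Z) s = (q ^+ r)^-1 ^+ s * poch_flip q s * po (q * q ^+ r) s.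
  rewrite -[q * q ^+ r](_ : q / (q ^+ r)^-1 = _); last by rewrite invrK.
  rewrite -(poch_reverse q0 thV) ?invr_eq0 //; congr (po _ _).
  rewrite ZE mE exprD; move: (q ^+ s) qs (q ^+ r) (qX r) => u u0 v v0.
  by field; rewrite u0 v0 w0.
have e9 : po q r * po (q * q ^+ r) s = po q s * po (q * q ^+ s) r by rewrite poch_exchange.
have n1 : po q s != 0 /\ po (q * q ^+ s) r != 0.
  by move: h5; rewrite mE pochD mulf_eq0 negb_or => /andP.
have n2 : po (w / a) r != 0 /\ (Z / a) ^+ s * poch_flip q s * po (a * q / Z) s != 0.
  by move: h4; rewrite e5 mulf_eq0 negb_or => /andP.
(* The monomials produced by the four reversals [e5] to [e8] balance, again by b d q^s w = a q. *)
have pw : (q ^+ r)^-1 ^+ s * q ^+ s * (Z / a) ^+ s = (q / d) ^+ s * (q / b) ^+ s.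
  rewrite -!exprMn; congr (_ ^+ s).
  rewrite ZE mE exprD; apply: (mulIf a0); apply: (mulIf b0); apply: (mulIf d0).
  transitivity (q * (b * d * q ^+ s * w)); last rewrite bd.
    by move: (q ^+ s) (q ^+ r) (qX r) => u v v0; field; rewrite v0 a0.
  by field; rewrite b0 d0.
case: n1 => n1 n1'; case: n2 => n2 n2'.
move: n2'; rewrite !mulf_eq0 !negb_or => /andP[/andP[n3 n4] _].
rewrite e4 e5 e6 e7 e8.
have n5 : po q r != 0.
  by move: h5; rewrite mE addnC pochD mulf_eq0 negb_or => /andP[].
have E : th (a * q ^+ s * (w * q ^+ s)) * po (a * w) s * po c s *
    po (a * q ^+ s * q * (w * q ^+ s)) r = th (a * w) * po (a * q * w) m * po (a * q * Z) s.
  by rewrite e1 -mulrA e2 mulrA.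
move: (po (b * w / a * q ^+ s) r) (po (d * w / a * q ^+ s) r) (po (c * w / a) r)
  (po (w / a) r) n2 (po (Z * w) s) => u1 u2 u3 u4 n2 u5.
move: (poch_flip q s) n4 (po (a * q / Z) s) h3 => f f0 u6 h3.
move: (th (a * q ^+ s * (w * q ^+ s))) (po (a * w) s) (po c s) (po (a * q ^+ s * q * (w * q ^+ s)) r)
  (th (a * w)) h1 (po (a * q * w) m) (po (a * q * Z) s) h2 E => T A C u8 t h1 u9 g h2 E.
move: (po (q * q ^+ r) s) (po q s) (po (q * q ^+ s) r) (po q r) e9 n1 n1' n5 => P9 p1 p2 p3 e9 n1 n1' n5.
move: (po b s) (po d s) ((q ^+ r)^-1 ^+ s) (q ^+ s) qs ((Z / a) ^+ s) n3 ((q / d) ^+ s) ((q / b) ^+ s) pw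
  => B D X1 qs qs0 Zs n3 D1 B1 pw.
have -> : P9 = p1 * p2 / p3 by rewrite -e9; field.
have -> : X1 = D1 * B1 / (qs * Zs) by rewrite -pw; field; rewrite qs0 n3.
transitivity (T * A * C * u8 / (t * g) *
  (D1 * B1 / Zs * f * p2 / p3 * u5 / u6 * B * D * (p3 / p2) * (u1 * u3 * u2 / u4))).
  by field; rewrite h1 h2 h3 n1 n1' n2 n3 n5 qs0.
by rewrite E; field; rewrite f0 h1 h2 h3 n1' n2 n3 n5.
Qed.

End PoleConstant.

Lemma prod_pairs_at (K : fieldType) (n : nat) (F : 'I_n -> 'I_n -> K) (k0 : 'I_n) :
  (forall j k, F j k = F k j) -> (forall j k, j != k0 -> k != k0 -> (j < k)%N -> F j k = 1) ->
  \prod_(j < n) \prod_(k < n | (j < k)%N) F j k = \prod_(j < n | j != k0) F j k0.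
Proof.
move=> Fsym F1; rewrite (bigD1 k0) //= mulrC.
have -> : \prod_(k < n | (k0 < k)%N) F k0 k =
    \prod_(j < n | j != k0) (if (k0 < j)%N then F j k0 else 1).
  rewrite -big_mkcondr /=; apply: eq_big => j; last by rewrite Fsym.
  by case: (eqVneq j k0) => [->|]; rewrite ?ltnn.
have -> : \prod_(j < n | j != k0) \prod_(k < n | (j < k)%N) F j k =
    \prod_(j < n | j != k0) (if (j < k0)%N then F j k0 else 1).
  apply: eq_bigr => j jk0; case: ifP => [jk|jk].
    rewrite (bigD1 k0) //= big1 ?mulr1 // => k /andP[jk' kk0]; exact: F1.
  apply: big1 => k jk'; apply: F1 => //.
  by apply: contraFneq jk => <-.
rewrite -big_split /=; apply: eq_bigr => j jk0.
case: (ltngtP j k0) => [_|_|/val_inj E]; rewrite ?mulr1 ?mul1r //.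
by rewrite E eqxx in jk0.
Qed.

(** * Product sides before and after the shift, for generic parameters *)

Section PoleEvaluation.
Variables (K : fieldType) (th : K -> K) (q : K) (n : nat).
Local Notation po := (poch th q).
Hypothesis q0 : q != 0.
Hypothesis thV : forall x, x != 0 -> th x^-1 = - th x / x.

Let qX i : q ^+ i != 0. Proof. exact: expf_neq0. Qed.

(* The last four conditions hold for all but countably many scalings of a and b; [gen_b] and
   [gen_ba] separate the interpolation nodes. *)
Record generic (z : 'I_n -> K) (m : 'I_n -> nat) (a b : K) : Prop := Generic {
  gen_z : forall k, z k != 0;
  gen_ratio : forall j k i i', j != k -> (i <= m k)%N -> (i' <= m j)%N ->
    th (z k * q ^+ i / (z j * q ^+ i')) != 0;
  gen_q : forall k i, (0 < i <= m k)%N -> th (q ^+ i) != 0;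
  gen_mul : forall j k i i', j != k -> (i <= m j)%N -> (i' <= m k)%N ->
    (i + i' < m j + m k)%N -> th (z j * q ^+ i * (z k * q ^+ i')) != 0;
  gen_a : forall k i, th (a * z k * q ^+ i) != 0;
  gen_aV : forall k i, th (a * q ^+ i.+1 / (z k * q ^+ m k)) != 0;
  gen_b : forall j k i, th (b * (z j * z k) * q ^+ i) != 0;
  gen_ba : forall k i, th (b * z k * q ^+ i / a) != 0 }.

Variables (z : 'I_n -> K) (m : 'I_n -> nat) (a b c d : K) (k0 : 'I_n) (s : nat).
Hypothesis a0 : a != 0.
Hypothesis sm : (s <= m k0)%N.
Hypothesis gen : generic z m a b.

Local Notation spk := (spike k0 s).
Local Notation z' := (shiftz q z spk).
Local Notation m' := (fun k => (m k - spk k)%N).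

Let z0 := gen_z gen.

(** Needed to apply the induction hypothesis. The shift only moves exponents: within the ranges
    given by m in the conditions on z alone, freely in those that involve a or b. *)
Lemma generic_spike : generic z' m' (a * q ^+ s) (b * q ^+ s).
Proof.
have sk k : (spk k <= m k)%N by apply: spike_leq.
have zE k i : z' k * q ^+ i = z k * q ^+ (spk k + i) by rewrite /shiftz exprD mulrA.
split.
- by move=> k; apply: z'_neq0.
- move=> j k i i' jk im im'; rewrite !zE.
  by apply: (gen_ratio gen) => //; have := sk k; have := sk j; lia.
- by move=> k i ik; apply: (gen_q gen (k := k)); lia.
- move=> j k i i' jk im im' ii; rewrite !zE.
  by apply: (gen_mul gen) => //; have := sk k; have := sk j; lia.
- move=> k i; rewrite /shiftz.
  rewrite (_ : _ * _ = a * z k * q ^+ (s + spk k + i)); first exact: (gen_a gen).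
  by rewrite !exprD; ring.
- move=> k i; rewrite zE subnKC // -[a * _ * _]mulrA -exprD addnS.
  exact: (gen_aV gen).
- move=> j k i; rewrite /shiftz.
  rewrite (_ : _ * _ = b * (z j * z k) * q ^+ (s + spk j + spk k + i)); first exact: (gen_b gen).
  by rewrite !exprD; ring.
- move=> k i; rewrite /shiftz.
  rewrite (_ : _ / _ = b * z k * q ^+ (spk k + i) / a); first exact: (gen_ba gen).
  by rewrite exprD; have := qX s; move: (q ^+ s) => u u0; field; rewrite u0 a0.
Qed.

Lemma th_inv_neq0 x : x != 0 -> th x != 0 -> th x^-1 != 0.
Proof. by move=> x0 h; rewrite thV // mulf_neq0 ?invr_eq0 ?oppr_eq0. Qed.

Lemma poch_neq0_eq (u : K) k : (forall i, (i < k)%N -> exists2 v, u * q ^+ i = v & th v != 0) ->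
  po u k != 0.
Proof. by move=> H; apply: poch_neq0 => i /H[v ->]. Qed.

Lemma generic_poch_a k l : po (a * z k) l != 0.
Proof. by apply: poch_neq0 => i _; apply: (gen_a gen). Qed.

Lemma generic_poch_aq k l : po (a * q * z k) l != 0.
Proof.
apply: poch_neq0_eq => i _; exists (a * z k * q ^+ i.+1); last exact: (gen_a gen).
by rewrite exprS; ring.
Qed.

Lemma generic_poch_aqZ k l : po (a * q * (z k * q ^+ m k)) l != 0.
Proof.
apply: poch_neq0_eq => i _; exists (a * z k * q ^+ (m k + i).+1); last exact: (gen_a gen).
by rewrite exprS exprD; ring.
Qed.

Lemma generic_poch_aqVZ k l : po (a * q / (z k * q ^+ m k)) l != 0.
Proof.
apply: poch_neq0_eq => i _; exists (a * q ^+ i.+1 / (z k * q ^+ m k)); last exact: (gen_aV gen).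
by rewrite exprS mulrA mulrAC.
Qed.

Lemma generic_poch_aqV k l : po (a * q / z k) l != 0.
Proof.
apply: poch_neq0_eq => i _.
exists (a * q ^+ (i + m k).+1 / (z k * q ^+ m k)); last exact: (gen_aV gen).
rewrite exprS exprD; have := qX (m k); have := z0 k.
by move: (q ^+ m k) => u h1 h2; field; rewrite h1 h2.
Qed.

Lemma generic_poch_za k l : (l <= m k)%N -> po (z k / a) l != 0.
Proof.
move=> lm; apply: poch_neq0_eq => i il.
(* z_k q^i / a is the inverse of an argument covered by [gen_aV], the one with exponent m_k - i >=
   1. *)
exists (a * q ^+ (m k - i.+1).+1 / (z k * q ^+ m k))^-1.
  rewrite -subSn ?subSS; last exact: leq_trans il lm.
  rewrite -[in X in _ / (_ * X)](subnK (ltnW (leq_trans il lm))) exprD.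
  have := qX (m k - i); have := qX i; have := z0 k.
  by move: (q ^+ _) (q ^+ _) => u v h1 h2 h3; field; rewrite h1 h2 h3 a0.
apply: th_inv_neq0; last exact: (gen_aV gen).
by rewrite !mulf_neq0 ?invr_eq0 ?mulf_neq0.
Qed.

Lemma generic_ratio_spike k i : (0 < i <= m' k)%N -> th (z' k * q ^+ i / z' k0) != 0.
Proof.
move=> /andP[i0 im].
have sk : (spk k <= m k)%N by apply: spike_leq.
rewrite [z' k0]shift_spike_in.
have -> : z' k * q ^+ i = z k * q ^+ (spk k + i) by rewrite exprD mulrA.
case: (eqVneq k k0) => [E|kk0]; last first.
  by apply: (gen_ratio gen); rewrite 1?eq_sym //; lia.
subst k; move: im; rewrite spike_in => im.
rewrite (_ : _ / _ = q ^+ i); first by apply: (gen_q gen (k := k0)); lia.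
rewrite exprD; have := qX s; have := z0 k0; move: (q ^+ s) => u h1 h2.
by field; rewrite h1 h2.
Qed.

Lemma generic_pole_num k : po (q * z' k / z' k0) (m' k) != 0.
Proof.
apply: poch_neq0_eq => i im; exists (z' k * q ^+ i.+1 / z' k0); last exact: generic_ratio_spike.
by rewrite exprS; ring.
Qed.

Lemma generic_pole_den k : po (q * z' k / z' k0 * q ^+ s) (m' k) != 0.
Proof.
apply: poch_neq0_eq => i im.
have E : q * z' k / z' k0 * q ^+ s * q ^+ i = z k * q ^+ (spk k + i.+1) / z k0.
  rewrite [z' k0]shift_spike_in /shiftz exprD exprS.
  have := qX s; have := z0 k0; move: (q ^+ s) => u h1 h2.
  by field; rewrite h1 h2.
exists (z k * q ^+ (spk k + i.+1) / z k0) => //.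
have sk : (spk k <= m k)%N by apply: spike_leq.
case: (eqVneq k k0) => [E'|kk0].
  subst k; rewrite mulrAC mulfV // mul1r; apply: (gen_q gen (k := k0)); lia.
have := gen_ratio gen (j := k0) (k := k) (i := (spk k + i.+1)) (i' := 0).
by rewrite expr0 mulr1; apply; rewrite 1?eq_sym //; lia.
Qed.

Hypothesis b0 : b != 0.
Hypothesis d0 : d != 0.
Hypothesis cE : c = a * q ^+ s * z k0.
Hypothesis bcd : a ^+ 2 * q = b * c * d.

Local Notation Z j := (z j * q ^+ m j).
Local Notation w := (z k0).

Lemma vdm_anti x y : x != 0 -> y != 0 -> vdm th y x = - vdm th x y.
Proof.
move=> x0 y0; rewrite /vdm -[x / y]invrK invf_div thV; last by rewrite mulf_neq0 ?invr_eq0.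
by rewrite invf_div; field.
Qed.

Lemma vdm_generic_neq0 j k i i' : j != k -> (i <= m j)%N -> (i' <= m k)%N ->
  vdm th (z j * q ^+ i) (z k * q ^+ i') != 0.
Proof. by move=> jk im im'; rewrite !mulf_neq0 //; apply: (gen_ratio gen). Qed.

(** Only z_{k0} moves, so pairs avoiding k0 contribute 1. The quotient of two antisymmetric [vdm] is
    symmetric, so it does not matter on which side of j the index k0 lies. *)
Lemma vand_part_at_spike : vand_part th q z spk =
  \prod_(j < n | j != k0) (th (w * q ^+ s / z j) / th (w / z j) / po (z j * w) s).
Proof.
pose F j k := vdm th (z j * q ^+ spk j) (z k * q ^+ spk k) / vdm th (z j) (z k)
   / po (z j * z k) (spk j + spk k).
rewrite /vand_part (prod_pairs_at (F := F) (k0 := k0)).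
- apply: eq_bigr => j jk0; rewrite /F spike_in spike_out // expr0 mulr1 add0n.
  by congr (_ / _); rewrite /vdm -mulf_div divff // mul1r.
- move=> j k; rewrite /F (vdm_anti (z0 k) (z0 j)) vdm_anti ?mulf_neq0 //.
  by rewrite invrN mulrNN addnC (mulrC (z j) (z k)).
- move=> j k jk0 kk0 jk; rewrite /F !spike_out // !expr0 !mulr1 poch0 divr1 divff //.
  have := @vdm_generic_neq0 j k 0 0; rewrite !expr0 !mulr1; apply=> //.
  by apply: contraTneq jk => ->; rewrite ltnn.
Qed.

Lemma prod_poch_spike (u : 'I_n -> K) : \prod_(k < n) po (u k) (spk k) = po (u k0) s.
Proof.
rewrite (bigD1 k0) //= spike_in big1 ?mulr1 // => k kk0.
by rewrite spike_out // poch0.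
Qed.

(** Both sides are products over the indices and are compared factor by factor. The factors
    (b,c,d)_s q^s, which belong to no index, are absorbed at k0. *)
Lemma spike_const_product :
  spike_const th q z m a b c d k0 s *
    product_side th q (a * q ^+ s) (b * q ^+ s) c (d * q ^+ s) m' z' =
  product_side th q a b c d m z.
Proof.
pose wp j := th (a * q ^+ s * z' j) / th (a * z j).
pose nu j := po (w / Z j) s * po (Z j * w) s / po (q * w / z j) s.
pose mi j := po (a * z j) s * (po (a * q / z j) (s - spk j) /
   (po (a * q * Z j) s * po (a * q / Z j) s)).
pose xx j := po (q * z' j / z' k0) (m' j) / po (q * z' j / z' k0 * q ^+ s) (m' j).
pose ps j := po (a * q ^+ s * q * z' j) (m' j) * po (b * q ^+ s * z' j / (a * q ^+ s)) (m' j)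
  * po (c * z' j / (a * q ^+ s)) (m' j) * po (d * q ^+ s * z' j / (a * q ^+ s)) (m' j)
  / po (z' j / (a * q ^+ s)) (m' j).
have E : spike_const th q z m a b c d k0 s *
    product_side th q (a * q ^+ s) (b * q ^+ s) c (d * q ^+ s) m' z' =
  (\prod_(j < n | j != k0) (th (w * q ^+ s / z j) / th (w / z j) / po (z j * w) s))
  * \prod_(j < n) (wp j) * \prod_(j < n) (nu j) * \prod_(j < n) (mi j)
  * \prod_(j < n) (xx j) * \prod_(j < n) (ps j) * (po b s * po d s * q ^+ s * po c s).
  rewrite /spike_const /pole_const vand_part_at_spike.
  have -> : wp_part th q a z spk s = \prod_(j < n) wp j.
    apply: eq_bigr => j _; rewrite /wp /shiftz; congr (th _ / _).
    by rewrite exprD; ring.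
  have -> : \prod_(j < n) nu j = num_part th q m z spk / den_part th q z spk.
    rewrite /nu prodf_div; congr (_ / _); apply: eq_bigr => j _.
      by rewrite big_split /= !prod_poch_spike.
    by rewrite prod_poch_spike.
  have -> : \prod_(j < n) mi j = weight_part th q a z s * mixed_part th q a m z spk s.
    by rewrite /mi big_split.
  rewrite /product_side -/(\prod_(j < n) ps j) -/(\prod_(j < n) xx j); ring.
rewrite E; do 5![rewrite [\prod_(j < n) _](bigD1 k0) //=].
rewrite /product_side [RHS](bigD1 k0) //=.
have Ein : wp k0 * nu k0 * mi k0 * (po b s * po d s * q ^+ s * po c s) * xx k0 * ps k0 =
    po (a * q * w) (m k0) * po (b * w / a) (m k0) * po (c * w / a) (m k0) *
    po (d * w / a) (m k0) / po (w / a) (m k0).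
  rewrite -(@pole_factor_in _ th q q0 thV a b c d w (Z k0) (m k0) s) //.
  - rewrite /wp /nu /mi /xx /ps spike_in subnn poch0 div1r.
    by rewrite [z' k0]shift_spike_in (mulfK (mulf_neq0 (z0 k0) (qX s))).
  - by have := gen_a gen k0 0; rewrite expr0 mulr1.
  - exact: generic_poch_aqZ.
  - exact: generic_poch_aqVZ.
  - exact: generic_poch_za.
  - apply: poch_neq0 => i im; rewrite -exprS; exact: (gen_q gen (k := k0)).
have Eout j : j != k0 -> th (w * q ^+ s / z j) / th (w / z j) / po (z j * w) s
    * wp j * nu j * mi j * xx j * ps j =
  po (a * q * z j) (m j) * po (b * z j / a) (m j) *
      po (c * z j / a) (m j) * po (d * z j / a) (m j) / po (z j / a) (m j).
  move=> jk0; have k0j : k0 != j by rewrite eq_sym.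
  have Hr i i' : (i <= m k0)%N -> (i' <= m j)%N -> th (w * q ^+ i / (z j * q ^+ i')) != 0.
    exact: (gen_ratio gen).
  rewrite -(@pole_factor_out _ th q q0 thV a b c d w (z j) (Z j) (m j) s) //.
  - rewrite /wp /nu /mi /xx /ps (spike_out s jk0) !subn0.
    by rewrite (shift_spike_out q z s jk0) [z' k0]shift_spike_in.
  - by have := Hr 0%N 0%N isT isT; rewrite !expr0 !mulr1.
  - apply: poch_neq0_eq => i im; exists (w * q ^+ i / (z j * q ^+ 0)); last by apply: Hr; lia.
    by rewrite expr0 mulr1; ring.
  - apply: poch_neq0_eq => i im; exists (w * q ^+ i.+1 / (z j * q ^+ 0)); last by apply: Hr; lia.
    by rewrite expr0 mulr1 exprS; ring.
  - by have := gen_a gen j 0; rewrite expr0 mulr1.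
  - exact: generic_poch_a.
  - exact: generic_poch_aq.
  - apply: poch_neq0_eq => i im; exists (z j * q ^+ 0 * (w * q ^+ i)); last first.
      by apply: (gen_mul gen) => //; lia.
    by rewrite expr0 mulr1; ring.
  - exact: generic_poch_aqZ.
  - exact: generic_poch_aqVZ.
  - exact: generic_poch_aqV.
  - exact: generic_poch_za.
  - apply: poch_neq0_eq => i im; exists (w * q ^+ i / Z j); last by apply: Hr; lia.
    by rewrite mulrAC.
  - by have := generic_pole_den j; rewrite [z' k0]shift_spike_in (shift_spike_out q z s jk0)
      (spike_out s jk0) subn0.
rewrite -Ein -(eq_bigr _ Eout) !big_split /=; ring.
Qed.

End PoleEvaluation.

(** * The cleared sum at the interpolation nodes *)

Section ClearedSum.
Variables (K : fieldType) (th : K -> K) (q : K) (n : nat) (B : nat).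
Local Notation po := (poch th q).
Hypothesis q0 : q != 0.
Hypothesis th1 : th 1 = 0.
Hypothesis thV : forall x, x != 0 -> th x^-1 = - th x / x.

Let qX i : q ^+ i != 0. Proof. exact: expf_neq0. Qed.

Local Notation index := {ffun 'I_n -> 'I_B.+1}.
Local Notation nats y := (fun k => nat_of_ord ((y : index) k)).

(** All multi-indices live in one box of side B, so that the sum for m and the shifted sum for a
    smaller m have the same index type. *)
Definition below (m : 'I_n -> nat) (y : index) : bool := [forall k, (y k <= m k)%N].

Definition cleared_sum a b c d m z : K :=
  \sum_(y : index | below m y) summand th q a b c d m z (nats y).

(** (1)_Y contains theta(1) = 0 when Y > 0. In the remaining term y = 0, the relation a^2 q = bd
    gives bz/a = aqz/d and dz/a = aqz/b, which turns the clearing products into the product side. *)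
Lemma cleared_sum_at_one (z : 'I_n -> K) (m : 'I_n -> nat) (a b d : K) :
  a != 0 -> b != 0 -> d != 0 -> a ^+ 2 * q = b * d -> generic th q z m a b ->
  cleared_sum a b 1 d m z = product_side th q a b 1 d m z.
Proof.
move=> a0 b0 d0 bd gen; have z0 := gen_z gen.
pose o : index := [ffun=> ord0].
have o0 k : nat_of_ord (o k) = 0%N by rewrite ffunE.
have bo : below m o by apply/forallP => k; rewrite o0.
rewrite /cleared_sum (bigD1 o) //= big1 ?addr0; last first.
  move=> y /andP[_ yo].
  have [k yk] : exists k, (0 < y k)%N.
    apply/existsP; apply: contraNT yo; rewrite negb_exists => /forallP H.
    apply/eqP/ffunP => k; apply: val_inj => /=.
    by have := H k; rewrite -eqn0Ngt o0 => /eqP.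
  have Y0 : (0 < \sum_(k < n) y k)%N by rewrite (bigD1 k) //= addn_gt0 yk.
  rewrite /summand; have -> : po 1 (\sum_(k < n) y k) = 0.
    by apply: (poch_eq0 Y0); rewrite mulr1.
  by rewrite mulr0 mul0r !(mulr0, mul0r).
rewrite /summand big1 => [|k _]; last exact: o0.
rewrite !poch0 expr0 !mulr1.
have -> : vand_part th q z (nats o) = 1.
  apply: big1 => j _; apply: big1 => k jk; rewrite !o0 !expr0 !mulr1 poch0 divr1 divff //.
  have := @vdm_generic_neq0 _ th q n q0 z m a b gen j k 0 0; rewrite !expr0 !mulr1; apply=> //.
  by apply: contraTneq jk => ->; rewrite ltnn.
have -> : wp_part th q a z (nats o) 0 = 1.
  apply: big1 => k _; rewrite o0 expr0 mulr1 divff //.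
  by have := gen_a gen k 0; rewrite expr0 mulr1.
have -> : num_part th q m z (nats o) = 1.
  by apply: big1 => j _; apply: big1 => k _; rewrite o0 !poch0 mulr1.
have -> : den_part th q z (nats o) = 1.
  by apply: big1 => j _; apply: big1 => k _; rewrite o0 !poch0.
have -> : weight_part th q a z 0 = 1 by apply: big1 => j _; rewrite poch0.
have -> : mixed_part th q a m z (nats o) 0 = 1.
  by apply: big1 => j _; rewrite o0 !poch0 mulr1 divr1.
rewrite divr1 !mul1r -!big_split /=; apply: eq_bigr => k _.
rewrite !o0 expr0 mulr1 subn0 divr1 mul1r.
have h := generic_poch_za q0 thV a0 gen (leqnn (m k)).
rewrite (_ : b * z k / a = a * q * z k / d); last first.
  apply: (mulIf a0); apply: (mulIf d0); transitivity (b * d * z k); first by field.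
  by rewrite -bd; field.
rewrite (_ : d * z k / a = a * q * z k / b); last first.
  apply: (mulIf a0); apply: (mulIf b0); transitivity (b * d * z k); first by field.
  by rewrite -bd; field.
by field.
Qed.

(** The induction on M supplies the last hypothesis. The constant that relates the terms in
    [summand_spike] also relates the product sides, by [spike_const_product]. *)
Lemma cleared_sum_at_pole (z : 'I_n -> K) (m : 'I_n -> nat) (a b c d : K) (k0 : 'I_n) (s : nat) :
  (0 < s)%N -> (s <= m k0)%N -> (forall k, (m k <= B)%N) ->
  a != 0 -> b != 0 -> d != 0 -> c = a * q ^+ s * z k0 -> a ^+ 2 * q = b * c * d ->
  generic th q z m a b ->
  cleared_sum (a * q ^+ s) (b * q ^+ s) c (d * q ^+ s)
    (fun k => m k - spike k0 s k)%N (shiftz q z (spike k0 s)) =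
  product_side th q (a * q ^+ s) (b * q ^+ s) c (d * q ^+ s)
    (fun k => m k - spike k0 s k)%N (shiftz q z (spike k0 s)) ->
  cleared_sum a b c d m z = product_side th q a b c d m z.
Proof.
move=> s0 sm mB a0 b0 d0 cE bcd gen IH.
have z0 := gen_z gen.
have genS := generic_spike q0 a0 sm gen.
rewrite -(spike_const_product q0 thV a0 sm gen b0 d0 cE bcd) -IH /cleared_sum mulr_sumr.
rewrite (bigID (fun y : index => (s <= y k0)%N)) /= [X in _ + X]big1 ?addr0; last first.
  move=> y /andP[/forallP ym]; rewrite -ltnNge => ys.
  have E : clear_part th q a c m z (nats y) = 0.
    rewrite /clear_part (bigD1 k0) //=.
    (* This factor of the clearing product has argument q^(1 + y + i - s) with y = y_{k0} and i = s
       - y - 1, that is, 1. *)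
    rewrite (@poch_eq0 _ _ _ _ _ (s - (y k0).+1)); first by rewrite mul0r.
      by have := ym k0; lia.
    rewrite -(th1); congr th; rewrite cE.
    have := qX (s - (y k0).+1); rewrite -{2}(subnK ys) exprD.
    have := qX (y k0); have := z0 k0; rewrite exprS; move: (q ^+ _) (q ^+ _) => u v z1 u0 v0.
    by field; rewrite a0 q0 z1 u0 v0.
  by rewrite /summand E mulr0 mul0r mulr0.
pose h (y : index) : index := [ffun k => inord (spike k0 s k + y k)].
pose h' (y : index) : index := [ffun k => inord (y k - spike k0 s k)].
have hE (y : index) : below (fun k => m k - spike k0 s k)%N y ->
    forall k, nat_of_ord (h y k) = (spike k0 s k + y k)%N.
  move=> /forallP ym k; rewrite ffunE inordK //.
  by have := ym k; have := spike_leq sm k; have := mB k; lia.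
have h'E (y : index) k : nat_of_ord (h' y k) = (y k - spike k0 s k)%N.
  by rewrite ffunE inordK //; have := ltn_ord (y k); lia.
rewrite (reindex_onto h h') /=; last first.
  move=> y /andP[/forallP ym sy]; apply/ffunP => k; apply: val_inj; rewrite /= ffunE h'E.
  rewrite subnKC; first by rewrite inord_val.
  by rewrite /spike; case: eqP => // ->.
apply: eq_big => [y|y /andP[/andP[yb sy] /eqP hy]].
  apply/idP/idP.
    move=> /andP[/andP[/forallP yb sy] /eqP hy]; apply/forallP => k.
    by rewrite -hy h'E leq_sub2r.
  move=> yb; have yE := hE y yb; move/forallP: yb => yb.
  rewrite yE spike_in leq_addr andbT; apply/andP; split.
    by apply/forallP => k; rewrite yE; have := yb k; have := spike_leq sm k; lia.
  by apply/eqP/ffunP => k; apply: val_inj; rewrite /= h'E yE addKn.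
have yb' : below (fun k => m k - spike k0 s k)%N y.
  by apply/forallP => k; rewrite -hy h'E leq_sub2r //; apply: (forallP yb).
have -> : nats (h y) = (fun k => spike k0 s k + y k)%N.
  by apply: functional_extensionality => k; rewrite hE.
apply: summand_spike => //.
- exact: (generic_pole_num q0 a0 sm gen).
- exact: (generic_pole_den q0 a0 sm gen).
- move=> j k jk; have := @vdm_generic_neq0 _ th q n q0 _ _ _ _ genS j k 0 0.
  rewrite !expr0 !mulr1; apply=> //.
  by apply: contraTneq jk => ->; rewrite ltnn.
- by move=> k; have := gen_a genS k 0; rewrite expr0 mulr1.
- exact: (forallP yb').
Qed.

End ClearedSum.

(** * Interpolation in c and induction on M *)

Section ClearedIdentity.
Variables (K : fieldType) (th : K -> K) (q : K) (n : nat) (B : nat).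
Local Notation po := (poch th q).
Hypothesis q0 : q != 0.
Hypothesis th1 : th 1 = 0.
Hypothesis thV : forall x, x != 0 -> th x^-1 = - th x / x.
Hypothesis thW : forall x t u v, x != 0 -> t != 0 -> u != 0 -> v != 0 ->
  thpair th x t * thpair th v u * thpair th u v =
  thpair th x u * thpair th v t * thpair th u v + thpair th x v * thpair th u t * thpair th v u.
Hypothesis sqrtK : forall x : K, exists y, y ^+ 2 = x.

Let qX i : q ^+ i != 0. Proof. exact: expf_neq0. Qed.

Local Notation index := {ffun 'I_n -> 'I_B.+1}.
Local Notation nats y := (fun k => nat_of_ord ((y : index) k)).

Lemma thprod_cat (xs ys : seq K) t : thprod th (xs ++ ys) t = thprod th xs t * thprod th ys t.
Proof. by rewrite /thprod big_cat. Qed.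

Lemma thprod_poch (u t : K) l : thprod th [seq u * q ^+ i | i <- iota 0 l] t =
  po (u * t) l * po (u / t) l.
Proof.
rewrite /thprod big_map /poch -big_split /= /index_iota subn0.
by apply: eq_bigr => i _; rewrite /thpair; congr (th _ * th _); rewrite mulrAC.
Qed.

Lemma thprod_flatten (I : Type) (r : seq I) (F : I -> seq K) t :
  thprod th (flatten [seq F i | i <- r]) t = \prod_(i <- r) thprod th (F i) t.
Proof.
elim: r => [|i r IH] /=; first by rewrite /thprod !big_nil.
by rewrite thprod_cat IH big_cons.
Qed.

Lemma all_neq0_map (u : K) l : u != 0 -> all (fun x => x != 0) [seq u * q ^+ i | i <- iota 0 l].
Proof. by move=> u0; apply/allP => x /mapP[i _ ->]; rewrite mulf_neq0. Qed.

Lemma size_flatten_map (F : 'I_n -> seq K) :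
  size (flatten [seq F i | i <- enum 'I_n]) = (\sum_(i < n) size (F i))%N.
Proof. by rewrite size_flatten /shape -map_comp sumnE big_map big_enum. Qed.

Lemma cleared_sum_eq (z : 'I_n -> K) (m : 'I_n -> nat) (a b c d : K) :
  (forall k, (m k <= B)%N) -> a != 0 -> b != 0 -> c != 0 -> d != 0 ->
  a ^+ 2 * q = b * c * d -> generic th q z m a b ->
  cleared_sum th q B a b c d m z = product_side th q a b c d m z.
Proof.
have [M] := ubnP (\sum_(k < n) m k)%N.
elim: M z m a b c d => [|M IH] z m a b c d; first by rewrite ltn0.
rewrite ltnS => mM mB a0 b0 c0 d0 bcd gen; have z0 := gen_z gen.
(* With e fixed, t = c / e moves c = e t and d = e / t while their product stays the same. *)
have [e eE] := sqrtK (c * d).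
have e0 : e != 0.
  by apply: contra_eq_neq eE => ->; rewrite expr0n /= eq_sym mulf_neq0.
have e2b : a ^+ 2 * q = b * e ^+ 2 by rewrite eE bcd mulrA.
pose kc (y : index) : K := let Y := (\sum_(k < n) y k)%N in
  vand_part th q z (nats y) * wp_part th q a z (nats y) Y * num_part th q m z (nats y)
  / den_part th q z (nats y) * weight_part th q a z Y * mixed_part th q a m z (nats y) Y
  * po b Y * q ^+ Y * clear_part th q a b m z (nats y).
(* The symbols (c,d)_{|y|} give |y| pairs and the clearing products for c and d give m_k - y_k for
   each k: M pairs in all, whatever y is. *)
pose xs (y : index) := [seq e * q ^+ i | i <- iota 0 (\sum_(k < n) y k)%N] ++
  flatten [seq [seq a * q * (z k * q ^+ y k) / e * q ^+ i | i <- iota 0 (m k - y k)%N]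
          | k <- enum 'I_n].
pose ks : K := \prod_(k < n) (po (a * q * z k) (m k) * po (b * z k / a) (m k) / po (z k / a) (m k)).
pose ys := flatten [seq [seq e * z k / a * q ^+ i | i <- iota 0 (m k)] | k <- enum 'I_n].
have Tsum t : t != 0 -> cleared_sum th q B a b (e * t) (e / t) m z =
    \sum_(y : index | below m y) kc y * thprod th (xs y) t.
  move=> t0; apply: eq_bigr => y _; rewrite /xs thprod_cat thprod_poch thprod_flatten big_enum /=.
  rewrite (eq_bigr (fun k => po (a * q * (z k * q ^+ y k) / (e * t)) (m k - y k) *
     po (a * q * (z k * q ^+ y k) / (e / t)) (m k - y k))); last first.
    move=> k _; rewrite thprod_poch [LHS]mulrC.
    by congr (po _ _ * po _ _); move: (q ^+ y k) => u; field; rewrite ?e0 ?t0.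
  rewrite big_split /= -/(clear_part th q a (e * t) m z (nats y))
    -/(clear_part th q a (e / t) m z (nats y)) /summand /kc; ring.
have Rprod t : t != 0 -> product_side th q a b (e * t) (e / t) m z = ks * thprod th ys t.
  move=> t0; rewrite /ys thprod_flatten big_enum /= /ks -big_split /=.
  apply: eq_bigr => k _; rewrite thprod_poch.
  have -> : e * z k / a * t = e * t * z k / a by ring.
  have -> : e * z k / a / t = e / t * z k / a by ring.
  by ring.
(* [None] is the node c = 1, and (k, i) is the node c = a q^(i+1) z_k, in the variable t = c / e. *)
pose J := option {k : 'I_n & 'I_(m k)}.
pose tau (j : J) : K := match j with
  | None => e^-1
  | Some (existT k i) => a * q ^+ i.+1 * z k / e end.
have tau0 j : tau j != 0.
  by case: j => [[k i]|] /=; rewrite ?mulf_neq0 ?invr_eq0.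
have cJ : #|{: J}| = (size ys).+1.
  rewrite card_option card_tagged; congr _.+1.
  rewrite /ys size_flatten_map sumnE big_map big_enum /=.
  by apply: eq_bigr => k _; rewrite card_ord size_map size_iota.
have ltm k (i : 'I_(m k)) : (i < m k)%N by [].
have thi x : x != 0 -> th x != 0 -> th x^-1 != 0 by apply: th_inv_neq0.
(* Since e^2 = a^2 q / b, products of two nodes are free of e and fall under [gen_b] and [gen_ba];
   quotients fall under [gen_ratio], [gen_q] and [gen_a]. *)
have sep i j : i != j -> thpair th (tau i) (tau j) != 0.
  have sep0 k (l : 'I_(m k)) : th (e^-1 * (a * q ^+ l.+1 * z k / e)) != 0.
    rewrite (_ : e^-1 * _ = b * z k * q ^+ l / a); first exact: (gen_ba gen).
    apply: (mulIf a0); apply: (mulIf e0); apply: (mulIf e0); rewrite exprS.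
    transitivity (a ^+ 2 * q * q ^+ l * z k); first by field.
    by rewrite e2b; field.
  have sep1 k (l : 'I_(m k)) : th (a * q ^+ l.+1 * z k) != 0.
    by rewrite mulrAC; apply: (gen_a gen).
  case: i j => [[k i]|] [[k' i']|] //= ij.
  - rewrite mulf_neq0 //.
      rewrite (_ : a * q ^+ i.+1 * z k / e * _ = b * (z k * z k') * q ^+ (i + i').+1);
        first exact: (gen_b gen).
      apply: (mulIf e0); apply: (mulIf e0); rewrite !exprS exprD.
      transitivity (a ^+ 2 * q * (q * q ^+ i * q ^+ i' * z k * z k')); first by field.
      by rewrite e2b; ring.
    rewrite (_ : a * q ^+ i.+1 * z k / e / _ = z k * q ^+ i.+1 / (z k' * q ^+ i'.+1)); last first.
      have := qX i'.+1; have := z0 k'; move: (q ^+ _) (q ^+ _) => u v z1 v0.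
      by field; rewrite a0 e0 z1 v0.
    case: (eqVneq k k') => [E|kk']; last first.
      by apply: (gen_ratio gen); rewrite 1?eq_sym // ltm.
    subst k'; have {ij} : (i : nat) != i'.
      by apply: contra ij => /eqP /val_inj ->.
    rewrite -mulf_div divff // mul1r neq_ltn => /orP[ii|ii].
      rewrite -invf_div; apply: thi; first by rewrite mulf_neq0 ?invr_eq0.
      rewrite (_ : q ^+ i'.+1 = q ^+ (i' - i) * q ^+ i.+1) ?mulfK //; last first.
        by rewrite -exprD; congr (_ ^+ _); lia.
      by apply: (gen_q gen (k := k)); have := ltm _ i'; lia.
    rewrite (_ : q ^+ i.+1 = q ^+ (i - i') * q ^+ i'.+1) ?mulfK //; last first.
      by rewrite -exprD; congr (_ ^+ _); lia.
    by apply: (gen_q gen (k := k)); have := ltm _ i; lia.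
  - rewrite mulf_neq0 //; first by rewrite mulrC.
    by rewrite invrK divfK.
  - rewrite mulf_neq0 //.
    rewrite (_ : e^-1 / _ = (a * q ^+ i'.+1 * z k')^-1); last first.
      have := qX i'.+1; have := z0 k'; move: (q ^+ _) => u h1 h2.
      by field; rewrite a0 e0 h1 h2.
    by apply: thi => //; rewrite !mulf_neq0.
have cE : c = e * (c / e) by rewrite mulrC divfK.
have dE : d = e / (c / e).
  by apply: (mulfI c0); rewrite -eE invf_div; field; rewrite ?c0 ?e0.
rewrite cE dE Tsum ?Rprod ?mulf_neq0 ?invr_eq0 //.
apply: (thprod_interpolation thW tau0 sep) => //; last by rewrite mulf_neq0 ?invr_eq0.
- move=> y _; rewrite all_cat all_neq0_map //=; apply/allP => x /flattenP[s /mapP[k _ ->]].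
  by move: x; apply/allP; apply: all_neq0_map; rewrite !mulf_neq0 ?invr_eq0.
- move=> y /forallP ym; rewrite size_cat size_map size_iota !size_flatten_map -big_split /=.
  by apply: eq_bigr => k _; rewrite !size_map !size_iota subnKC.
- apply/allP => x /flattenP[s /mapP[k _ ->]].
  by move: x; apply/allP; apply: all_neq0_map; rewrite !mulf_neq0 ?invr_eq0.
move=> j; rewrite -Tsum // -Rprod //.
case: j => [[k i]|] /=; last first.
  rewrite mulfV // invrK -expr2; apply: cleared_sum_at_one => //.
  exact: expf_neq0.
have cE' : e * (a * q ^+ i.+1 * z k / e) = a * q ^+ i.+1 * z k by rewrite mulrC divfK.
rewrite cE'; set c' := a * _ * _; set d' := e / _.
have c'0 : c' != 0 by rewrite !mulf_neq0.
have d'0 : d' != 0 by rewrite mulf_neq0 // invr_eq0 mulf_neq0 // invr_eq0.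
have bcd' : a ^+ 2 * q = b * c' * d'.
  rewrite e2b /d' /c'; have := qX i.+1; have := z0 k; move: (q ^+ _) => u h1 h2.
  by field; rewrite a0 e0 h1 h2.
apply: (@cleared_sum_at_pole _ th q n B q0 th1 thV z m a b c' d' k i.+1) => //.
have sm : (i < m k)%N by [].
apply: IH.
- apply: leq_trans mM; rewrite (bigD1 k) //= [X in (_ < X)%N](bigD1 k) //=.
  rewrite spike_in -addSn leq_add //; first by lia.
  by apply: leq_sum => l lk; rewrite spike_out // subn0.
- by move=> l; apply: leq_trans (mB l); apply: leq_subr.
- by rewrite mulf_neq0.
- by rewrite mulf_neq0.
- by [].
- by rewrite mulf_neq0.
- by transitivity (a ^+ 2 * q * (q ^+ i.+1 * q ^+ i.+1)); [ring | rewrite bcd'; ring].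
- exact: generic_spike.
Qed.

End ClearedIdentity.

From mathcomp Require Import all_classical all_reals all_analysis.
Import numFieldNormedType.Exports.

(** * The theta function *)

Section RealPreliminaries.
Variable R : realType.

(** Convergence is mostly handled through explicit errors A r^n; this is how such an error is
    dropped from an estimate. *)
Lemma le_of_geometric (a b A r : R) : 0 <= r < 1 ->
  (forall n, a <= b + A * r ^+ n) -> a <= b.
Proof.
move=> /andP[r0 r1] H; rewrite leNgt; apply/negP => ba.
have := @cvg_geometric R A r; rewrite ger0_norm // => /(_ r1).
move=> /cvgrPdist_lt /(_ (a - b)); rewrite subr_gt0 => /(_ ba) [N _ /(_ N (leqnn N))] /=.
rewrite sub0r normrN => h.
have := H N; have := ler_norm (A * r ^+ N); lra.
Qed.

Lemma geometric_sum_le (r : R) n : 0 <= r < 1 -> \sum_(0 <= j < n) r ^+ j <= (1 - r)^-1.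
Proof.
move=> /andP[r0 r1]; have r1' : 0 < 1 - r by rewrite subr_gt0.
have -> : \sum_(0 <= j < n) r ^+ j = (1 - r ^+ n) / (1 - r).
  have d0 : 1 - r != 0 by rewrite gt_eqF.
  elim: n => [|n IH]; first by rewrite big_geq // expr0 subrr mul0r.
  by rewrite big_nat_recr //= IH exprS; field.
rewrite ler_pdivrMr // mulVf ?gt_eqF //; have := exprn_ge0 n r0; lra.
Qed.

Lemma prod_le_expR (f : nat -> R) n : (forall j, 0 <= f j) ->
  \prod_(0 <= j < n) (1 + f j) <= expR (\sum_(0 <= j < n) f j).
Proof.
move=> f0; elim: n => [|n IH]; first by rewrite !big_geq // expR0.
rewrite !big_nat_recr //= expRD; apply: ler_pM => //.
- by apply: prodr_ge0 => j _; have := f0 j; lra.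
- by have := f0 n; lra.
- exact: expR_ge1Dx.
Qed.

(** Nested intervals: with e_n the tail of the geometric series, x_n - e_n increases and x_n + e_n
    decreases, and the limit is the supremum of the lower ends. *)
Lemma real_geometric_limit (x : nat -> R) (A r : R) : 0 <= r < 1 ->
  (forall n, `|x n.+1 - x n| <= A * r ^+ n) ->
  exists l, forall n, `|x n - l| <= A * r ^+ n / (1 - r).
Proof.
move=> /andP[r0 r1] H; have d0 : 0 < 1 - r by rewrite subr_gt0.
have d0' : 1 - r != 0 by rewrite gt_eqF.
have A0 : 0 <= A by have := H 0%N; rewrite expr0 mulr1; apply: le_trans.
pose e n := A * r ^+ n / (1 - r).
have e0 n : 0 <= e n by rewrite /e divr_ge0 ?mulr_ge0 ?exprn_ge0 // ltW.
have eS n : e n - e n.+1 = A * r ^+ n by rewrite /e exprS; field.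
pose y n := x n - e n; pose z n := x n + e n.
have yS n : y n <= y n.+1.
  by rewrite /y; have := eS n; have := H n; rewrite ler_norml => /andP[]; lra.
have zS n : z n.+1 <= z n.
  by rewrite /z; have := eS n; have := H n; rewrite ler_norml => /andP[]; lra.
have yz n m : y n <= z m.
  have ymono i j : (i <= j)%N -> y i <= y j.
    by move=> /subnK <-; elim: (j - i)%N => //= k IH; apply: le_trans IH (yS _).
  have zmono i j : (i <= j)%N -> z j <= z i.
    by move=> /subnK <-; elim: (j - i)%N => //= k IH; apply: le_trans (zS _) IH.
  have [nm|mn] := leqP n m.
    by apply: (le_trans (ymono _ _ nm)); rewrite /y /z; have := e0 m; lra.
  by apply: le_trans (zmono _ _ (ltnW mn)); rewrite /y /z; have := e0 n; lra.
exists (sup (range y)) => n.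
have ub : ubound (range y) (z n) by move=> _ [k _ <-].
have h1 : sup (range y) <= z n by apply: ge_sup => //; exists (y 0%N), 0%N.
have h2 : y n <= sup (range y) by apply: ub_le_sup; [exists (z n) | exists n].
rewrite -/(e n) ler_norml; move: h1 h2; rewrite /y /z; lra.
Qed.

End RealPreliminaries.

(** Real-valued, whereas the norm of R[i] takes its values in R[i]: the estimates are then made in a
    totally ordered field. *)
Record absolute_value (R : realType) (K : fieldType) (nm : K -> R) : Prop := AbsoluteValue {
  av_ge0 : forall x, 0 <= nm x;
  av0 : nm 0 = 0;
  av_eq0 : forall x, nm x = 0 -> x = 0;
  av1 : nm 1 = 1;
  avM : forall x y, nm (x * y) = nm x * nm y;
  avD : forall x y, nm (x + y) <= nm x + nm y;
  avN : forall x, nm (- x) = nm x }.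

(** The factor 2 comes from the complex case, where real and imaginary parts converge separately. *)
Definition geometrically_complete (R : realType) (K : fieldType) (nm : K -> R) : Prop :=
  forall (u : nat -> K) (A r : R), 0 <= r < 1 ->
  (forall n, nm (u n.+1 - u n) <= A * r ^+ n) ->
  exists l, forall n, nm (u n - l) <= A * r ^+ n / (1 - r) *+ 2.

(** * The infinite product (x; p)_oo *)

Section QPochhammer.
Variables (R : realType) (K : fieldType) (nm : K -> R).
Hypothesis av : absolute_value nm.
Hypothesis complete : geometrically_complete nm.
Variable p : K.
Hypothesis p1 : nm p < 1.

Let r := nm p.
Let r0 : 0 <= r. Proof. exact: (av_ge0 av). Qed.
Let r01 : 0 <= r < 1. Proof. by rewrite r0. Qed.
Let d0 : 0 < 1 - r. Proof. by rewrite subr_gt0. Qed.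

Lemma avX x n : nm (x ^+ n) = nm x ^+ n.
Proof. by elim: n => [|n IH]; rewrite ?expr0 ?(av1 av) // !exprS (avM av) IH. Qed.

Lemma av_neq0 x : x != 0 -> 0 < nm x.
Proof.
move=> x0; rewrite lt_neqAle (av_ge0 av) andbT eq_sym.
by apply: contra x0 => /eqP /(av_eq0 av) ->.
Qed.

Lemma av_sub x y : nm (x - y) = nm (y - x).
Proof. by rewrite -(avN av) opprB. Qed.

Lemma av_triangle x y z : nm (x - z) <= nm (x - y) + nm (y - z).
Proof. by have := avD av (x - y) (y - z); rewrite addrA subrK. Qed.

Lemma av_unique x y A s : 0 <= s < 1 -> (forall n, nm (x - y) <= A * s ^+ n) -> x = y.
Proof.
move=> s01 H; apply/eqP; rewrite -subr_eq0; apply/eqP; apply: (av_eq0 av).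
apply/eqP; rewrite eq_le (av_ge0 av) andbT; apply: (le_of_geometric (A := A) s01) => n.
by rewrite add0r.
Qed.

(** The symbol (x; p)_n in base p, with limit [qinf]; the factors of [poch], by contrast, are theta
    functions. *)
Definition qpart (n : nat) (x : K) : K := \prod_(0 <= j < n) (1 - p ^+ j * x).

Lemma qpartS n x : qpart n.+1 x = qpart n x * (1 - p ^+ n * x).
Proof. by rewrite /qpart big_nat_recr. Qed.

Lemma qpartD n k x : qpart (n + k) x = qpart n x * qpart k (p ^+ n * x).
Proof.
elim: k => [|k IH]; first by rewrite addn0 /qpart (big_geq (leqnn 0)) mulr1.
by rewrite addnS !qpartS IH mulrA (mulrA (p ^+ k)) -exprD addnC.
Qed.

(** By 1 + u <= exp u and the geometric series, a bound of (x; p)_n for |x| <= rho that is uniform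
    in n. *)
Definition qbound (rho : R) : R := expR (rho / (1 - r)).

Lemma qbound_ge1 rho : 0 <= rho -> 1 <= qbound rho.
Proof. by move=> rho0; rewrite -expR0 ler_expR divr_ge0 // ltW. Qed.

Lemma prod_qbound rho n : 0 <= rho ->
  \prod_(0 <= j < n) (1 + r ^+ j * rho) <= qbound rho.
Proof.
move=> rho0; apply: le_trans (prod_le_expR _ _) _.
  by move=> j; rewrite mulr_ge0 ?exprn_ge0.
rewrite ler_expR -mulr_suml mulrC; apply: ler_wpM2l => //.
exact: geometric_sum_le.
Qed.

Lemma prod_qbound_ge1 rho n : 0 <= rho -> 1 <= \prod_(0 <= j < n) (1 + r ^+ j * rho).
Proof.
move=> rho0; elim: n => [|n IH]; first by rewrite big_geq.
rewrite big_nat_recr //=; have : 0 <= r ^+ n * rho by rewrite mulr_ge0 ?exprn_ge0.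
nra.
Qed.

Lemma factor_le x rho j : nm x <= rho -> nm (1 - p ^+ j * x) <= 1 + r ^+ j * rho.
Proof.
move=> xr; apply: le_trans (avD av _ _) _; rewrite (av1 av) (avN av) (avM av) avX.
by rewrite lerD2l ler_wpM2l ?exprn_ge0.
Qed.

Lemma qpart_le_prod n x rho : nm x <= rho -> nm (qpart n x) <= \prod_(0 <= j < n) (1 + r ^+ j * rho).
Proof.
move=> xr; elim: n => [|n IH]; first by rewrite /qpart !big_geq // (av1 av).
by rewrite qpartS big_nat_recr //= (avM av) ler_pM ?(av_ge0 av) // factor_le.
Qed.

Lemma qpart_le n x rho : nm x <= rho -> nm (qpart n x) <= qbound rho.
Proof.
move=> xr; apply: le_trans (qpart_le_prod n xr) _; apply: prod_qbound.
exact: le_trans (av_ge0 av x) xr.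
Qed.

Lemma qpart_step n x rho : nm x <= rho ->
  nm (qpart n.+1 x - qpart n x) <= qbound rho * rho * r ^+ n.
Proof.
move=> xr; rewrite qpartS mulrBr mulr1 addrC addKr (avN av) !(avM av) avX -mulrA (mulrC rho).
by rewrite !ler_pM ?mulr_ge0 ?(av_ge0 av) ?exprn_ge0 ?qpart_le.
Qed.

(** The constant does not depend on n, so the bound passes to [qinf]; this is the source of the
    continuity of theta. *)
Lemma qpart_lip n x y rho : nm x <= rho -> nm y <= rho ->
  nm (qpart n x - qpart n y) <= qbound rho ^+ 2 / (1 - r) * nm (x - y).
Proof.
move=> xr yr; have rho0 : 0 <= rho by apply: le_trans (av_ge0 av x) xr.
have E1 := qbound_ge1 rho0.
(* The induction carries the partial product and the partial sum themselves, because they grow by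
   exactly the new term; they are replaced by uniform bounds afterwards. *)
apply: (@le_trans _ _ ((\prod_(0 <= j < n) (1 + r ^+ j * rho)) *
   (\sum_(0 <= j < n) r ^+ j) * qbound rho * nm (x - y))).
  elim: n => [|n IH].
    by rewrite /qpart !big_geq // subrr (av0 av) mulr0 !mul0r.
  have -> : qpart n.+1 x - qpart n.+1 y =
      (qpart n x - qpart n y) * (1 - p ^+ n * x) - qpart n y * p ^+ n * (x - y).
    by rewrite !qpartS; ring.
  apply: le_trans (avD av _ _) _; rewrite (avN av) !(avM av) avX !big_nat_recr //=.
  have h1 := factor_le n xr; have h2 := qpart_le n yr.
  have h3 := prod_qbound_ge1 n rho0.
  have S0 : 0 <= \sum_(0 <= j < n) r ^+ j by apply: sumr_ge0 => j _; apply: exprn_ge0.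
  move: IH h1 h2 h3 S0.
  move: (\prod_(0 <= j < n) _) (\sum_(0 <= j < n) _) => P S.
  have := av_ge0 av (x - y); have := av_ge0 av (qpart n x - qpart n y).
  have := av_ge0 av (1 - p ^+ n * x); have := av_ge0 av (qpart n y).
  have rn := exprn_ge0 n r0; move: rn; rewrite -!/r => rn.
  move: (rn).
  have : 0 <= r ^+ n * rho by rewrite mulr_ge0 ?exprn_ge0.
  rewrite -!/r => t0; have T1 : 1 <= 1 + r ^+ n * rho by lra.
  move: T1 {t0}; move: (nm (x - y)) (nm (qpart n x - qpart n y))
    (nm (1 - p ^+ n * x)) (nm (qpart n y)) (r ^+ n) (1 + r ^+ n * rho) (qbound rho) E1.
  move=> D q1 f q2 u T E E1 T1 q20 f0 q10 D0 u0 IH h1 h2 h3 S0.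
  have -> : P * T * (S + u) * E * D = P * S * E * D * T + E * u * D * (P * T) by ring.
  apply: lerD; first by apply: ler_pM.
  apply: le_trans (_ : E * u * D <= _).
    by rewrite ler_wpM2r // ler_wpM2r.
  have EuD0 : 0 <= E * u * D by rewrite !mulr_ge0 // (le_trans _ E1).
  by apply: ler_peMr => //; nra.
rewrite ler_wpM2r ?(av_ge0 av) // mulrAC expr2 -mulrA.
have h1 := prod_qbound n rho0; have h2 := geometric_sum_le n r01.
have h3 := prod_qbound_ge1 n rho0.
have S0 : 0 <= \sum_(0 <= j < n) r ^+ j by apply: sumr_ge0 => j _; apply: exprn_ge0.
rewrite -mulrA; apply: ler_pM => //; first by lra.
  by rewrite mulr_ge0 // (le_trans _ E1).
by rewrite ler_wpM2l // (le_trans _ E1).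
Qed.

Lemma qinf_exists x : exists l, forall n,
  nm (qpart n x - l) <= qbound (nm x) * nm x * r ^+ n / (1 - r) *+ 2.
Proof. by apply: complete => // n; apply: qpart_step. Qed.

Definition qinf (x : K) : K := projT1 (cid (qinf_exists x)).

Lemma qinf_rate x n : nm (qpart n x - qinf x) <= (qbound (nm x) * nm x / (1 - r) *+ 2) * r ^+ n.
Proof.
have := projT2 (cid (qinf_exists x)) n; rewrite -/(qinf x).
by rewrite mulrnAl mulrAC.
Qed.

Lemma qinf_lip x y rho : nm x <= rho -> nm y <= rho ->
  nm (qinf x - qinf y) <= qbound rho ^+ 2 / (1 - r) * nm (x - y).
Proof.
move=> xr yr.
apply: (@le_of_geometric _ _ _ (qbound (nm x) * nm x / (1 - r) *+ 2 +
  qbound (nm y) * nm y / (1 - r) *+ 2) r) => // n.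
have h1 := qinf_rate x n; have h2 := qinf_rate y n; have h3 := qpart_lip n xr yr.
have h4 := av_triangle (qinf x) (qpart n x) (qinf y).
have h5 := av_triangle (qpart n x) (qpart n y) (qinf y).
rewrite av_sub in h1; rewrite mulrDl -!/r in h1 h2 h3 h4 h5 *; lra.
Qed.

Lemma qinf_unique x l A : (forall n, nm (qpart n x - l) <= A * r ^+ n) -> qinf x = l.
Proof.
move=> H; apply: (@av_unique _ _ (qbound (nm x) * nm x / (1 - r) *+ 2 + A) r) => // n.
have h1 := qinf_rate x n; have h2 := H n; have h3 := av_triangle (qinf x) (qpart n x) l.
rewrite av_sub in h1; rewrite mulrDl -!/r in h1 h2 h3 *; lra.
Qed.

Lemma qinf_le x rho : nm x <= rho -> nm (qinf x) <= qbound rho.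
Proof.
move=> xr; apply: (@le_of_geometric _ _ _ (qbound (nm x) * nm x / (1 - r) *+ 2) r) => // n.
have h1 := qinf_rate x n; have h2 := qpart_le n xr.
have h3 := avD av (qpart n x) (qinf x - qpart n x); rewrite subrKC in h3.
rewrite av_sub in h1; rewrite -!/r in h1 *; lra.
Qed.

Lemma qinf_split n x : qinf x = qpart n x * qinf (p ^+ n * x).
Proof.
set y := p ^+ n * x.
set A := qbound (nm y) * nm y / (1 - r) *+ 2.
apply: (@av_unique _ _ (qbound (nm x) * nm x / (1 - r) *+ 2 + nm (qpart n x) * A) r) => // k.
have h1 := qinf_rate x (n + k); have h2 := qinf_rate y k.
have h3 := av_triangle (qinf x) (qpart (n + k) x) (qpart n x * qinf y).
rewrite av_sub in h1; rewrite qpartD -/y -mulrBr (avM av) in h3.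
have h4 : r ^+ (n + k) <= r ^+ k.
  by rewrite exprD ler_piMl ?exprn_ge0 // exprn_ile1 // ltW.
have h5 := av_ge0 av x; have h6 := qbound_ge1 h5.
have h7 : nm (qinf x - qpart (n + k) x) <= (qbound (nm x) * nm x / (1 - r) *+ 2) * r ^+ k.
  apply: le_trans h1 _; apply: ler_wpM2l h4; apply: mulrn_wge0; apply: divr_ge0; last exact: ltW.
  by apply: mulr_ge0 => //; apply: le_trans h6.
have h8 : nm (qpart n x) * nm (qpart k y - qinf y) <= nm (qpart n x) * A * r ^+ k.
  by rewrite -mulrA ler_wpM2l ?(av_ge0 av).
rewrite qpartD -/y in h7; apply: (le_trans h3); rewrite mulrDl; exact: lerD.
Qed.

(** The inequality prod (1 - u_j) >= 1 - sum u_j. The bound on rho keeps the sum at most 1/2, so the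
    limit stays away from 0. *)
Lemma qpart_ge n x rho : 0 <= rho -> nm x <= rho -> rho <= (1 - r) / 2 ->
  1 - rho * (\sum_(0 <= j < n) r ^+ j) <= nm (qpart n x).
Proof.
move=> rho0 xr rho1.
have S1 k : rho * (\sum_(0 <= j < k) r ^+ j) <= 2^-1.
  have h := geometric_sum_le k r01.
  apply: le_trans (_ : (1 - r) / 2 * (1 - r)^-1 <= _).
    by rewrite ler_pM // sumr_ge0 // => j _; apply: exprn_ge0.
  by rewrite mulrAC divff ?gt_eqF // mul1r.
elim: n => [|n IH]; first by rewrite /qpart !big_geq // mulr0 subr0 (av1 av).
rewrite qpartS (avM av) big_nat_recr //=.
have h1 : 1 - r ^+ n * rho <= nm (1 - p ^+ n * x).
  have := avD av (1 - p ^+ n * x) (p ^+ n * x); rewrite subrK (av1 av) (avM av) avX -/r.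
  have : r ^+ n * nm x <= r ^+ n * rho by rewrite ler_wpM2l ?exprn_ge0.
  lra.
have h2 := S1 n; have h3 := S1 n.+1; rewrite big_nat_recr //= in h3.
have S0 : 0 <= \sum_(0 <= j < n) r ^+ j by apply: sumr_ge0 => j _; apply: exprn_ge0.
have rn := exprn_ge0 n r0.
move: IH h1 h2 h3 S0 rn; move: (nm _) (nm _) (\sum_(0 <= j < n) _) (r ^+ n) => u v S t.
move=> IH h1 h2 h3 S0 t0.
have a1 : 0 <= rho * S by rewrite mulr_ge0.
have a2 : 0 <= t * rho by rewrite mulr_ge0.
apply: le_trans (_ : (1 - rho * S) * (1 - t * rho) <= _).
  by rewrite -subr_ge0 (_ : _ - _ = (rho * S) * (t * rho)) ?mulr_ge0 //; ring.
by apply: ler_pM => //; lra.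
Qed.

Lemma qinf_small_neq0 x : nm x <= (1 - r) / 2 -> qinf x != 0.
Proof.
move=> xr; apply: contraTneq (isT : true) => q0; exfalso.
suff : (2^-1 : R) <= 0 by lra.
apply: (@le_of_geometric _ _ _ (qbound (nm x) * nm x / (1 - r) *+ 2) r) => // n.
have h1 := qinf_rate x n; rewrite q0 subr0 in h1.
have h2 := qpart_ge n (av_ge0 av x) (lexx _) xr.
have h : nm x * (\sum_(0 <= j < n) r ^+ j) <= 2^-1.
  have h := geometric_sum_le n r01.
  apply: le_trans (_ : (1 - r) / 2 * (1 - r)^-1 <= _).
    by rewrite ler_pM ?(av_ge0 av) // sumr_ge0 // => j _; apply: exprn_ge0.
  by rewrite mulrAC divff ?gt_eqF // mul1r.
rewrite -/r in h1 *; lra.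
Qed.

Lemma exists_expr_small (A e : R) : 0 < e -> exists n, A * r ^+ n <= e.
Proof.
move=> e0; apply: contrapT => /forallNP H.
suff : e <= 0 by rewrite leNgt e0.
by apply: (@le_of_geometric _ _ _ A r) => // n; have /negP := H n; rewrite -ltNge add0r => /ltW.
Qed.

(** For large n the tail (p^n x; p)_oo is nonzero by [qinf_small_neq0], so a zero comes from one of
    the finitely many factors split off. *)
Lemma qinf_zero x : qinf x = 0 -> exists n, p ^+ n * x = 1.
Proof.
move=> q0.
have [n hn] := @exists_expr_small (nm x) ((1 - r) / 2) (divr_gt0 d0 (ltr0Sn _ _)).
have : qpart n x * qinf (p ^+ n * x) = 0 by rewrite -qinf_split.
move=> /eqP; rewrite mulf_eq0 (negbTE (qinf_small_neq0 _)) ?orbF; last first.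
  by rewrite (avM av) avX mulrC.
rewrite /qpart prodf_seq_eq0 => /hasP[j _ /=].
by rewrite subr_eq0 eq_sym => /eqP ?; exists j.
Qed.

Lemma qpart_one n : (0 < n)%N -> qpart n 1 = 0.
Proof. by case: n => // n _; rewrite /qpart big_nat_recl //= expr0 mulr1 subrr mul0r. Qed.

Lemma qinf1 : qinf 1 = 0.
Proof. by rewrite (qinf_split 1) qpart_one // mul0r. Qed.

End QPochhammer.

(** * The finite Jacobi triple product *)

Section FiniteTripleProduct.
Variables (K : fieldType) (p s : K).
Hypothesis p0 : p != 0.
Hypothesis pn1 : forall n, 1 - p ^+ n.+1 != 0.
Hypothesis sE : s ^+ 2 = p.

Let s0 : s != 0.
Proof. by apply: contraNneq p0 => s0; rewrite -sE s0 expr0n. Qed.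

Local Notation pf n := (qpart p n p).

Lemma qfact_neq0 n : pf n != 0.
Proof. by rewrite prodf_seq_neq0; apply/allP => j _ /=; rewrite -exprSr. Qed.

Definition gaussbin (n k : nat) : K := if (k <= n)%N then pf n / (pf k * pf (n - k)) else 0.

Lemma gaussbin0 n : gaussbin n 0 = 1.
Proof.
rewrite /gaussbin leq0n subn0 {2}/qpart big_geq // mul1r.
by rewrite divff ?qfact_neq0.
Qed.

Lemma gaussbin_pascal n k : (k <= n)%N ->
  gaussbin n.+1 k.+1 = gaussbin n k.+1 + p ^+ (n - k) * gaussbin n k.
Proof.
move=> kn; rewrite /gaussbin ltnS kn subSS.
have := qfact_neq0 k; have := qfact_neq0 k.+1; have := qfact_neq0 (n - k); have := qfact_neq0 n.
have := pn1 k; have := pn1 (n - k).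
case: ltnP => [kn'|nk].
  have nE : (n - k = (n - k.+1).+1)%N by lia.
  rewrite nE !qpartS -!exprSr -nE.
  have -> : p ^+ n.+1 = p ^+ (n - k) * p ^+ k.+1 by rewrite -exprD; congr (_ ^+ _); lia.
  move: (pn1 (n - k.+1)); rewrite -nE.
  move: (p ^+ k.+1) (p ^+ (n - k)) (qpart _ _ _) (qpart _ _ _) (qpart _ _ _) => u v a b c.
  move=> v1 _ u1 a0; rewrite !mulf_eq0 !negb_or => /andP[c0 _] /andP[b0 _] _.
  by field; rewrite ?v1 ?u1 ?b0 ?c0.
have -> : n = k by lia.
rewrite subnn add0r expr0 mul1r.
have -> : pf 0 = 1 by rewrite /qpart big_geq.
by rewrite !mulr1 => *; rewrite !divff.
Qed.

Lemma gaussbin_big n k : (n < k)%N -> gaussbin n k = 0.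
Proof. by rewrite /gaussbin ltnNge => /negbTE ->. Qed.

(** The finite q-binomial theorem in base p, by Pascal's rule. *)
Lemma qbinomial n x : qpart p n x = \sum_(0 <= k < n.+1) gaussbin n k * p ^+ 'C(k, 2) * (- x) ^+ k.
Proof.
elim: n => [|n IH].
  by rewrite big_nat1 /qpart big_geq // gaussbin0 expr0 !mulr1.
(* The sum is extended by the zero coefficient at k = n + 1, so that it pairs term by term with the
   one multiplied by p^n x. *)
have H : qpart p n x = 1 + \sum_(0 <= k < n.+1) gaussbin n k.+1 * p ^+ 'C(k.+1, 2) * (- x) ^+ k.+1.
  rewrite [in RHS]big_nat_recr //= gaussbin_big // !mul0r addr0 IH big_nat_recl //.
  by rewrite gaussbin0 !expr0 !mulr1.
rewrite qpartS mulrBr mulr1 {1}H IH [in RHS]big_nat_recl // gaussbin0 !expr0 !mulr1.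
rewrite -addrA; congr (_ + _).
rewrite mulr_suml -sumrB; apply: eq_big_nat => k /andP[_ kn].
rewrite gaussbin_pascal // binS bin1 exprD exprS.
have -> : p ^+ n = p ^+ (n - k) * p ^+ k by rewrite -exprD subnK.
by ring.
Qed.

(* 1 - x/p^i = -(x/p^i)(1 - p^i/x). *)
Lemma qpart_flip N x : x != 0 ->
  qpart p N (x / p ^+ N) = (- x / s) ^+ N / s ^+ (N * N) * qpart p N (p / x).
Proof.
move=> x0; elim: N => [|N IH]; first by rewrite /qpart !big_geq // !expr0 !mulr1 divr1.
have -> : qpart p N.+1 (x / p ^+ N.+1) = (1 - x / p ^+ N.+1) * qpart p N (x / p ^+ N).
  rewrite -add1n qpartD {1}/qpart big_nat1 expr0 mul1r expr1; congr (_ * qpart _ _ _).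
  by rewrite exprS; have := expf_neq0 N p0; move: (p ^+ N) => u u0; field; rewrite p0 u0.
rewrite IH qpartS exprS.
have -> : (N.+1 * N.+1 = N * N + (2 * N).+1)%N by lia.
rewrite exprD (exprS s (2 * N)) (exprM s 2 N) sE exprS.
have := expf_neq0 N p0; have := expf_neq0 (N * N) s0.
move: (p ^+ N) (s ^+ (N * N)) ((- x / s) ^+ N) (qpart _ _ _) => u v w a v0 u0.
rewrite -sE; field; by rewrite ?s0 ?u0 ?v0 ?x0.
Qed.

Definition tripart (N : nat) (x : K) : K := qpart p N x * qpart p N (p / x).

(** The q-binomial theorem for (x / p^N; p)_{2N}: its last N factors are (x; p)_N, and its first N
    become (p/x; p)_N by [qpart_flip]. The root s of p absorbs the half in k(k-1)/2 and lets the
    exponent be the square (k - N)^2. *)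
Lemma finite_triple_product N x : x != 0 -> tripart N x =
  \sum_(k < (N + N).+1) gaussbin (N + N) k * (s ^ ((k%:Z - N%:Z) * (k%:Z - N%:Z))
     * (- x / s) ^ (k%:Z - N%:Z)).
Proof.
move=> x0; set w := - x / s.
have w0 : w != 0 by rewrite /w mulf_neq0 ?invr_eq0 ?oppr_eq0.
have pN := expf_neq0 N p0.
have c0 : w ^+ N / s ^+ (N * N) != 0 by rewrite mulf_neq0 ?invr_eq0 ?expf_neq0.
apply: (mulfI c0).
have -> : w ^+ N / s ^+ (N * N) * tripart N x = qpart p (N + N) (x / p ^+ N).
  by rewrite qpartD qpart_flip // [p ^+ N * _]mulrC divfK // /tripart; ring.
rewrite qbinomial big_mkord mulr_sumr; apply: eq_bigr => k _.
rewrite mulrCA -mulrA; congr (_ * _).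
have binE : (2 * 'C(k, 2) + k = k * k)%N.
  by elim: (nat_of_ord k) => [|i IH] //; rewrite binS bin1; lia.
have -> : p ^+ 'C(k, 2) = s ^ (k%:Z * k%:Z - k%:Z).
  rewrite -sE -exprM exprnP; congr (_ ^ _).
  by apply: (addIr k%:Z); rewrite subrK -PoszD binE.
have -> : - (x / p ^+ N) = w * s ^ (1 - N%:Z *+ 2).
  rewrite /w -sE -exprM expfzDr // expr1z -invr_expz exprnP.
  rewrite (_ : (2 * N)%:Z = N%:Z *+ 2); last by rewrite mul2n -addnn PoszD.
  by have := expfz_neq0 (N%:Z *+ 2) s0; move: (s ^ _) => u u0; field; rewrite u0 s0.
rewrite !exprnP expfzMl exprz_exp mulrCA -expfzDr //.
have -> : w ^ k = w ^ N * w ^ (k%:Z - N%:Z) by rewrite -expfzDr // subrKC.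
rewrite (_ : k%:Z * k%:Z - k%:Z + (1 - N%:Z *+ 2) * k%:Z =
  - (N * N)%N%:Z + (k%:Z - N%:Z) * (k%:Z - N%:Z)); last by rewrite PoszM; ring.
rewrite (expfzDr (- (N * N)%N%:Z) _ s0) -invr_expz.
rewrite [LHS]mulrACA -!mulrA; congr (_ * (_ * _)); exact: mulrC.
Qed.

End FiniteTripleProduct.

(** * Calculus of limits with a geometric rate *)

Section GeometricLimit.
Variables (R : realType) (K : fieldType) (nm : K -> R).
Hypothesis av : absolute_value nm.
Variable r : R.
Hypothesis r01 : 0 <= r < 1.

(** With r fixed, this notion is stable under the ring operations and has unique limits, so no
    topology on K is involved. *)
Definition geolim (u : nat -> K) (l : K) : Prop := exists M, forall N, nm (u N - l) <= M * r ^+ N.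

Let rN N : 0 <= r ^+ N. Proof. by case/andP: r01 => ? _; apply: exprn_ge0. Qed.
Let rN1 N : r ^+ N <= 1. Proof. by case/andP: r01 => ? /ltW ?; apply: exprn_ile1. Qed.

Lemma geolim_cst l : geolim (fun=> l) l.
Proof. by exists 0 => N; rewrite subrr (av0 av) mul0r. Qed.

Lemma geolim_bounded u l : geolim u l -> exists2 B, 0 <= B & forall N, nm (u N) <= B.
Proof.
case=> M H; have M0 : 0 <= M.
  by have := H 0%N; rewrite expr0 mulr1; apply: le_trans; apply: (av_ge0 av).
exists (M + nm l) => [|N]; first by rewrite addr_ge0 ?(av_ge0 av).
have h := avD av (u N - l) l; rewrite subrK in h.
apply: (le_trans h); rewrite lerD2r; apply: (le_trans (H N)).
by rewrite ler_piMr.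
Qed.

Lemma geolimD u v a b : geolim u a -> geolim v b -> geolim (fun N => u N + v N) (a + b).
Proof.
move=> [M HM] [P HP]; exists (M + P) => N.
rewrite (_ : _ - _ = (u N - a) + (v N - b)); last by ring.
by rewrite mulrDl; apply: le_trans (avD av _ _) _; apply: lerD.
Qed.

Lemma geolimM u v a b : geolim u a -> geolim v b -> geolim (fun N => u N * v N) (a * b).
Proof.
move=> [M HM] Hv; have [P P0 HP] := geolim_bounded Hv; case: Hv => Q HQ.
exists (M * P + nm a * Q) => N.
rewrite (_ : _ - _ = (u N - a) * v N + a * (v N - b)); last by ring.
apply: le_trans (avD av _ _) _; rewrite !(avM av) mulrDl; apply: lerD.
  by rewrite mulrAC; apply: ler_pM; rewrite ?(av_ge0 av).
by rewrite -mulrA ler_wpM2l ?(av_ge0 av).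
Qed.

Lemma geolimN u a : geolim u a -> geolim (fun N => - u N) (- a).
Proof. by move=> [M HM]; exists M => N; rewrite -opprD (avN av). Qed.

Lemma geolimB u v a b : geolim u a -> geolim v b -> geolim (fun N => u N - v N) (a - b).
Proof. by move=> Hu /geolimN; apply: geolimD. Qed.

Lemma geolim_near u v a : geolim u a -> geolim (fun N => u N - v N) 0 -> geolim v a.
Proof.
move=> Hu Hd; have [M HM] := geolimD Hu (geolimN Hd); exists M => N.
by have := HM N; rewrite oppr0 addr0 opprB subrKC.
Qed.

Lemma geolim_zero u a : geolim u a -> (forall N, u N = 0) -> a = 0.
Proof.
move=> [M H] u0; apply/esym; apply: (@av_unique _ _ _ av _ _ M r r01) => N.
by have := H N; rewrite u0.
Qed.

End GeometricLimit.

(** * Theta as a limit, and the expansion of theta(xy) theta(x/y) *)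

Section ThetaFunction.
Variables (R : realType) (K : fieldType) (nm : K -> R).
Hypothesis av : absolute_value nm.
Hypothesis complete : geometrically_complete nm.
Variable p : K.
Hypothesis p1 : nm p < 1.

Local Notation r := (nm p).
Local Notation qinf := (qinf av complete p1).

Lemma av_range : 0 <= r < 1. Proof. by rewrite (av_ge0 av). Qed.

Definition thetaq (x : K) : K := qinf x * qinf (p / x).

Lemma thetaq1 : thetaq 1 = 0.
Proof. by rewrite /thetaq qinf1 mul0r. Qed.

Lemma qinf_left x : qinf x = (1 - x) * qinf (p * x).
Proof. by rewrite (qinf_split av complete p1 1) /qpart big_nat1 expr0 mul1r expr1. Qed.

(** In theta(x) = (1 - x) (px; p)_oo (p/x; p)_oo, inversion of x exchanges the last two factors. *)
Lemma thetaqV x : x != 0 -> thetaq x^-1 = - thetaq x / x.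
Proof.
move=> x0; rewrite /thetaq invrK (qinf_left x^-1) (qinf_left x).
by rewrite -/(p / x); move: (qinf _) (qinf _) => u v; field.
Qed.

Lemma tripart_geolim x : geolim nm r (fun N => tripart p N x) (thetaq x).
Proof.
have H y : geolim nm r (fun N => qpart p N y) (qinf y).
  by exists (qbound nm p (nm y) * nm y / (1 - r) *+ 2) => N; apply: qinf_rate.
exact: (geolimM av av_range (H x) (H (p / x))).
Qed.

Lemma thetaq_zero x : thetaq x = 0 ->
  (exists n, p ^+ n * x = 1) \/ (exists n, p ^+ n.+1 / x = 1).
Proof.
move=> /eqP; rewrite mulf_eq0 => /orP[] /eqP /qinf_zero [n En].
  by left; exists n.
by right; exists n; rewrite exprSr -mulrA.
Qed.

Section RankTwo.
Hypothesis p0 : p != 0.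
Variable t : K.
Hypothesis tE : t ^+ 4 = p.

Let s := t ^+ 2.
Let sE : s ^+ 2 = p. Proof. by rewrite /s -exprM. Qed.
Let t0 : t != 0. Proof. by apply: contraNneq p0 => t0; rewrite -tE t0 expr0n. Qed.
Let s0 : s != 0. Proof. exact: expf_neq0. Qed.

Lemma one_sub_expr_neq0 n : 1 - p ^+ n.+1 != 0.
Proof.
rewrite subr_eq0; apply/eqP => E; have : nm (p ^+ n.+1) < 1.
  by rewrite (avX av) exprn_ilt1 ?(av_ge0 av).
by rewrite -E (av1 av) ltxx.
Qed.

(* theta(xy) theta(x/y) expands in products of a [gterm] in k + l by one in k - l. *)
Definition gterm (a : K) (v : int) : K := t ^ (v * v) * a ^ v.

Local Notation gb := (gaussbin p).

(** With s = t^2, the exponent u^2 + v^2 of s is the exponent (u + v)^2 + (u - v)^2 of t; hence the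
    fourth root of p. *)
Lemma tripart_pair_expand N x y : x != 0 -> y != 0 ->
  tripart p N (x * y) * tripart p N (x / y) =
  \sum_(k < (N + N).+1) \sum_(l < (N + N).+1) gb (N + N) k * gb (N + N) l *
    (gterm (- x / s) (k%:Z + l%:Z - (N + N)%N%:Z) * gterm y (k%:Z - l%:Z)).
Proof.
move=> x0 y0.
rewrite !(finite_triple_product p0 one_sub_expr_neq0 sE) ?mulf_neq0 ?invr_eq0 //.
rewrite big_distrlr /=; apply: eq_bigr => k _; apply: eq_bigr => l _.
rewrite mulrACA; congr (_ * _).
rewrite (_ : - (x * y) / s = - x / s * y); last by field.
rewrite (_ : - (x / y) / s = - x / s / y); last by field; rewrite s0 y0.
have a0 : - x / s != 0 by rewrite mulf_neq0 ?invr_eq0 ?oppr_eq0.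
move: (- x / s) a0 => a a0; rewrite /gterm.
set u := k%:Z - N%:Z; set v := l%:Z - N%:Z.
have -> : k%:Z + l%:Z - (N + N)%N%:Z = u + v by rewrite /u /v PoszD; ring.
have -> : k%:Z - l%:Z = u - v by rewrite /u /v; ring.
rewrite /s !exprnP !exprz_exp !expfzMl exprz_inv.
rewrite (expfzDr u v a0) (expfzDr u (- v) y0).
have E : t ^ (2%:Z * (u * u)) * t ^ (2%:Z * (v * v)) = t ^ ((u + v) * (u + v)) * t ^ ((u - v) * (u - v)).
  by rewrite -!expfzDr //; congr (_ ^ _); ring.
move: E; move: (t ^ (2%:Z * (u * u))) (t ^ (2%:Z * (v * v))) (t ^ ((u + v) * (u + v)))
  (t ^ ((u - v) * (u - v))) (a ^ u) (a ^ v) (y ^ u) (y ^ (- v)) => e1 e2 e3 e4 f1 f2 f3 f4 E.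
transitivity (e1 * e2 * (f1 * f2 * f3 * f4)); first by ring.
by rewrite E; ring.
Qed.

End RankTwo.
End ThetaFunction.

(** * Double sums along diagonals, and decay estimates *)

Section DiagonalReindexing.
Variables (K : fieldType) (N : nat) (g : nat -> K).
Hypothesis g_out : forall j, (N + N < j)%N -> g j = 0.

(** For u = k + l and v = k - l + 2N, the half-sums in [sum_diagonal] are k + N and l + N; hence the
    offset N. Extension by zero lets (u, v) range over a full square. *)
Definition centered (j : nat) : K := if (N <= j)%N then g (j - N) else 0.

Local Notation M := (N + N + (N + N))%N.

(* Change of variables (u, v) = (k + l, k - l), shifted to be nonnegative; the parity
   condition on (u, v) is what makes the limit of rank two rather than one. *)
Lemma sum_diagonal (Phi : nat -> nat -> K) :
  \sum_(k < (N + N).+1) \sum_(l < (N + N).+1) g k * g l * Phi (k + l)%N (k + (N + N) - l)%N =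
  \sum_(u < M.+1) \sum_(v < M.+1 | odd u == odd v)
    centered ((u + v)./2) * centered ((u + M - v)./2) * Phi u v.
Proof.
pose inr j := ((N <= j) && (j <= N + N + N))%N.
have cE j : centered j = if inr j then g (j - N) else 0.
  rewrite /centered /inr; case: (leqP N j) => //= Nj; case: leqP => // h.
  by rewrite g_out //; lia.
rewrite pair_big_dep [RHS]pair_big_dep /=.
pose I := ('I_(N + N).+1 * 'I_(N + N).+1)%type; pose J := ('I_M.+1 * 'I_M.+1)%type.
pose P (q : J) := (odd q.1 == odd q.2) && (inr ((q.1 + q.2)./2) && inr ((q.1 + M - q.2)./2)).
rewrite [RHS](bigID (fun q : J => inr ((q.1 + q.2)./2) && inr ((q.1 + M - q.2)./2))) /=.
rewrite [X in _ = _ + X]big1 ?addr0; last first.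
  move=> [u v] /= /andP[_]; rewrite negb_and !cE.
  by case: ifP => //=; case: ifP => //=; rewrite ?mulr0 ?mul0r // mul0r.
pose h (i : I) : J := (inord (i.1 + i.2), inord (i.1 + (N + N) - i.2)).
pose h' (q : J) : I := (inord ((q.1 + q.2)./2 - N), inord ((q.1 + M - q.2)./2 - N)).
have hE1 (i : I) : nat_of_ord (h i).1 = (i.1 + i.2)%N.
  by rewrite inordK //; have := ltn_ord i.1; have := ltn_ord i.2; lia.
have hE2 (i : I) : nat_of_ord (h i).2 = (i.1 + (N + N) - i.2)%N.
  by rewrite inordK //; have := ltn_ord i.1; have := ltn_ord i.2; lia.
have half1 (i : I) : ((h i).1 + (h i).2)./2 = (i.1 + N)%N.
  by rewrite hE1 hE2; have := ltn_ord i.1; have := ltn_ord i.2; lia.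
have half2 (i : I) : ((h i).1 + M - (h i).2)./2 = (i.2 + N)%N.
  by rewrite hE1 hE2; have := ltn_ord i.1; have := ltn_ord i.2; lia.
have hodd (i : I) : odd (h i).1 == odd (h i).2.
  by rewrite hE1 hE2; have := ltn_ord i.1; have := ltn_ord i.2; lia.
rewrite [RHS](reindex_onto h h') /=; last first.
  move=> [u v] /= /andP[/eqP uv /andP[/andP[a1 a2] /andP[b1 b2]]].
  have := ltn_ord u; have := ltn_ord v => hv hu.
  congr (_, _); apply: val_inj; rewrite /= inordK /= ?inordK /= ?inordK //; lia.
apply: eq_big => [i|i _].
  apply/esym; rewrite hodd half1 half2 /inr.
  have := ltn_ord i.1; have := ltn_ord i.2 => h2 h1.
  rewrite (_ : h' (h i) = i) ?eqxx ?andbT.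
    by rewrite !leq_addl /= !leq_add2r (ltnSE h1) (ltnSE h2).
  by rewrite /h' half1 half2 !addnK !inord_val; case: i {h1 h2}.
rewrite half1 half2 !cE /inr !addnK hE1 hE2.
have := ltn_ord i.1; have := ltn_ord i.2 => h2 h1.
by rewrite !leq_addl /= !leq_add2r (ltnSE h1) (ltnSE h2).
Qed.

End DiagonalReindexing.

(** In truncated subtraction, (u - M) + (M - u) is the distance |u - M|. *)
Lemma sum_half_dist (R : realType) (M : nat) :
  \sum_(0 <= u < (M + M).+1) (2^-1 : R) ^+ ((u - M) + (M - u)) <= 3 - 2 * 2^-1 ^+ M.
Proof.
elim: M => [|M IH]; first by rewrite big_nat1 addn0 subn0 expr0; lra.
rewrite addSn addnS big_nat_recl // big_nat_recr //=.
rewrite (eq_bigr (fun u => (2^-1 : R) ^+ ((u - M) + (M - u)))); last first.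
  by move=> i _; rewrite !subSS.
have -> : (0 - M.+1 + (M.+1 - 0) = M.+1)%N by lia.
have -> : ((M + M).+2 - M.+1 + (M.+1 - (M + M).+2) = M.+1)%N by lia.
move: IH; rewrite !exprS; move: (\sum_(0 <= u < _) _) (2^-1 ^+ M) => a b; lra.
Qed.

(** The left side is the n-th power of tau^n Y, which is at most 1/2 from some n0 on; the constant
    covers the n <= n0. *)
Lemma gaussian_decay (R : realType) (tau Y : R) : 0 <= tau < 1 -> 0 <= Y ->
  exists2 C, 0 <= C & forall n, tau ^+ (n * n) * Y ^+ n <= C * 2^-1 ^+ n.
Proof.
move=> tau01 Y0; have /andP[tau0 tau1] := tau01.
have [n0 hn0] : exists n, (2 * Y) * tau ^+ n <= 1.
  apply: contrapT => /forallNP H.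
  suff : (1 : R) <= 0 by lra.
  apply: (@le_of_geometric _ _ _ (2 * Y) tau) => // n.
  by have /negP := H n; rewrite -ltNge add0r => /ltW.
have Y1 : 1 <= 1 + 2 * Y by lra.
exists ((1 + 2 * Y) ^+ n0) => [|n]; first by rewrite exprn_ge0 //; lra.
rewrite -ler_pdivrMr ?exprn_gt0 ?invr_gt0 // exprVn invrK exprM -!exprMn.
have -> : tau ^+ n * Y * 2 = 2 * Y * tau ^+ n by ring.
have h0 : 0 <= 2 * Y * tau ^+ n by rewrite !mulr_ge0 ?exprn_ge0.
have [nn0|n0n] := leqP n n0.
  apply: (@le_trans _ _ ((1 + 2 * Y) ^+ n)); last by rewrite ler_weXn2l.
  rewrite lerXn2r ?nnegrE //; first by lra.
  have : tau ^+ n <= 1 by apply: exprn_ile1 => //; lra.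
  have := exprn_ge0 n tau0; nra.
apply: (@le_trans _ _ 1); last by rewrite exprn_ege1.
rewrite exprn_ile1 //; apply: le_trans hn0; rewrite ler_wpM2l ?mulr_ge0 //.
by apply: ler_wiXn2l => //; [exact: ltW | exact: ltnW].
Qed.

(** * Gaussian binomials near the centre *)

Section ApproximateRankTwo.
Variables (R : realType) (K : fieldType) (nm : K -> R).
Hypothesis av : absolute_value nm.
Hypothesis complete : geometrically_complete nm.
Variable p : K.
Hypothesis p1 : nm p < 1.

Local Notation r := (nm p).
Local Notation qinf := (qinf av complete p1).
Local Notation gb := (gaussbin p).
Local Notation pf n := (qpart p n p).

Let r01 := av_range av p1.
Let U := qbound nm p 1.
Let U1 : 1 <= U. Proof. exact: qbound_ge1. Qed.
Let U_gt0 : 0 < U. Proof. exact: lt_le_trans ltr01 U1. Qed.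
Let U_ge0 : 0 <= U. Proof. exact: ltW. Qed.

(** From (p; p)_oo = (p; p)_n (p^(n+1); p)_oo, whose left side is nonzero and whose last factor is
    at most U in absolute value. *)
Lemma qfact_lower : exists2 L, 0 < L & forall n, L <= nm (pf n).
Proof.
have U0 := U_gt0.
exists (nm (qinf p) / U) => [|n].
  rewrite divr_gt0 //; apply: (av_neq0 av); apply/eqP => /qinf_zero[n].
  by rewrite -exprSr => E; have := one_sub_expr_neq0 av p1 n; rewrite E subrr eqxx.
rewrite ler_pdivrMr // (qinf_split av complete p1 n) (avM av).
rewrite ler_wpM2l ?(av_ge0 av) // qinf_le // (avM av) (avX av).
by rewrite -exprSr exprn_ile1 ?(av_ge0 av) // ltW.
Qed.

Lemma qfact_upper n : nm (pf n) <= U.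
Proof. by apply: (qpart_le av p1); apply: ltW. Qed.

Lemma qfact_diff : exists2 C, 0 <= C & forall m a b, (m <= a)%N -> (m <= b)%N ->
  nm (pf a - pf b) <= C * r ^+ m.
Proof.
have d0 : 0 < 1 - r by rewrite subr_gt0.
pose C := U * (U ^+ 2 / (1 - r)).
have C0 : 0 <= C.
  by rewrite mulr_ge0 ?divr_ge0 ?exprn_ge0 // ltW.
exists C => //.
have H a b : (a <= b)%N -> nm (pf b - pf a) <= C * r ^+ a.
  move=> ab; rewrite -(subnKC ab) qpartD -{2}[pf a]mulr1 -mulrBr (avM av) /C -mulrA.
  apply: ler_pM; rewrite ?(av_ge0 av) ?qfact_upper //.
  have E0 : qpart p (b - a) 0 = 1 by rewrite /qpart big1 // => j _; rewrite mulr0 subr0.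
  have y1 : nm (p ^+ a * p) <= 1.
    by rewrite (avM av) (avX av) -exprSr exprn_ile1 ?(av_ge0 av) // ltW.
  have z1 : nm 0 <= 1 by rewrite (av0 av).
  rewrite -{1}E0; apply: le_trans (qpart_lip av p1 (b - a) y1 z1) _.
  rewrite subr0 (avM av) (avX av) ler_wpM2l ?divr_ge0 ?exprn_ge0 //; first exact: ltW.
  by rewrite ler_piMr ?exprn_ge0 ?(av_ge0 av) // ltW.
have mono m a : (m <= a)%N -> r ^+ a <= r ^+ m.
  by move=> ma; apply: ler_wiXn2l => //; [exact: (av_ge0 av) | exact: ltW].
move=> m a b ma mb; have [ab|/ltnW ba] := leqP a b.
  by rewrite (av_sub av); apply: le_trans (H _ _ ab) _; rewrite ler_wpM2l ?mono.
by apply: le_trans (H _ _ ba) _; rewrite ler_wpM2l ?mono.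
Qed.

Lemma gaussbin_bounded : exists2 G, 0 <= G & forall n k, nm (gb n k) <= G.
Proof.
have [L L0 HL] := qfact_lower; have U0 := U_ge0.
exists (U / (L * L)) => [|n k]; first by rewrite divr_ge0 ?mulr_ge0 // ltW.
rewrite /gaussbin; case: ifP => _; last by rewrite (av0 av) divr_ge0 ?mulr_ge0 // ltW.
have nV x : x != 0 -> nm x^-1 = (nm x)^-1.
  move=> x0; have := avM av x x^-1; rewrite mulfV // (av1 av) => E.
  by apply: (mulfI (lt0r_neq0 (av_neq0 av x0))); rewrite -E mulfV // lt0r_neq0 ?(av_neq0 av).
have q0 := qfact_neq0 (one_sub_expr_neq0 av p1).
rewrite (avM av) nV ?mulf_neq0 // (avM av) ler_pM ?qfact_upper ?(av_ge0 av) //.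
  by rewrite invr_ge0 mulr_ge0 ?(av_ge0 av).
by rewrite lef_pV2 ?posrE ?mulr_gt0 ?(av_neq0 av) // ler_pM // ltW.
Qed.

(** The two coefficients share their numerator, and their denominators are built from (p; p)_j with
    j >= m, which differ by O(r^m). Here m bounds from below the distance of k from the ends 0 and
    2N. *)
Lemma gaussbin_central : exists2 C, 0 <= C & forall N k m,
  (m <= k)%N -> (m + k <= N + N)%N -> nm (gb (N + N) k - gb (N + N) N) <= C * r ^+ m.
Proof.
have [L L0 HL] := qfact_lower; have U0 := U_ge0.
have [C C0 HC] := qfact_diff; have [G G0 HG] := gaussbin_bounded.
have q0 := qfact_neq0 (one_sub_expr_neq0 av p1).
have L2 : 0 < L * L by rewrite mulr_gt0.
exists (G * (2 * U * C) / (L * L)) => [|N k m mk mk2].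
  by rewrite divr_ge0 ?mulr_ge0 // ltW.
have kN : (k <= N + N)%N := leq_trans (leq_addl m k) mk2.
have E : (gb (N + N) k - gb (N + N) N) * (pf k * pf (N + N - k)) =
    gb (N + N) N * (pf N * (pf N - pf k) + pf k * (pf N - pf (N + N - k))).
  rewrite /gaussbin kN leq_addr addnK.
  have := q0 k; have := q0 (N + N - k)%N; have := q0 N.
  move: (pf k) (pf (N + N - k)) (pf N) (pf (N + N)) => a b c e c0 b0 a0.
  by field; rewrite a0 b0 c0.
rewrite -(ler_pM2r L2) mulrAC divfK ?gt_eqF // -(mulrA G).
apply: (@le_trans _ _ (nm (gb (N + N) k - gb (N + N) N) * nm (pf k * pf (N + N - k)))).
  by rewrite ler_wpM2l ?(av_ge0 av) // (avM av) ler_pM // ltW.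
rewrite -(avM av) E (avM av) ler_pM ?(av_ge0 av) //.
apply: le_trans (avD av _ _) _; rewrite !(avM av).
have h1 : nm (pf N - pf k) <= C * r ^+ m by apply: HC => //; clear -mk mk2; lia.
have h2 : nm (pf N - pf (N + N - k)) <= C * r ^+ m by apply: HC; clear -mk mk2; lia.
have -> : 2 * U * C * r ^+ m = U * (C * r ^+ m) + U * (C * r ^+ m) by ring.
by apply: lerD; apply: ler_pM; rewrite ?(av_ge0 av) ?qfact_upper.
Qed.

Local Notation cent N := (centered N (gb (N + N))).

Lemma centered_bounded : exists2 G, 0 <= G & forall N j, nm (cent N j) <= G.
Proof.
have [G G0 HG] := gaussbin_bounded; exists G => // N j.
by rewrite /centered; case: ifP => _; rewrite ?(av0 av).
Qed.

(** The approximation gets worse off the centre, and the weight r^d pays for it: for d < N the error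
    r^(N-d) times r^d is r^N, and for d >= N the weight alone is at most r^N. *)
Lemma centered_central : exists2 D, 0 <= D & forall N j d,
  (N + N <= j + d)%N -> (j <= N + N + d)%N ->
  nm (cent N j - gb (N + N) N) * r ^+ d <= D * r ^+ N.
Proof.
have [G G0 HG] := centered_bounded; have [G' G'0 HG'] := gaussbin_bounded.
have [C C0 HC] := gaussbin_central.
have rge0 := av_ge0 av p.
exists (C + G + G') => [|N j d h1 h2]; first by rewrite !addr_ge0.
have [Nd|dN] := leqP N d.
  apply: ler_pM; rewrite ?(av_ge0 av) ?exprn_ge0 //.
    apply: le_trans (avD av _ _) _; rewrite (avN av).
    have := HG N j; have := HG' (N + N)%N N; lra.
  by apply: ler_wiXn2l => //; exact: ltW.
have Nj : (N <= j)%N by clear -dN h1; lia.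
rewrite {1}/centered Nj.
have h : nm (gb (N + N) (j - N) - gb (N + N) N) <= C * r ^+ (N - d) by apply: HC; clear -dN h1 h2; lia.
apply: (@le_trans _ _ (C * r ^+ (N - d) * r ^+ d)); first by rewrite ler_wpM2r ?exprn_ge0.
rewrite -mulrA -exprD subnK ?(ltnW dN) // ler_wpM2r ?exprn_ge0 //; lra.
Qed.

Lemma centered_product : exists2 D, 0 <= D & forall N j k d,
  (N + N <= j + d)%N -> (j <= N + N + d)%N -> (N + N <= k + d)%N -> (k <= N + N + d)%N ->
  nm (cent N j * cent N k - gb (N + N) N * gb (N + N) N) * r ^+ d <= D * r ^+ N.
Proof.
have [G G0 HG] := centered_bounded; have [G' G'0 HG'] := gaussbin_bounded.
have [D D0 HD] := centered_central; have rge0 := av_ge0 av p.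
exists (D * G + G' * D) => [|N j k d h1 h2 h3 h4]; first by rewrite addr_ge0 ?mulr_ge0.
have -> : cent N j * cent N k - gb (N + N) N * gb (N + N) N =
   (cent N j - gb (N + N) N) * cent N k + gb (N + N) N * (cent N k - gb (N + N) N) by ring.
have a1 := HD N j d h1 h2; have a2 := HD N k d h3 h4.
have a3 := HG N k; have a4 := HG' (N + N)%N N.
have rd : 0 <= r ^+ d by rewrite exprn_ge0.
apply: (le_trans (ler_wpM2r rd (avD av _ _))); rewrite !(avM av) !mulrDl; apply: lerD.
  by rewrite mulrAC [leRHS]mulrAC; apply: ler_pM; rewrite ?mulr_ge0 ?(av_ge0 av).
by rewrite -!mulrA; apply: ler_pM; rewrite ?mulr_ge0 ?(av_ge0 av).
Qed.

End ApproximateRankTwo.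

(** * Weierstrass' three-term relation *)

Section Weierstrass.
Variables (R : realType) (K : fieldType) (nm : K -> R).
Hypothesis av : absolute_value nm.
Hypothesis complete : geometrically_complete nm.
Variable p : K.
Hypothesis p1 : nm p < 1.

Local Notation r := (nm p).
Local Notation thetaq := (thetaq av complete p1).
Local Notation gb := (gaussbin p).

Lemma av_sum (I : Type) (s : seq I) (P : pred I) (F : I -> K) :
  nm (\sum_(i <- s | P i) F i) <= \sum_(i <- s | P i) nm (F i).
Proof.
elim/big_ind2: _ => [|x a y b h1 h2|i _]; rewrite ?(av0 av) //.
by apply: le_trans (avD av _ _) _; apply: lerD.
Qed.

Section Nonzero.
Variable t : K.
Hypothesis p0 : p != 0.
Hypothesis tE : t ^+ 4 = p.

Local Notation s := (t ^+ 2).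
Let t0 : t != 0. Proof. by apply: contraNneq p0 => t0; rewrite -tE t0 expr0n. Qed.
Let r0 : 0 < r. Proof. exact: (av_neq0 av). Qed.

Let tau01 : 0 <= nm t < 1.
Proof.
rewrite (av_ge0 av) /= ltNge; apply/negP => h.
by have := exprn_ege1 4 h; rewrite -(avX av) tE leNgt p1.
Qed.

Local Notation dist N u := ((u - (N + N)) + (N + N - u))%N.

(** The Gaussian factor t^(v^2) beats a^v with two geometric factors to spare: 2^-dist makes the
    double sum bounded, and r^dist is the weight required by [centered_product]. *)
Lemma gterm_bound (a : K) : a != 0 -> exists2 C, 0 <= C & forall N u,
  nm (gterm t a (u%:Z - (N + N)%N%:Z)) <= C * 2^-1 ^+ dist N u * r ^+ dist N u.
Proof.
move=> a0; pose Z := nm a + nm a^-1.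
have Z0 : 0 <= Z by rewrite addr_ge0 ?(av_ge0 av).
have [C C0 HC] := gaussian_decay tau01 (divr_ge0 Z0 (ltW r0)).
exists C => // N u; set n := dist N u.
suff h : nm (gterm t a (u%:Z - (N + N)%N%:Z)) <= nm t ^+ (n * n) * Z ^+ n.
  apply: (le_trans h); have -> : Z = Z / r * r by rewrite divfK ?gt_eqF.
  by rewrite exprMn mulrA ler_wpM2r ?exprn_ge0 // ltW.
rewrite /gterm (avM av); have [Nu|uN] := leqP (N + N) u.
  have -> : u%:Z - (N + N)%N%:Z = n%:Z by rewrite /n; clear -Nu; lia.
  rewrite -PoszM -!exprnP !(avX av) ler_wpM2l ?exprn_ge0 ?(av_ge0 av) //.
  by rewrite lerXn2r ?nnegrE ?(av_ge0 av) // /Z lerDl (av_ge0 av).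
have -> : u%:Z - (N + N)%N%:Z = - n%:Z by rewrite /n; clear -uN; lia.
rewrite mulrNN -PoszM -exprz_inv -!exprnP !(avX av) ler_wpM2l ?exprn_ge0 ?(av_ge0 av) //.
by rewrite lerXn2r ?nnegrE ?(av_ge0 av) // /Z lerDr (av_ge0 av).
Qed.

(** A truncated theta series over the even or the odd exponents: N + N is even, so [odd u] is the
    parity of the exponent. *)
Definition half_sum (b : bool) (a : K) (N : nat) : K :=
  \sum_(u < (N + N + (N + N)).+1 | odd u == b) gterm t a (u%:Z - (N + N)%N%:Z).

Definition rank_two (x y : K) (N : nat) : K := gb (N + N) N * gb (N + N) N *
  (half_sum false (- x / s) N * half_sum false y N + half_sum true (- x / s) N * half_sum true y N).

Lemma rank_two_expand x y N : rank_two x y N =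
  \sum_(u < (N + N + (N + N)).+1) \sum_(v < (N + N + (N + N)).+1 | odd u == odd v)
   gb (N + N) N * gb (N + N) N *
    (gterm t (- x / s) (u%:Z - (N + N)%N%:Z) * gterm t y (v%:Z - (N + N)%N%:Z)).
Proof.
rewrite /rank_two /half_sum !big_distrlr /= mulrDr [RHS](bigID (fun u : 'I_ _ => odd u == false)) /=.
congr (_ + _); rewrite mulr_sumr; apply: eq_big => u.
- by [].
- by move=> /eqP ->; rewrite mulr_sumr; apply: eq_bigl => v; rewrite eq_sym.
- by case: odd.
- by move=> /eqP ->; rewrite mulr_sumr; apply: eq_bigl => v; rewrite eq_sym.
Qed.

Lemma half_dist N u v : (u < (N + N + (N + N)).+1)%N -> (v < (N + N + (N + N)).+1)%N ->
  odd u == odd v -> let d := (dist N u + dist N v)%N in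
  let j := ((u + v)./2)%N in let k := ((u + (N + N + (N + N)) - v)./2)%N in
  [/\ N + N <= j + d, j <= N + N + d, N + N <= k + d & k <= N + N + d]%N.
Proof. by clear; move=> /= *; split; lia. Qed.

(** Once every Gaussian binomial is replaced by the central one, the terms of the double sum factor
    in u and v, and only the common parity links the two indices. *)
Lemma tripart_rank_two x y : x != 0 -> y != 0 ->
  geolim nm r (fun N => tripart p N (x * y) * tripart p N (x / y) - rank_two x y N) 0.
Proof.
move=> x0 y0; have s0 : s != 0 by rewrite expf_neq0.
have a0 : - x / s != 0 by rewrite mulf_neq0 ?invr_eq0 ?oppr_eq0.
have [A A0 HA] := gterm_bound a0; have [B B0 HB] := gterm_bound y0.
have [D D0 HD] := centered_product av complete p1.
(* 9 is the square of 3, the bound of the sum of 2^-dist over u or over v. *)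
exists (D * A * B * 9) => N; rewrite subr0.
pose Phi u v := gterm t (- x / s) (u%:Z - (N + N)%N%:Z) * gterm t y (v%:Z - (N + N)%N%:Z).
have -> : tripart p N (x * y) * tripart p N (x / y) =
    \sum_(k < (N + N).+1) \sum_(l < (N + N).+1) gb (N + N) k * gb (N + N) l *
      Phi (k + l)%N (k + (N + N) - l)%N.
  rewrite (tripart_pair_expand av p1 p0 tE N x0 y0).
  apply: eq_bigr => k _; apply: eq_bigr => l _; congr (_ * (gterm _ _ _ * gterm _ _ _)).
  by have := ltn_ord l; clear; lia.
rewrite (sum_diagonal (@gaussbin_big _ p (N + N))) rank_two_expand -sumrB.
apply: le_trans (av_sum _ _ _) _.
pose w u := (2^-1 : R) ^+ dist N u.
have w0 u : 0 <= w u by rewrite exprn_ge0 // invr_ge0.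
apply: (@le_trans _ _ (\sum_(u < (N + N + (N + N)).+1) \sum_(v < (N + N + (N + N)).+1)
    D * A * B * r ^+ N * (w u * w v))).
  apply: ler_sum => u _; rewrite -sumrB; apply: le_trans (av_sum _ _ _) _.
  rewrite [leRHS](bigID (fun v : 'I_ _ => odd u == odd v)) /= ler_wpDr //.
    by apply: sumr_ge0 => v _; rewrite !mulr_ge0 ?exprn_ge0 ?(av_ge0 av).
  apply: ler_sum => v uv; rewrite -mulrBl (avM av) (avM av).
  have [h1 h2 h3 h4] := half_dist (ltn_ord u) (ltn_ord v) uv.
  have := HD N _ _ _ h1 h2 h3 h4; have := HA N u; have := HB N v.
  rewrite (exprD r (dist N u) (dist N v)).
  move: (nm (gterm _ _ _)) (av_ge0 av (gterm t y (v%:Z - (N + N)%N%:Z))).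
  move: (nm (gterm _ _ _)) (av_ge0 av (gterm t (- x / s) (u%:Z - (N + N)%N%:Z))).
  move: (nm (_ - _)) (av_ge0 av (centered N (gb (N + N)) ((u + v)./2) *
    centered N (gb (N + N)) ((u + (N + N + (N + N)) - v)./2) - gb (N + N) N * gb (N + N) N)).
  rewrite -/(w u) -/(w v); move: (w u) (w v) (w0 u) (w0 v) (r ^+ dist N u) (r ^+ dist N v) (r ^+ N).
  move=> wu wv wu0 wv0 ru rv rN c c0 g g0 h h0 Hh Hg Hc.
  apply: (@le_trans _ _ (c * (A * wu * ru * (B * wv * rv)))).
    by rewrite ler_wpM2l // ler_pM.
  have -> : c * (A * wu * ru * (B * wv * rv)) = c * (ru * rv) * (A * wu * (B * wv)) by ring.
  have -> : D * A * B * rN * (wu * wv) = D * rN * (A * wu * (B * wv)) by ring.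
  by rewrite ler_wpM2r ?mulr_ge0.
have -> : \sum_(u < (N + N + (N + N)).+1) \sum_(v < (N + N + (N + N)).+1)
    D * A * B * r ^+ N * (w u * w v) = D * A * B * r ^+ N *
  ((\sum_(u < (N + N + (N + N)).+1) w u) * (\sum_(u < (N + N + (N + N)).+1) w u)).
  rewrite big_distrlr mulr_sumr /=; apply: eq_bigr => u _; by rewrite mulr_sumr.
have W3 : \sum_(u < (N + N + (N + N)).+1) w u <= 3.
  have S := sum_half_dist R (N + N); rewrite big_mkord in S; apply: (le_trans S).
  have : 0 <= (2^-1 : R) ^+ (N + N) by rewrite exprn_ge0 // invr_ge0.
  by lra.
have W0 : 0 <= \sum_(u < (N + N + (N + N)).+1) w u by apply: sumr_ge0.
rewrite [leRHS]mulrAC; apply: ler_wpM2l; first by rewrite !mulr_ge0 ?exprn_ge0 ?(av_ge0 av).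
nra.
Qed.

Lemma thpair_rank_two x y : x != 0 -> y != 0 ->
  geolim nm r (rank_two x y) (thpair thetaq x y).
Proof.
move=> x0 y0; apply: (geolim_near av _ (tripart_rank_two x0 y0)).
by apply: (geolimM av (av_range av p1)); apply: tripart_geolim.
Qed.

(* Vanishing of the 3 x 3 minor on rows x, v, w and columns u, v, w of a limit of rank-two kernels. *)
Lemma thetaW_nonzero x u v w : x != 0 -> u != 0 -> v != 0 -> w != 0 ->
  let h := thpair thetaq in
  h x u * h w v * h v w = h x v * h w u * h v w + h x w * h v u * h w v.
Proof.
move=> x0 u0 v0 w0 h.
have hd y : y != 0 -> h y y = 0 by move=> y0; rewrite /h /thpair divff // thetaq1 mulr0.
have r01 := av_range av p1.
have L y z : y != 0 -> z != 0 -> geolim nm r (rank_two y z) (h y z) by exact: thpair_rank_two.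
have D := geolimD av (geolimB av
  (geolimM av r01 (L x u x0 u0)
     (geolimB av (geolimM av r01 (L v v v0 v0) (L w w w0 w0)) (geolimM av r01 (L v w v0 w0) (L w v w0 v0))))
  (geolimM av r01 (L x v x0 v0)
     (geolimB av (geolimM av r01 (L v u v0 u0) (L w w w0 w0)) (geolimM av r01 (L v w v0 w0) (L w u w0 u0)))))
  (geolimM av r01 (L x w x0 w0)
     (geolimB av (geolimM av r01 (L v u v0 u0) (L w v w0 v0)) (geolimM av r01 (L v v v0 v0) (L w u w0 u0)))).
(* The entries h v v and h w w vanish since theta(1) = 0, which leaves three products of the
   determinant. *)
have := geolim_zero av r01 D; rewrite !hd // => E.
have {}E := E (fun N => ltac:(rewrite /rank_two; ring)).
by apply/eqP; rewrite -subr_eq0; apply/eqP; rewrite -[RHS]oppr0 -[in RHS]E; ring.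
Qed.

End Nonzero.

Lemma thetaq_p0 x : p = 0 -> thetaq x = 1 - x.
Proof.
move=> p0; have q0 : qinf av complete p1 0 = 1.
  apply: (@qinf_unique _ _ _ av complete p p1 0 1 0) => n.
  rewrite /qpart big1 ?subrr ?(av0 av) ?mul0r // => j _.
  by rewrite mulr0 subr0.
have pz y : p * y = 0 by rewrite p0 mul0r.
by rewrite /thetaq (qinf_left av complete p1 x) !pz q0 !mulr1.
Qed.

Lemma thetaW x u v w : (forall y : K, exists z, z ^+ 2 = y) ->
  x != 0 -> u != 0 -> v != 0 -> w != 0 ->
  let h := thpair thetaq in
  h x u * h w v * h v w = h x v * h w u * h v w + h x w * h v u * h w v.
Proof.
move=> sqrtK x0 u0 v0 w0; have [s sE] := sqrtK p; have [t tE] := sqrtK s.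
(* The triple product divides by roots of p. At p = 0 one has theta(x) = 1 - x, and the relation is
   a rational identity. *)
have [p0|p0] := eqVneq p 0; last first.
  by apply: (@thetaW_nonzero t p0) => //; rewrite (exprM t 2 2) tE.
rewrite /= /thpair !thetaq_p0 //; field.
by rewrite u0 v0 w0.
Qed.

End Weierstrass.

(** * The complex numbers as an instance, and the limit that defines [theta] *)

Section ComplexTheta.
Variable R : realType.
Local Notation C := R[i].

Definition cabs (z : C) : R := complex.Re `|z|.

Lemma cabsE (z : C) : `|z| = (cabs z)%:C%C.
Proof. by rewrite /cabs normc_def. Qed.

Lemma cabs_absolute_value : absolute_value cabs.
Proof.
have inj : injective (fun x : R => x%:C%C) by apply: complexI.
split=> [x||x x0||x y|x y|x].
- by rewrite -lecR -cabsE rmorph0 normr_ge0.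
- by rewrite /cabs normr0.
- by apply/eqP; rewrite -normr_eq0 cabsE x0.
- by rewrite /cabs normr1.
- by apply: inj; rewrite rmorphM -!cabsE normrM.
- by rewrite -lecR rmorphD /= -!cabsE ler_normD.
- by rewrite /cabs normrN.
Qed.

Lemma Re_le_cabs (z : C) : `|complex.Re z| <= cabs z.
Proof. by rewrite -lecR -cabsE normc_ge_Re. Qed.

Lemma Im_le_cabs (z : C) : `|complex.Im z| <= cabs z.
Proof.
have := Re_le_cabs (z * 'i%C); rewrite ReiNIm normrN (avM cabs_absolute_value).
suff -> : cabs 'i%C = 1 by rewrite mulr1.
by rewrite /cabs normc_def /= expr0n expr1n add0r sqrtr1.
Qed.

Lemma cabs_le_Re_Im (z : C) : cabs z <= `|complex.Re z| + `|complex.Im z|.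
Proof.
rewrite -lecR rmorphD /= -cabsE.
have E := complexE z; rewrite {1}E; apply: le_trans (ler_normD _ _) _.
rewrite normrM.
have -> : `|'i%C : C| = 1 by rewrite normc_def /= expr0n expr1n add0r sqrtr1.
by rewrite mul1r !normc_def /= !expr0n /= !addr0 !sqrtr_sqr.
Qed.

Lemma cabs_complete : geometrically_complete cabs.
Proof.
move=> u A r r01 H.
have [|x Hx] := @real_geometric_limit R (fun n => complex.Re (u n)) A r r01.
  by move=> n; apply: le_trans (H n); rewrite -raddfB; apply: Re_le_cabs.
have [|y Hy] := @real_geometric_limit R (fun n => complex.Im (u n)) A r r01.
  by move=> n; apply: le_trans (H n); rewrite -raddfB; apply: Im_le_cabs.
exists (x +i* y)%C => n; apply: le_trans (cabs_le_Re_Im _) _.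
by rewrite !raddfB /= mulr2n; apply: lerD.
Qed.

Lemma csqrt_exists (x : C) : exists y, y ^+ 2 = x.
Proof. by exists (sqrtc x); rewrite sqr_sqrtc. Qed.

(** The epsilon of the topology on R[i] is itself complex; being positive, it equals its real
    part. *)
Lemma cvg_of_cabs (u : nat -> C) (l : C) :
  (forall e : R, 0 < e -> (\forall n \near \oo, cabs (u n - l) < e)%classic) ->
  ((u : nat -> (C : numFieldType)) @ \oo --> (l : (C : numFieldType)))%classic.
Proof.
move=> H; apply/cvgrPdist_lt => e e0.
have e0' : 0 < complex.Re e by move: e0; rewrite ltcE /= => /andP[].
have eE : e = (complex.Re e)%:C%C.
  by move: e0; rewrite ltcE /= => /andP[/eqP Ie _]; rewrite {1}(complexE e) Ie mulr0 addr0.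
have := H _ e0'; apply: filterS => n h.
by rewrite distrC cabsE eE ltcR.
Qed.

Section Theta.
Variable p : C.
Hypothesis p1 : `|p| < 1.

Lemma cabs_lt1 : cabs p < 1.
Proof. by move: p1; rewrite cabsE -[1 in X in X -> _]/(1%:C%C) ltcR. Qed.

Definition ctheta : C -> C := thetaq cabs_absolute_value cabs_complete cabs_lt1.

Lemma geolim_cvg (r : R) u (l : C) : 0 <= r < 1 -> geolim cabs r u l ->
  ((u : nat -> (C : numFieldType)) @ \oo --> (l : (C : numFieldType)))%classic.
Proof.
move=> /andP[r0 r1] [M HM]; apply: cvg_of_cabs => e e0.
have := @cvg_geometric R M r; rewrite ger0_norm // => /(_ r1).
move=> /cvgrPdist_lt /(_ e e0); apply: filterS => n /=.
rewrite sub0r normrN; apply: le_lt_trans; apply: (le_trans (HM n)); exact: ler_norm.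
Qed.

Lemma theta_ctheta (x : C) : theta p x = ctheta x.
Proof.
have E : (fun N => \prod_(0 <= j < N) ((1 - p ^+ j * x) * (1 - p ^+ j.+1 / x))) =
    (fun N => tripart p N x).
  apply/funext => N; rewrite big_split /=; congr (_ * _).
  by apply: eq_bigr => j _; rewrite exprSr mulrA.
rewrite /theta E; apply/cvg_lim => //.
exact: (geolim_cvg (av_range cabs_absolute_value cabs_lt1) (tripart_geolim _ _ _ _)).
Qed.

End Theta.
End ComplexTheta.

(** * Degeneration to arbitrary parameters *)

Section GeometricContinuity.
Variables (R : realType) (K : fieldType) (nm : K -> R).
Hypothesis av : absolute_value nm.
Variable r : R.
Hypothesis r01 : 0 < r < 1.

Local Notation lim := (geolim nm r).
Let r0 : 0 < r. Proof. by case/andP: r01. Qed.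
Let r01' : 0 <= r < 1. Proof. by case/andP: r01 => /ltW -> ->. Qed.

(** The first n0 terms go into the constant through S, which divides by r^i; this is where r > 0
    enters. *)
Lemma geolim_eventually (u : nat -> K) l M n0 :
  (forall n, (n0 <= n)%N -> nm (u n - l) <= M * r ^+ n) -> lim u l.
Proof.
move=> H; pose S := \sum_(i < n0) nm (u i - l) / r ^+ i.
have S0 (P : pred 'I_n0) : 0 <= \sum_(i < n0 | P i) nm (u i - l) / r ^+ i.
  by apply: sumr_ge0 => i _; rewrite divr_ge0 ?(av_ge0 av) ?exprn_ge0 // ltW.
exists (`|M| + S) => n; have rn : 0 < r ^+ n by rewrite exprn_gt0.
have [n0n|nn0] := leqP n0 n.
  apply: le_trans (H n n0n) _; rewrite ler_wpM2r ?(ltW rn) //.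
  by have := ler_norm M; have := S0 predT; rewrite -/S; lra.
rewrite -ler_pdivrMr //.
have h := S0 (fun i => i != Ordinal nn0).
have -> : S = nm (u n - l) / r ^+ n + \sum_(i < n0 | i != Ordinal nn0) nm (u i - l) / r ^+ i.
  by rewrite /S (bigD1 (Ordinal nn0)).
by have := normr_ge0 M; lra.
Qed.

Lemma geolimV u l : lim u l -> l != 0 -> lim (fun n => (u n)^-1) l^-1.
Proof.
move=> [M H] l0; have nl0 : 0 < nm l by apply: (av_neq0 av).
have [n0 hn0] : exists n0, forall n, (n0 <= n)%N -> nm (u n - l) <= nm l / 2.
  have [n0 hn0] : exists n, `|M| * r ^+ n <= nm l / 2.
    apply: contrapT => /forallNP Hn.
    have : nm l / 2 <= 0.
      apply: (@le_of_geometric _ _ _ `|M| r) => // n.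
      by have /negP := Hn n; rewrite -ltNge add0r => /ltW.
    by lra.
  exists n0 => n n0n; apply: le_trans (H n) _; apply: le_trans hn0.
  apply: le_trans (_ : `|M| * r ^+ n <= _).
    by rewrite ler_wpM2r ?ler_norm ?exprn_ge0 // ltW.
  by rewrite ler_wpM2l // ler_wiXn2l // ltW //; case/andP: r01.
apply: (@geolim_eventually _ _ (M * (2 / (nm l * nm l))) n0) => n n0n.
have h1 := hn0 n n0n.
have h2 : nm l / 2 <= nm (u n).
  have := avD av (u n) (l - u n); rewrite subrKC (av_sub av l); lra.
have un0 : u n != 0 by apply: contraTneq h2 => ->; rewrite (av0 av) -ltNge; lra.
have nV x : x != 0 -> nm x^-1 = (nm x)^-1.
  move=> x0; have := avM av x x^-1; rewrite mulfV // (av1 av) => E.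
  by apply: (mulfI (lt0r_neq0 (av_neq0 av x0))); rewrite -E mulfV // lt0r_neq0 ?(av_neq0 av).
have -> : (u n)^-1 - l^-1 = (l - u n) * (u n * l)^-1 by field; rewrite un0 l0.
rewrite (avM av) nV ?mulf_neq0 // (avM av) (av_sub av l).
rewrite [leRHS]mulrAC; apply: ler_pM; rewrite ?(av_ge0 av) ?invr_ge0 ?mulr_ge0 ?(av_ge0 av) //.
have -> : 2 / (nm l * nm l) = (nm l / 2 * nm l)^-1.
  by have := gt_eqF nl0; move: (nm l) => x /negbT x0; field.
rewrite lef_pV2 ?posrE ?mulr_gt0 ?(av_neq0 av) ?divr_gt0 //.
by rewrite ler_wpM2r ?(av_ge0 av).
Qed.

Lemma geolim_sum (I : Type) (s : seq I) (P : pred I) (F : I -> nat -> K) (l : I -> K) :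
  (forall i, P i -> lim (F i) (l i)) ->
  lim (fun n => \sum_(i <- s | P i) F i n) (\sum_(i <- s | P i) l i).
Proof.
move=> H; elim: s => [|i s IH].
  have -> : (fun n => \sum_(i <- [::] | P i) F i n) = (fun=> 0).
    by apply: functional_extensionality => n; rewrite big_nil.
  by rewrite big_nil; apply: geolim_cst.
have -> : (fun n => \sum_(i <- i :: s | P i) F i n) =
    (fun n => if P i then F i n + \sum_(i <- s | P i) F i n else \sum_(i <- s | P i) F i n).
  by apply: functional_extensionality => n; rewrite big_cons.
by rewrite big_cons; case: ifP => // Pi; apply: geolimD => //; apply: H.
Qed.

Lemma geolim_prod (I : Type) (s : seq I) (P : pred I) (F : I -> nat -> K) (l : I -> K) :
  (forall i, P i -> lim (F i) (l i)) ->
  lim (fun n => \prod_(i <- s | P i) F i n) (\prod_(i <- s | P i) l i).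
Proof.
move=> H; elim: s => [|i s IH].
  have -> : (fun n => \prod_(i <- [::] | P i) F i n) = (fun=> 1).
    by apply: functional_extensionality => n; rewrite big_nil.
  by rewrite big_nil; apply: geolim_cst.
have -> : (fun n => \prod_(i <- i :: s | P i) F i n) =
    (fun n => if P i then F i n * \prod_(i <- s | P i) F i n else \prod_(i <- s | P i) F i n).
  by apply: functional_extensionality => n; rewrite big_cons.
by rewrite big_cons; case: ifP => // Pi; apply: (geolimM av r01') => //; apply: H.
Qed.

Lemma geolim_unique u a b : lim u a -> lim u b -> a = b.
Proof.
move=> Ha Hb; apply/eqP; rewrite -subr_eq0; apply/eqP.
by apply: (geolim_zero av r01' (geolimB av Ha Hb)) => n; rewrite subrr.
Qed.

Section Theta.
Hypothesis complete : geometrically_complete nm.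
Variable p : K.
Hypothesis p1 : nm p < 1.
Local Notation th := (thetaq av complete p1).

Lemma geolim_qinf u l : lim u l -> lim (fun n => qinf av complete p1 (u n)) (qinf av complete p1 l).
Proof.
move=> ul; have [B B0 HB] := geolim_bounded av r01' ul; case: ul => M HM.
pose rho := B + nm l.
have lr : nm l <= rho by rewrite /rho; lra.
have d0 : 0 < 1 - nm p by rewrite subr_gt0.
exists (qbound nm p rho ^+ 2 / (1 - nm p) * M) => n.
have ur : nm (u n) <= rho by have := HB n; have := av_ge0 av l; rewrite /rho; lra.
apply: le_trans (qinf_lip av complete p1 ur lr) _; rewrite -[leRHS]mulrA ler_wpM2l //.
by rewrite divr_ge0 ?exprn_ge0 ?expR_ge0 // ltW.
Qed.

Lemma geolim_thetaq u l : lim u l -> l != 0 -> lim (fun n => th (u n)) (th l).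
Proof.
move=> ul l0; apply: (geolimM av r01'); apply: geolim_qinf => //.
apply: (geolimM av r01'); [exact: geolim_cst | exact: geolimV].
Qed.

Lemma geolim_poch q u l k : q != 0 -> lim u l -> l != 0 ->
  lim (fun n => poch th q (u n) k) (poch th q l k).
Proof.
move=> q0 ul l0; apply: geolim_prod => i _; apply: geolim_thetaq.
  by apply: (geolimM av r01') => //; apply: geolim_cst.
by rewrite mulf_neq0 ?expf_neq0.
Qed.

End Theta.
End GeometricContinuity.

Section Degeneration.
Variables (R : realType) (K : fieldType) (nm : K -> R).
Hypothesis av : absolute_value nm.
Hypothesis complete : geometrically_complete nm.
Hypothesis sqrtK : forall x : K, exists y, y ^+ 2 = x.
Variable p : K.
Hypothesis p1 : nm p < 1.
Variables (r : R) (q : K) (n B : nat).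
Hypothesis r01 : 0 < r < 1.
Hypothesis q0 : q != 0.

Local Notation th := (thetaq av complete p1).
Local Notation po := (poch th q).
Local Notation lim := (geolim nm r).

Let r01' : 0 <= r < 1. Proof. by case/andP: r01 => /ltW -> ->. Qed.
Let qX i : q ^+ i != 0. Proof. exact: expf_neq0. Qed.

Let limC (x : K) : lim (fun=> x) x. Proof. exact: geolim_cst. Qed.
Let limM := geolimM av r01'.
Let limV := geolimV av r01.
Let limP := geolim_poch av r01 complete p1.
Let limT := geolim_thetaq av r01 complete p1.

Variables (z : 'I_n -> K) (m : 'I_n -> nat) (u : nat -> K).
Hypothesis z0 : forall k, z k != 0.
Hypothesis mB : forall k, (m k <= B)%N.

Local Notation M := (\sum_(k < n) m k)%N.

Lemma geolim_wp_part (a : nat -> K) a1 y Y : lim a a1 -> a1 != 0 ->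
  (forall k, th (a1 * z k) != 0) ->
  lim (fun i => wp_part th q (a i) z y Y) (wp_part th q a1 z y Y).
Proof.
move=> la a10 h; apply: (geolim_prod av r01) => k _; apply: limM.
  by apply: limT; rewrite ?mulf_neq0 //; apply: limM => //; apply: limM.
apply: limV => //; apply: limT; rewrite ?mulf_neq0 //; exact: limM.
Qed.

Lemma geolim_weight_part (a : nat -> K) a1 Y : lim a a1 -> a1 != 0 ->
  lim (fun i => weight_part th q (a i) z Y) (weight_part th q a1 z Y).
Proof.
move=> la a10; apply: (geolim_prod av r01) => k _.
by apply: limP; rewrite ?mulf_neq0 //; apply: limM.
Qed.

Lemma geolim_mixed_part (a : nat -> K) a1 y Y : lim a a1 -> a1 != 0 ->
  (forall j, po (a1 * q * (z j * q ^+ m j)) Y != 0) ->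
  (forall j, po (a1 * q / (z j * q ^+ m j)) Y != 0) ->
  lim (fun i => mixed_part th q (a i) m z y Y) (mixed_part th q a1 m z y Y).
Proof.
move=> la a10 h1 h2; apply: (geolim_prod av r01) => k _.
have laq : lim (fun i => a i * q) (a1 * q) by apply: limM.
apply: limM; first by apply: limP; rewrite ?mulf_neq0 ?invr_eq0 //; apply: limM.
apply: limV; last by rewrite mulf_neq0.
by apply: limM; apply: limP; rewrite ?mulf_neq0 ?invr_eq0 ?mulf_neq0 //; apply: limM.
Qed.

Lemma geolim_clear_part (a b : nat -> K) a1 b1 y : lim a a1 -> lim b b1 -> a1 != 0 -> b1 != 0 ->
  lim (fun i => clear_part th q (a i) (b i) m z y) (clear_part th q a1 b1 m z y).
Proof.
move=> la lb a10 b10; apply: (geolim_prod av r01) => k _.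
apply: limP; rewrite ?mulf_neq0 ?invr_eq0 //.
by apply: limM; [apply: limM => //; apply: limM | apply: limV].
Qed.

Lemma geolim_summand (a b : nat -> K) a1 b1 c d (y : 'I_n -> nat) :
  lim a a1 -> lim b b1 -> a1 != 0 -> b1 != 0 -> c != 0 -> d != 0 ->
  (forall k, th (a1 * z k) != 0) ->
  (forall j, po (a1 * q * (z j * q ^+ m j)) (\sum_(k < n) y k) != 0) ->
  (forall j, po (a1 * q / (z j * q ^+ m j)) (\sum_(k < n) y k) != 0) ->
  lim (fun i => summand th q (a i) (b i) c d m z y) (summand th q a1 b1 c d m z y).
Proof.
move=> la lb a10 b10 c0 d0 h0 h1 h2; rewrite /summand /=.
have lw := geolim_wp_part y (\sum_(k < n) y k) la a10 h0.
have lwt := geolim_weight_part (\sum_(k < n) y k) la a10.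
have lm := geolim_mixed_part y la a10 h1 h2.
have lpb := limP (\sum_(k < n) y k) q0 lb b10.
have lb1 := geolim_clear_part y la lb a10 b10.
have lb2 := geolim_clear_part y la (limC c) a10 c0.
have lb3 := geolim_clear_part y la (limC d) a10 d0.
by do ![apply: limM => //].
Qed.

Lemma geolim_product_side (a b : nat -> K) a1 b1 c d :
  lim a a1 -> lim b b1 -> a1 != 0 -> b1 != 0 -> c != 0 -> d != 0 ->
  (forall k, po (z k / a1) (m k) != 0) ->
  lim (fun i => product_side th q (a i) (b i) c d m z) (product_side th q a1 b1 c d m z).
Proof.
move=> la lb a10 b10 c0 d0 h; apply: (geolim_prod av r01) => k _.
have lV := limV la a10.
have zV : lim (fun i => z k / a i) (z k / a1) by apply: limM.
apply: limM; last by apply: limV => //; apply: limP; rewrite ?mulf_neq0 ?invr_eq0.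
by do ?[apply: limM]; apply: limP; rewrite ?mulf_neq0 ?invr_eq0 //; do ![apply: limM => //].
Qed.

(** The scaling (au, bu^2) preserves a^2 q = bcd with c and d fixed. In cleared form the vanishing
    of a denominator depends only on a and z, so both sides converge as u tends to 1. *)
Lemma cleared_sum_degenerate a b c d : a != 0 -> b != 0 -> c != 0 -> d != 0 ->
  a ^+ 2 * q = b * c * d -> lim u 1 -> (forall i, u i != 0) ->
  (forall i, generic th q z m (a * u i) (b * u i ^+ 2)) ->
  (forall k, th (a * z k) != 0) ->
  (forall j, po (a * q * (z j * q ^+ m j)) M != 0) ->
  (forall j, po (a * q / (z j * q ^+ m j)) M != 0) ->
  (forall k, po (z k / a) (m k) != 0) ->
  cleared_sum th q B a b c d m z = product_side th q a b c d m z.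
Proof.
move=> a0 b0 c0 d0 bcd lu u0 gen h0 h1 h2 h3.
have la : lim (fun i => a * u i) a by rewrite -[X in lim _ X]mulr1; apply: limM.
have lb : lim (fun i => b * u i ^+ 2) b.
  rewrite -[X in lim _ X]mulr1 -[X in lim _ (_ * X)](expr1n K 2) expr2.
  by apply: limM => //; apply: limM.
have E i : cleared_sum th q B (a * u i) (b * u i ^+ 2) c d m z =
    product_side th q (a * u i) (b * u i ^+ 2) c d m z.
  apply: cleared_sum_eq => //.
  - exact: thetaq1.
  - exact: thetaqV.
  - by move=> x t v w x0 t0 v0 w0; apply: thetaW.
  - by rewrite mulf_neq0.
  - by rewrite mulf_neq0 ?expf_neq0.
  - by rewrite exprMn mulrAC bcd; ring.
have P := geolim_product_side la lb a0 b0 c0 d0 h3.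
have S : lim (fun i => cleared_sum th q B (a * u i) (b * u i ^+ 2) c d m z)
    (cleared_sum th q B a b c d m z).
  apply: (geolim_sum av) => y /forallP ym.
  have yM : (\sum_(k < n) y k <= M)%N by apply: leq_sum => k _; apply: ym.
  apply: geolim_summand => // j.
  - by apply: poch_neq0 => i iy; apply: (poch_factor_neq0 (h1 j)); apply: leq_trans yM.
  - by apply: poch_neq0 => i iy; apply: (poch_factor_neq0 (h2 j)); apply: leq_trans yM.
apply: (geolim_unique av r01 S).
by rewrite (_ : (fun i => _) = (fun i => product_side th q (a * u i) (b * u i ^+ 2) c d m z)) //;
  apply: functional_extensionality.
Qed.

End Degeneration.

(** * Generic parameters close to the given ones *)

Lemma avoid_countable (R : realType) (I : countType) (f : I -> R) (a b : R) : a < b ->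
  exists u, a < u < b /\ forall i, f i != u.
Proof.
move=> ab; apply: contrapT => H.
have sub : (`]a, b[ `<=` [set f i | i in [set: I]])%classic.
  move=> u /=; rewrite in_itv /= => uab; apply: contrapT => nf; apply: H; exists u; split=> // i.
  by apply/eqP => E; apply: nf; exists i.
have cnt : countable (`]a, b[%classic : set R).
  by apply: sub_countable (card_le_trans (subset_card_le sub) (card_image_le f setT)) _; apply: countableP.
have := countable_lebesgue_measure0 cnt.
rewrite lebesgue_measure_itv /= lte_fin ab -EFinD => /eqP.
by rewrite eqe subr_eq0 gt_eqF.
Qed.

Section AvoidZeros.
Variables (R : realType) (p : R[i]).
Hypothesis p1 : `|p| < 1.

(** By [thetaq_zero], theta has countably many zeros, so the values of u or u^2 to be avoided are
    countable; their real parts are what the real number u is compared with. *)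
Lemma avoid_theta_zeros (I : countType) (al : I -> R[i]) (e : R) : 0 < e ->
  (forall i, al i != 0) ->
  exists u : R, 1 < u < 1 + e /\
    forall i, ctheta p1 (al i * u%:C%C) != 0 /\ ctheta p1 (al i * u%:C%C ^+ 2) != 0.
Proof.
move=> e0 al0.
pose root (x : I * nat * bool) : R := let: (i, n, b) := x in
  complex.Re (if b then (p ^+ n * al i)^-1 else p ^+ n.+1 / al i).
(* The boolean [b] distinguishes the conditions on u from those on u^2. *)
pose f (x : I * nat * bool * bool) : R := let: (y, b) := x in
  if b then root y else Num.sqrt (root y).
have [|u [u1 uf]] := @avoid_countable R _ f 1 (1 + e); first by rewrite ltrDl.
have u0 : 0 <= u by case/andP: u1 => /ltW + _; apply: le_trans.
exists u; split=> // i.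
have key (w : R[i]) : w != 0 -> ctheta p1 (al i * w) = 0 -> exists y, complex.Re w = root (i, y.1, y.2).
  move=> w0 /thetaq_zero [[n En]|[n En]].
    exists (n, true) => /=; congr complex.Re; apply: (mulfI (al0 i)).
    have pn : p ^+ n != 0 by apply: contra_eq_neq En => ->; rewrite mul0r eq_sym oner_eq0.
    by apply: (mulfI pn); rewrite En mulrA mulfV // mulf_neq0.
  exists (n, false) => /=; congr complex.Re; apply: (mulfI (al0 i)).
  rewrite [RHS]mulrC divfK //.
  by move/(congr1 ( *%R^~ (al i * w))): En; rewrite mul1r divfK // mulf_neq0.
have uC0 : u%:C%C != 0.
  by rewrite -(rmorph0 (real_complex R)) (inj_eq (@complexI _)) gt_eqF //; case/andP: u1 => /(lt_trans ltr01).
split; apply/eqP.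
  move=> /(key _ uC0) [[n b] /= E].
  by have := uf (i, n, b, true); rewrite /f /root -E eqxx.
move=> /(key _ (expf_neq0 2 uC0)) [[n b] E].
have := uf (i, n, b, false); rewrite /f -[root _]E -rmorphXn /= sqrtr_sqr ger0_norm //.
by rewrite eqxx.
Qed.

End AvoidZeros.

(** * From cleared terms back to quotients *)

Section FieldTranslation.
Variables (K : fieldType) (th : K -> K) (q : K) (n : nat).
Local Notation po := (poch th q).
Variables (z : 'I_n -> K) (m : 'I_n -> nat) (a b c d : K).

Definition clearing (e : K) : K := \prod_(k < n) po (a * q * z k / e) (m k).

Lemma clear_part_quotient e (y : 'I_n -> nat) :
  (forall k, po (a * q * z k / e) (m k) != 0) -> (forall k, (y k <= m k)%N) ->
  clear_part th q a e m z y = clearing e / \prod_(k < n) po (a * q * z k / e) (y k).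
Proof.
move=> h ym; rewrite -prodf_div; apply: eq_bigr => k _.
by rewrite poch_tail //; congr (po _ _); rewrite [RHS]mulrAC -!mulrA.
Qed.

Lemma summand_quotient (y : 'I_n -> nat) :
  (forall k, po (a * q * z k / b) (m k) != 0) ->
  (forall k, po (a * q * z k / c) (m k) != 0) ->
  (forall k, po (a * q * z k / d) (m k) != 0) -> (forall k, (y k <= m k)%N) ->
  let Y := (\sum_(k < n) y k)%N in
  summand th q a b c d m z y =
  ((\prod_(j < n) \prod_(k < n | (j < k)%N) vdm th (z j * q ^+ y j) (z k * q ^+ y k)) /
     (\prod_(j < n) \prod_(k < n | (j < k)%N) vdm th (z j) (z k))
   * (\prod_(k < n) (th (a * z k * q ^+ (y k + Y)) / th (a * z k)))
   * (\prod_(j < n) \prod_(k < n | (j < k)%N) (1 / po (z j * z k) (y j + y k)))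
   * (\prod_(j < n) \prod_(k < n) (po (z k / (z j * q ^+ m j)) (y k) *
        po (z j * q ^+ m j * z k) (y k) / po (q * z k / z j) (y k)))
   * (\prod_(j < n) (po (a * z j) Y * po (a * q / z j) (Y - y j) /
        (po (a * q * (z j * q ^+ m j)) Y * po (a * q / (z j * q ^+ m j)) Y)))
   * (po b Y * po c Y * po d Y / \prod_(k < n) (po (a * q * z k / b) (y k) *
        po (a * q * z k / c) (y k) * po (a * q * z k / d) (y k)))
   * q ^+ Y) * (clearing b * clearing c * clearing d).
Proof.
move=> hb hc hd ym Y; rewrite /summand -/Y !clear_part_quotient //.
have -> : vand_part th q z y =
    (\prod_(j < n) \prod_(k < n | (j < k)%N) vdm th (z j * q ^+ y j) (z k * q ^+ y k)) /
     (\prod_(j < n) \prod_(k < n | (j < k)%N) vdm th (z j) (z k)) *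
    (\prod_(j < n) \prod_(k < n | (j < k)%N) (1 / po (z j * z k) (y j + y k))).
  rewrite -prodf_div -big_split /=; apply: eq_bigr => j _.
  rewrite -prodf_div -big_split /=; apply: eq_bigr => k _.
  by rewrite mul1r.
have -> : \prod_(j < n) \prod_(k < n) (po (z k / (z j * q ^+ m j)) (y k) *
        po (z j * q ^+ m j * z k) (y k) / po (q * z k / z j) (y k)) =
    num_part th q m z y / den_part th q z y.
  by rewrite -prodf_div; apply: eq_bigr => j _; rewrite prodf_div.
have -> : \prod_(j < n) (po (a * z j) Y * po (a * q / z j) (Y - y j) /
        (po (a * q * (z j * q ^+ m j)) Y * po (a * q / (z j * q ^+ m j)) Y)) =
    weight_part th q a z Y * mixed_part th q a m z y Y.
  by rewrite -big_split /=; apply: eq_bigr => j _; rewrite -[LHS]mulrA.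
rewrite -/(wp_part th q a z y Y) !big_split /= !invfM; ring.
Qed.

Lemma product_side_quotient :
  (forall k, po (a * q * z k / b) (m k) != 0) ->
  (forall k, po (a * q * z k / c) (m k) != 0) ->
  (forall k, po (a * q * z k / d) (m k) != 0) ->
  product_side th q a b c d m z =
  \prod_(k < n) (po (a * q * z k) (m k) * po (b * z k / a) (m k) * po (c * z k / a) (m k)
    * po (d * z k / a) (m k) / (po (z k / a) (m k) * po (a * q * z k / b) (m k) *
       po (a * q * z k / c) (m k) * po (a * q * z k / d) (m k))) *
  (clearing b * clearing c * clearing d).
Proof.
move=> hb hc hd; rewrite /clearing -!big_split /=; apply: eq_bigr => k _.
have := hb k; have := hc k; have := hd k; rewrite !invfM.
move: (po (a * q * z k / b) _) (po (a * q * z k / c) _) (po (a * q * z k / d) _) (po (z k / a) _)^-1.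
by move=> u v w x w0 v0 u0; field; rewrite u0 v0 w0.
Qed.

(** The index type of the theorem depends on m; the fixed box is the one that the induction runs
    on. *)
Lemma sum_multirange (F : ('I_n -> nat) -> K) (B : nat) : (forall k, (m k <= B)%N) ->
  \sum_(y : {dffun forall k, 'I_(m k).+1}) F (fun k => nat_of_ord (y k)) =
  \sum_(y : {ffun 'I_n -> 'I_B.+1} | below m y) F (fun k => nat_of_ord (y k)).
Proof.
move=> mB.
pose h (y : {dffun forall k, 'I_(m k).+1}) : {ffun 'I_n -> 'I_B.+1} := [ffun k => inord (y k)].
pose h' (y : {ffun 'I_n -> 'I_B.+1}) : {dffun forall k, 'I_(m k).+1} := [ffun k => inord (y k)].
have hE y k : nat_of_ord (h y k) = y k.
  by rewrite ffunE inordK // ltnS; apply: leq_trans (mB k); rewrite -ltnS.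
rewrite [RHS](reindex_onto h h') /=; last first.
  move=> y /forallP ym; apply/ffunP => k; apply: val_inj.
  by rewrite /= hE ffunE inordK // ltnS.
apply: eq_big => [y|y _]; last by congr F; apply: functional_extensionality => k; rewrite hE.
apply/esym/andP; split; first by apply/forallP => k; rewrite hE -ltnS.
by apply/eqP/ffunP => k; rewrite ffunE hE inord_val.
Qed.

End FieldTranslation.

Lemma cleared_identity (R : realType) (p q : R[i]) (p1 : `|p| < 1) (n B : nat)
    (z : 'I_n -> R[i]) (m : 'I_n -> nat) (a b c d : R[i]) :
  q != 0 -> (forall k, z k != 0) -> (forall k, (m k <= B)%N) ->
  a != 0 -> b != 0 -> c != 0 -> d != 0 -> a ^+ 2 * q = b * c * d ->
  let th := theta p in
  (forall j k i i', j != k -> (i <= m k)%N -> (i' <= m j)%N ->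
    th (z k * q ^+ i / (z j * q ^+ i')) != 0) ->
  (forall k i, (0 < i <= m k)%N -> th (q ^+ i) != 0) ->
  (forall j k i i', j != k -> (i <= m j)%N -> (i' <= m k)%N ->
    (i + i' < m j + m k)%N -> th (z j * q ^+ i * (z k * q ^+ i')) != 0) ->
  (forall k, th (a * z k) != 0) ->
  (forall j, poch th q (a * q * (z j * q ^+ m j)) (\sum_(k < n) m k) != 0) ->
  (forall j, poch th q (a * q / (z j * q ^+ m j)) (\sum_(k < n) m k) != 0) ->
  (forall k, poch th q (z k / a) (m k) != 0) ->
  cleared_sum th q B a b c d m z = product_side th q a b c d m z.
Proof.
move=> q0 z0 mB a0 b0 c0 d0 bcd th.
have thE : th = ctheta p1 by apply: functional_extensionality => x; apply: theta_ctheta.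
rewrite thE => h1 h2 h3 h4 h5 h6 h7.
have qX i : q ^+ i != 0 by apply: expf_neq0.
(* One summand each for [gen_a], [gen_aV], [gen_b] and [gen_ba]. Passing to (au, bu^2) multiplies
   the arguments by u, and by u^2 in [gen_b]. *)
pose I := ('I_n * nat + 'I_n * nat + 'I_n * 'I_n * nat + 'I_n * nat)%type.
pose al (x : I) : R[i] := match x with
  | inl (inl (inl (k, i))) => a * z k * q ^+ i
  | inl (inl (inr (k, i))) => a * q ^+ i.+1 / (z k * q ^+ m k)
  | inl (inr (j, k, i)) => b * (z j * z k) * q ^+ i
  | inr (k, i) => b * z k * q ^+ i / a end.
have al0 x : al x != 0.
  by case: x => [[[[k i]|[k i]]|[[j k] i]]|[k i]] /=; rewrite ?mulf_neq0 ?invr_eq0 ?mulf_neq0.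
have ex N := @avoid_theta_zeros R p p1 I al (2^-1 ^+ N)
  (exprn_gt0 N (ltac:(by rewrite invr_gt0) : 0 < 2^-1 :> R)) al0.
pose u N := projT1 (cid (ex N)).
have uP N : 1 < u N < 1 + 2^-1 ^+ N /\ forall i, ctheta p1 (al i * (u N)%:C%C) != 0 /\
    ctheta p1 (al i * (u N)%:C%C ^+ 2) != 0 by apply: (projT2 (cid (ex N))).
have uC0 N : (u N)%:C%C != 0.
  rewrite -(rmorph0 (real_complex R)) (inj_eq (@complexI _)) gt_eqF //.
  by have [/andP[/(lt_trans ltr01)]] := uP N.
have half01 : 0 < (2^-1 : R) < 1 by rewrite invr_gt0 /= invf_lt1 // ltr1n ltr0n.
have limu : geolim (@cabs R) 2^-1 (fun N => (u N)%:C%C) 1.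
  exists 1 => N; have [/andP[u1 u2] _] := uP N.
  rewrite mul1r -(rmorph1 (real_complex R)) -rmorphB /cabs normc_def /= expr0n addr0 sqrtr_sqr.
  by rewrite ger0_norm; lra.
apply: (@cleared_sum_degenerate R _ _ (cabs_absolute_value R) (@cabs_complete R) (@csqrt_exists R)
  p (cabs_lt1 p1) (2^-1) q n B half01 q0 z m (fun N => (u N)%:C%C) z0 mB a b c d
  a0 b0 c0 d0 bcd limu uC0 _ h4 h5 h6 h7).
move=> N; have [_ av] := uP N; have w0 := uC0 N.
move: av w0; move: (_%:C%C) => w av w0.
split=> //.
- move=> k i; have [h _] := av (inl (inl (inl (k, i)))); move: h => /=.
  by rewrite (_ : a * z k * q ^+ i * w = a * w * z k * q ^+ i) //; ring.
- move=> k i; have [h _] := av (inl (inl (inr (k, i)))); move: h => /=.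
  by rewrite (_ : a * q ^+ i.+1 / (z k * q ^+ m k) * w = a * w * q ^+ i.+1 / (z k * q ^+ m k)) //; ring.
- move=> j k i; have [_ h] := av (inl (inr (j, k, i))); move: h => /=.
  by rewrite (_ : b * (z j * z k) * q ^+ i * w ^+ 2 = b * w ^+ 2 * (z j * z k) * q ^+ i) //; ring.
- move=> k i; have [h _] := av (inr (k, i)); move: h => /=.
  rewrite (_ : b * z k * q ^+ i / a * w = b * w ^+ 2 * z k * q ^+ i / (a * w)) //.
  by move: (q ^+ i) => v; field; rewrite a0 w0.
Qed.

(** * Genericity of z from the nonvanishing denominators *)

Section DenominatorConditions.
Variables (K : fieldType) (th : K -> K) (q : K) (n : nat).
Local Notation po := (poch th q).
Hypothesis q0 : q != 0.
Hypothesis thV : forall x, x != 0 -> th x^-1 = - th x / x.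
Variables (z : 'I_n -> K) (m : 'I_n -> nat) (a b c d : K).
Hypothesis z0 : forall k, z k != 0.

Let qX i : q ^+ i != 0. Proof. exact: expf_neq0. Qed.

Hypothesis hlt : forall j k : 'I_n, (j < k)%N -> th (z k / z j) != 0.
Hypothesis hqz : forall j k, po (q * z k / z j) (m k) != 0.

Lemma ratio_power_neq0 j k i : (0 < i <= m k)%N -> th (z k * q ^+ i / z j) != 0.
Proof.
case: i => // i /andP[_ im]; have := poch_factor_neq0 (hqz j k) im.
by rewrite (_ : q * z k / z j * q ^+ i = z k * q ^+ i.+1 / z j) // exprS; ring.
Qed.

(** After cancelling the common power of q, a positive exponent falls under [hqz], if need be after
    inverting the argument, and exponent zero falls under [hlt]. *)
Lemma ratio_neq0 j k i i' : j != k -> (i <= m k)%N -> (i' <= m j)%N ->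
  th (z k * q ^+ i / (z j * q ^+ i')) != 0.
Proof.
move=> jk im im'; case: (ltngtP i i') => [ii|ii|->].
- have := ratio_power_neq0 k (k := j) (i := (i' - i)%N).
  rewrite (_ : z k * q ^+ i / (z j * q ^+ i') = (z j * q ^+ (i' - i) / z k)^-1).
    move=> h; apply: th_inv_neq0 => //; last by apply: h; clear -ii im'; lia.
    by rewrite !mulf_neq0 ?invr_eq0.
  rewrite -{1}(subnK (ltnW ii)) exprD; have := qX (i' - i); have := qX i; have := z0 k; have := z0 j.
  move: (q ^+ _) (q ^+ _) (z j) (z k) => x y v w v0 w0 x0 y0.
  by field; rewrite x0 y0 v0 w0.
- have := ratio_power_neq0 j (k := k) (i := (i - i')%N).
  rewrite (_ : z k * q ^+ i / (z j * q ^+ i') = z k * q ^+ (i - i') / z j).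
    by apply; clear -ii im; lia.
  rewrite -{1}(subnK (ltnW ii)) exprD; have := qX i'; have := z0 j.
  move: (q ^+ i') (q ^+ _) (z j) (z k) => x y v w v0 x0.
  by field; rewrite x0 v0.
- rewrite -mulf_div divff // mulr1; move: jk; rewrite neq_ltn => /orP[|kj]; first exact: hlt.
  by rewrite -invf_div; apply: th_inv_neq0 => //; [rewrite mulf_neq0 ?invr_eq0 | apply: hlt].
Qed.

Lemma power_neq0 k i : (0 < i <= m k)%N -> th (q ^+ i) != 0.
Proof.
by move=> /(ratio_power_neq0 k); rewrite mulrAC divff // mul1r.
Qed.

Hypothesis hzz : forall j k : 'I_n, (j < k)%N -> po (z j * z k) (m j + m k) != 0.

Lemma product_neq0 j k i i' : j != k -> (i <= m j)%N -> (i' <= m k)%N ->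
  (i + i' < m j + m k)%N -> th (z j * q ^+ i * (z k * q ^+ i')) != 0.
Proof.
move=> jk _ _ ii; have -> : z j * q ^+ i * (z k * q ^+ i') = z j * z k * q ^+ (i + i').
  by rewrite exprD; ring.
move: jk; rewrite neq_ltn => /orP[jk|kj]; first exact: poch_factor_neq0 (hzz jk) ii.
by rewrite (mulrC (z j)); apply: poch_factor_neq0 (hzz kj) _; rewrite (addnC (m k)).
Qed.

End DenominatorConditions.

(** * Division by the clearing products, in the notation of the theorem *)

Section Epochs.
Variables (K : numFieldType) (p q : K).
Local Notation po := (poch (theta p) q).

Lemma epochs2 x y k : epochs p q [:: x; y] k = po x k * po y k.
Proof. by rewrite /epochs !big_cons big_nil mulr1. Qed.

Lemma epochs3 x y w k : epochs p q [:: x; y; w] k = po x k * po y k * po w k.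
Proof. by rewrite /epochs !big_cons big_nil mulr1 !mulrA. Qed.

Lemma epochs4 x y w v k : epochs p q [:: x; y; w; v] k = po x k * po y k * po w k * po v k.
Proof. by rewrite /epochs !big_cons big_nil mulr1 !mulrA. Qed.

Lemma epochs_neq0 s k x : epochs p q s k != 0 -> x \in s -> po x k != 0.
Proof. by rewrite /epochs prodf_seq_neq0 => /allP H xs; have := H x xs. Qed.

Lemma epochs_identity (n B : nat) (m : 'I_n -> nat) (a b c d : K) (z : 'I_n -> K) :
  q != 0 -> (forall k, (m k <= B)%N) ->
  (forall k, po (a * q * z k / b) (m k) != 0) ->
  (forall k, po (a * q * z k / c) (m k) != 0) ->
  (forall k, po (a * q * z k / d) (m k) != 0) ->
  cleared_sum (theta p) q B a b c d m z = product_side (theta p) q a b c d m z ->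
  \sum_(y : multirange m)
    (evandermonde p (fun k => z k * q ^+ y k) / evandermonde p z
     * (\prod_(k < n)
          (theta p (a * z k * q ^+ (y k + mweight y)) / theta p (a * z k)))
     * (\prod_(j < n) \prod_(k < n | (j < k)%N)
          (1 / epoch p q (z j * z k) (y j + y k)))
     * (\prod_(j < n) \prod_(k < n)
          (epochs p q [:: q ^- m j * z k / z j; q ^+ m j * z j * z k] (y k)
           / epoch p q (q * z k / z j) (y k)))
     * (\prod_(j < n)
          (epoch p q (a * z j) (mweight y)
           * epoch p q (a * q / z j) (mweight y - y j)
           / epochs p q [:: a * q ^+ (1 + m j) * z j;
                            a * q ^ (1 - (m j)%:Z) / z j] (mweight y)))
     * (epochs p q [:: b; c; d] (mweight y)
        / (\prod_(k < n)
             epochs p q [:: a * q * z k / b; a * q * z k / c; a * q * z k / d]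
               (y k)))
     * q ^+ mweight y)
  = \prod_(k < n)
      (epochs p q [:: a * q * z k; b * z k / a; c * z k / a; d * z k / a] (m k)
       / epochs p q [:: z k / a; a * q * z k / b; a * q * z k / c;
                        a * q * z k / d] (m k)).
Proof.
move=> q0 mB hb1 hb2 hb3 main.
have eA j : a * q ^+ (1 + m j) * z j = a * q * (z j * q ^+ m j) by rewrite exprD expr1; ring.
have eV j : a * q ^ (1 - (m j)%:Z) / z j = a * q / (z j * q ^+ m j).
  by rewrite (expfzDr 1 _ q0) expr1z -invr_expz invfM; ring.
pose clr := clearing (theta p) q z m a b * clearing (theta p) q z m a c * clearing (theta p) q z m a d.
have clr0 : clr != 0.
  by rewrite !mulf_neq0 //; apply/prodf_neq0 => k _.
apply: (mulIf clr0).
transitivity (product_side (theta p) q a b c d m z); last first.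
  rewrite product_side_quotient // -/clr; congr (_ * _); apply: eq_bigr => k _.
  by rewrite !epochs4.
rewrite -main /cleared_sum.
rewrite -(sum_multirange (fun y => summand (theta p) q a b c d m z y) mB) mulr_suml.
apply: eq_bigr => y _.
have yle k : (y k <= m k)%N by rewrite -ltnS.
rewrite summand_quotient // -/clr; congr (_ * _).
rewrite -[(\sum_(k < n) y k)%N]/(mweight y).
congr (_ * _ * _ * _ * _ * _ * _).
- apply: eq_bigr => j _; apply: eq_bigr => k _.
  rewrite epochs2.
  rewrite (_ : q ^- m j * z k / z j = z k / (z j * q ^+ m j)); last by rewrite invfM; ring.
  by rewrite (mulrC (q ^+ m j) (z j)).
- apply: eq_bigr => j _; by rewrite epochs2 eA eV.
- rewrite epochs3; congr (_ / _).
  by apply: eq_bigr => k _; rewrite epochs3.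
Qed.

End Epochs.

Theorem corollary6p3 (R : realType) (p q : R[i]) (hp : `|p| < 1) (hq : q != 0)
  (n : nat) (hn : (1 <= n)%N) (m : 'I_n -> nat)
  (a b c d : R[i]) (z : 'I_n -> R[i])
  (ha : a != 0) (hb : b != 0) (hc : c != 0) (hd : d != 0)
  (hz : forall k, z k != 0)
  (habcd : a ^+ 2 * q = b * c * d)
  (* no denominator on the left-hand side vanishes *)
  (hDelta : evandermonde p z != 0)
  (htheta : forall k, theta p (a * z k) != 0)
  (hzz : forall (y : multirange m) (j k : 'I_n), (j < k)%N ->
     epoch p q (z j * z k) (y j + y k) != 0)
  (hqzz : forall (y : multirange m) (j k : 'I_n),
     epoch p q (q * z k / z j) (y k) != 0)
  (haqz : forall (y : multirange m) (j : 'I_n),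
     epochs p q [:: a * q ^+ (1 + m j) * z j; a * q ^ (1 - (m j)%:Z) / z j]
       (mweight y) != 0)
  (hbcd : forall (y : multirange m) (k : 'I_n),
     epochs p q [:: a * q * z k / b; a * q * z k / c; a * q * z k / d]
       (y k) != 0)
  (* no denominator on the right-hand side vanishes *)
  (hrhs : forall k,
     epochs p q [:: z k / a; a * q * z k / b; a * q * z k / c; a * q * z k / d]
       (m k) != 0) :
  \sum_(y : multirange m)
    (evandermonde p (fun k => z k * q ^+ y k) / evandermonde p z
     * (\prod_(k < n)
          (theta p (a * z k * q ^+ (y k + mweight y)) / theta p (a * z k)))
     * (\prod_(j < n) \prod_(k < n | (j < k)%N)
          (1 / epoch p q (z j * z k) (y j + y k)))
     * (\prod_(j < n) \prod_(k < n)
          (epochs p q [:: q ^- m j * z k / z j; q ^+ m j * z j * z k] (y k)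
           / epoch p q (q * z k / z j) (y k)))
     * (\prod_(j < n)
          (epoch p q (a * z j) (mweight y)
           * epoch p q (a * q / z j) (mweight y - y j)
           / epochs p q [:: a * q ^+ (1 + m j) * z j;
                            a * q ^ (1 - (m j)%:Z) / z j] (mweight y)))
     * (epochs p q [:: b; c; d] (mweight y)
        / (\prod_(k < n)
             epochs p q [:: a * q * z k / b; a * q * z k / c; a * q * z k / d]
               (y k)))
     * q ^+ mweight y)
  = \prod_(k < n)
      (epochs p q [:: a * q * z k; b * z k / a; c * z k / a; d * z k / a] (m k)
       / epochs p q [:: z k / a; a * q * z k / b; a * q * z k / c;
                        a * q * z k / d] (m k)).
Proof.
(* The largest multi-index y = m: its symbols contain the factors of those of every other y. *)
pose ym : multirange m := [ffun k => ord_max].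
have ymE k : nat_of_ord (ym k) = m k by rewrite ffunE.
have ymW : mweight ym = (\sum_(k < n) m k)%N by apply: eq_bigr => k _; rewrite ymE.
have thV x : x != 0 -> theta p x^-1 = - theta p x / x.
  by move=> x0; rewrite !(theta_ctheta hp); apply: thetaqV.
have hlt (j k : 'I_n) : (j < k)%N -> theta p (z k / z j) != 0.
  move=> jk; move: hDelta; rewrite /evandermonde => /prodf_neq0 /(_ j isT) /prodf_neq0 /(_ k jk).
  by rewrite mulf_eq0 negb_or => /andP[].
have hqz j k : poch (theta p) q (q * z k / z j) (m k) != 0.
  by have := hqzz ym j k; rewrite ymE.
have hzz' (j k : 'I_n) : (j < k)%N -> poch (theta p) q (z j * z k) (m j + m k) != 0.
  by move=> jk; have := hzz ym j k jk; rewrite !ymE.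
have qV j : q ^ (1 - (m j)%:Z) = q / q ^+ m j by rewrite expfzDr // expr1z -invr_expz.
have eA j : a * q ^+ (1 + m j) * z j = a * q * (z j * q ^+ m j) by rewrite exprD expr1; ring.
have eV j : a * q ^ (1 - (m j)%:Z) / z j = a * q / (z j * q ^+ m j).
  by rewrite qV invfM; ring.
have hA j : poch (theta p) q (a * q * (z j * q ^+ m j)) (\sum_(k < n) m k) != 0.
  by rewrite -ymW -eA; apply: (epochs_neq0 (haqz ym j)); apply: mem_head.
have hV j : poch (theta p) q (a * q / (z j * q ^+ m j)) (\sum_(k < n) m k) != 0.
  by rewrite -ymW -eV; apply: (epochs_neq0 (haqz ym j)); rewrite inE mem_head orbT.
have hb' k : poch (theta p) q (a * q * z k / b) (m k) != 0 /\
    poch (theta p) q (a * q * z k / c) (m k) != 0 /\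
    poch (theta p) q (a * q * z k / d) (m k) != 0.
  have h := epochs_neq0 (hbcd ym k); rewrite ymE in h.
  by split; [|split]; apply: h; rewrite !inE eqxx ?orbT.
have hza k : poch (theta p) q (z k / a) (m k) != 0.
  by apply: (epochs_neq0 (hrhs k)); apply: mem_head.
have hb1 k := (hb' k).1; have hb2 k := (hb' k).2.1; have hb3 k := (hb' k).2.2.
pose B := (\sum_(k < n) m k)%N.
have mB k : (m k <= B)%N by rewrite /B (bigD1 k) //= leq_addr.
have main := cleared_identity hp hq hz mB ha hb hc hd habcd
  (ratio_neq0 hq thV hz hlt hqz) (power_neq0 hz hqz) (product_neq0 hzz')
  htheta hA hV hza.
exact: epochs_identity hq mB hb1 hb2 hb3 main.
Qed.
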